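(* Let $n\in\mathbb N$, $q>1$ and $p\in(\tfrac23 q+1,\,q+\tfrac23)$. Then the functional $\mathrm{intM}^{(p,q)}$ is $C^1$ on the subspace of all regular embedded curves in $W^{(3p-2)/q-1,q}(\mathbb R/\mathbb Z,\mathbb R^n)$. Moreover, for any arc-length parametrized embedded $\gamma\in W^{(3p-2)/q-1,q}(\mathbb R/\mathbb Z,\mathbb R^n)$ and any $h\in W^{(3p-2)/q-1,q}(\mathbb R/\mathbb Z,\mathbb R^n)$, the first variation of $\mathrm{intM}^{(p,q)}$ at $\gamma$ in direction $h$ amounts to $$\begin{aligned}\delta\,\mathrm{intM}^{(p,q)}(\gamma,h)=\iiint_{(\mathbb R/\mathbb Z)^3}\Bigg\{&2q\,\frac{|\triangle_{v,0}\gamma\wedge\triangle_{w,0}\gamma|^{q-2}}{(|\triangle_{v,w}\gamma||\triangle_{v,0}\gamma||\triangle_{w,0}\gamma|)^p}\,\langle\triangle_{v,0}\gamma\wedge\triangle_{w,0}\gamma,\ \triangle_{v,0}\gamma\wedge\triangle_{w,0}h\rangle\\ &-3p\,\frac{|\triangle_{v,0}\gamma\wedge\triangle_{w,0}\gamma|^{q}}{(|\triangle_{v,w}\gamma||\triangle_{v,0}\gamma||\triangle_{w,0}\gamma|)^p}\cdot\frac{\langle\triangle_{v,w}\gamma,\triangle_{v,w}h\rangle}{|\triangle_{v,w}\gamma|^2}\\ &+3\,\frac{|\triangle_{v,0}\gamma\wedge\triangle_{w,0}\gamma|^{q}}{(|\triangle_{v,w}\gamma||\triangle_{v,0}\ga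mma||\triangle_{w,0}\gamma|)^p}\,\langle\gamma'(u),h'(u)\rangle\Bigg\}\,dw\,dv\,du.\end{aligned}$$
   Context: Notation: $\triangle_{v,w}f=f(u+v)-f(u+w)$. On bivectors, $\langle a\wedge b,c\wedge d\rangle=\langle a,c\rangle\langle b,d\rangle-\langle a,d\rangle\langle b,c\rangle$ and $|a\wedge b|^2=\langle a\wedge b,a\wedge b\rangle$. The expression $|\omega|^{q-2}\langle\omega,\cdot\rangle$ is read as $0$ when $\omega=0$. For an absolutely continuous curve $\gamma:\mathbb R/\mathbb Z\to\mathbb R^n$ the generalized integral Menger curvature is $$\mathrm{intM}^{(p,q)}(\gamma)=\iiint_{(\mathbb R/\mathbb Z)^3}\frac{|(y-x)\wedge(z-x)|^q}{(|y-z||y-x||z-x|)^p}\,|\gamma'(u_1)||\gamma'(u_2)||\gamma'(u_3)|\,du_1\,du_2\,du_3,$$ with $x=\gamma(u_1)$, $y=\gamma(u_2)$, $z=\gamma(u_3)$. The first variation is $\delta\,\mathrm{intM}^{(p,q)}(\gamma,h)=\frac{d}{d\tau}\big|_{\tau=0}\mathrm{intM}^{(p,q)}(\gamma+\tau h)$. A curve is regular if there is $c>0$ with $|\gamma'|\ge c$ a.e.; embedded means injective; arc-length parametrized means $|\gamma'|=1$. Sobolev–Slobodeckij spaces: for $s\in(0,1)$, $\rho\in[1,\infty)$, $W^{1+s,\rho}(\mathbb R/\mathbb Z,\mathbb R^n)$ is the set of $f\in W^{1,\rho}$ with finite norm $\|f\|_{W^{1+s,\rho}}=\|f\|_{W^{1,\rho}}+[f]_{W^{1+s,\rho}}$,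 where $[f]_{W^{1+s,\rho}}=\left(\int_{\mathbb R/\mathbb Z}\int_{-1/2}^{1/2}\frac{|f'(u+w)-f'(u)|^\rho}{|w|^{1+\rho s}}\,dw\,du\right)^{1/\rho}$. For the given $p,q$ one has $(3p-2)/q-1\in(1+\tfrac1q,2)$, and the space embeds into $C^1$, so the regular embedded curves form an open subset.
   Formalization: The triple integral in the first-variation formula is a principal value (removing symmetric neighbourhoods where two of u, u+v, u+w coincide), since its first term is in general not absolutely integrable near w = v; it equals the Lebesgue integral whenever that exists. *)

(* Defs.v *)
(* Functions on the circle R/Z are represented by 1-periodic functions on R. *)
From HB Require Import structures.
From mathcomp Require Import all_boot all_order all_algebra.
From mathcomp Require Import all_classical all_reals all_analysis.

Set Implicit Arguments.
Unset Strict Implicit.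
Unset Printing Implicit Defensive.

Import Order.TTheory GRing.Theory Num.Theory.
Import numFieldNormedType.Exports.

Local Open Scope classical_set_scope.
Local Open Scope ring_scope.

Section Euclidean.
Context {R : realType} {n : nat}.
Implicit Types a b c d : 'rV[R]_n.

(* The library norm on ['rV[R]_n] is the sup norm, hence [enorm]. *)
Definition edot a b : R := \sum_(i < n) a 0 i * b 0 i.
Definition enorm a : R := Num.sqrt (edot a a).

(* <a /\ b, c /\ d> and |a /\ b|; only simple bivectors occur. *)
Definition wedge_dot a b c d : R := edot a c * edot b d - edot a d * edot b c.
Definition wedge_norm a b : R := Num.sqrt (wedge_dot a b a b).

End Euclidean.

Section Sobolev.
Context {R : realType} {n : nat}.
Local Notation mu := (@lebesgue_measure R).
Implicit Types (s rho : R) (f : R -> 'rV[R]_n).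

Definition W1_norm rho f : \bar R :=
  ((\int[mu]_(u in `[0%R, 1%R]) (enorm (f u) `^ rho)%:E) `^ rho^-1 +
   (\int[mu]_(u in `[0%R, 1%R]) (enorm (derive1 f u) `^ rho)%:E) `^ rho^-1)%E.

(* W^{1,rho}(R/Z, R^n): the periodic functions that are primitives of their
   (a.e. existing, classical) derivative, with derivative in L^rho.  This picks
   the absolutely continuous representative of each class.  The value of
   [derive1 f] at points where [f] is not differentiable is irrelevant. *)
Definition W1 rho f : Prop :=
  [/\ periodic f 1,
      forall i, measurable_fun [set: R] (fun u => derive1 f u 0 i),
      forall (a b : R) i, a <= b ->
        f b 0 i - f a 0 i = \int[mu]_(u in `[a, b]) (derive1 f u 0 i)
    & (W1_norm rho f < +oo)%E].

Definition slobodeckij_seminorm s rho f : \bar R :=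
  ((\int[mu]_(u in `[0%R, 1%R]) \int[mu]_(w in `[(- 2^-1)%R, (2^-1)%R])
     (enorm (derive1 f (u + w) - derive1 f u) `^ rho
        / `|w| `^ (1 + rho * s))%:E)
   `^ rho^-1)%E.

(* Everything below is indexed by [s], for the space W^{1+s,rho}. *)
Definition W1s_norm s rho f : \bar R :=
  (W1_norm rho f + slobodeckij_seminorm s rho f)%E.

Definition W1s s rho : set (R -> 'rV[R]_n) :=
  [set f | W1 rho f /\ (W1s_norm s rho f < +oo)%E].

End Sobolev.

Section ContinuouslyDifferentiable.
Context {R : realType} {V : lmodType R}.

(* [F] is continuously Frechet differentiable at the points of [U], where [U]
   is a subset (open, in the intended use) of the subspace [X] of [V] normed by
   [N], and [L g] is the derivative at [g]: for each [g] in [U], [L g] is a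
   bounded linear form on [X] with F (g + h) = F g + L g h + o(N h) for h in X,
   and [L] is continuous for the operator norm of the dual of [X]. *)
Definition C1_on (X : set V) (N : V -> \bar R) (U : set V) (F : V -> R) :=
  exists L : V -> V -> R,
    [/\ forall g, U g -> forall (a : R) h k, X h -> X k ->
          L g (a *: h + k) = a * L g h + L g k,
        forall g, U g -> exists M : R, forall h, X h ->
          (`|L g h|%:E <= M%:E * N h)%E,
        forall g, U g -> forall e : R, 0 < e -> exists2 d : R, 0 < d &
          forall h, X h -> (N h <= d%:E)%E ->
            (`|F (g + h)%R - F g - L g h|%:E <= e%:E * N h)%E
      & forall g, U g -> forall e : R, 0 < e -> exists2 d : R, 0 < d &
          forall k, U k -> (N (k - g)%R <= d%:E)%E ->
            forall h, X h -> (`|L k h - L g h|%:E <= e%:E * N h)%E].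

End ContinuouslyDifferentiable.

Section TripleIntegrals.
Context {R : realType}.
Local Notation mu := (@lebesgue_measure R).
Implicit Types (g : R -> R -> R -> R) (D : set (R * R * R)).

(* Fundamental domain of (R/Z)^3. *)
Definition torus3 : set (R * R * R) :=
  [set t | [/\ 0 <= t.1.1 <= 1, 0 <= t.1.2 <= 1 & 0 <= t.2 <= 1]].

Definition integral3 D g : \bar R :=
  (\int[mu \x mu \x mu]_(t in D) (g t.1.1 t.1.2 t.2)%:E)%E.

Definition integrable3 D g : Prop :=
  (mu \x mu \x mu)%E.-integrable D (fun t => (g t.1.1 t.1.2 t.2)%:E).

Definition circle_far (e t : R) : Prop := forall k : int, e <= `|t - k%:~R|.

(* Points (u, v, w) for which u, u + v, u + w have pairwise distance at least
   [e] in R/Z. *)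
Definition torus3_far (e : R) : set (R * R * R) :=
  torus3 `&` [set t | [/\ circle_far e t.1.2, circle_far e t.2
                        & circle_far e (t.1.2 - t.2)]].

(* Principal value of the integral of g(u, v, w) over (R/Z)^3, singular where
   two of u, u + v, u + w coincide: the limit of the integrals over
   [torus3_far e].  By dominated convergence it is the Lebesgue integral over
   [torus3] whenever g is integrable there.  It is needed because the density
   of the first variation below is in general not absolutely integrable: its
   first term is of order |v - w|^(q - 1 - p) as w tends to v, and converges
   only thanks to the cancellation given by the symmetry (v, w) -> (w, v),
   which preserves [torus3_far e]. *)
Definition is_pv_integral3 g (l : R) : Prop :=
  (forall e : R, 0 < e -> integrable3 (torus3_far e) g) /\
  integral3 (torus3_far e) g @[e --> 0^'+] --> l%:E.

End TripleIntegrals.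

Section Menger.
Context {R : realType} {n : nat}.
Local Notation mu := (@lebesgue_measure R).
Implicit Types (p q : R) (gamma h f : R -> 'rV[R]_n).

Definition regular gamma : Prop :=
  exists2 c : R, 0 < c & {ae mu, forall u, c <= enorm (derive1 gamma u)}.

(* Injectivity on R/Z. *)
Definition embedded gamma : Prop :=
  forall x y, gamma x = gamma y -> exists k : int, x - y = k%:~R.

Definition arclength gamma : Prop :=
  {ae mu, forall u, enorm (derive1 gamma u) = 1}.

(* Where the denominator vanishes the density is 0 ([x / 0 = 0]); for an
   embedded curve this concerns a null set only. *)
Definition intM_density p q gamma (u1 u2 u3 : R) : R :=
  let x := gamma u1 in let y := gamma u2 in let z := gamma u3 in
  wedge_norm (y - x) (z - x) `^ q
    / (enorm (y - z) * enorm (y - x) * enorm (z - x)) `^ p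
  * enorm (derive1 gamma u1) * enorm (derive1 gamma u2)
  * enorm (derive1 gamma u3).

Definition intM p q gamma : \bar R := integral3 torus3 (intM_density p q gamma).

(* The real-valued functional ([intM] is finite on the curves of interest). *)
Definition intMr p q gamma : R := fine (intM p q gamma).

Definition first_variation p q gamma h : R :=
  derive1 (fun tau : R => intMr p q (gamma + tau *: h)) 0.

(* f(u + v) - f(u + w) *)
Definition tri f (u v w : R) : 'rV[R]_n := f (u + v) - f (u + w).

(* Where [om = 0] the factor [wedge_dot _ _ _ _] vanishes (Cauchy-Schwarz), so
   the first term is then 0, for every value of [q]. *)
Definition variation_density p q gamma h (u v w : R) : R :=
  let den := (enorm (tri gamma u v w) * enorm (tri gamma u v 0)
              * enorm (tri gamma u w 0)) `^ p in
  let om := wedge_norm (tri gamma u v 0) (tri gamma u w 0) in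
  2 * q * (om `^ (q - 2) / den)
    * wedge_dot (tri gamma u v 0) (tri gamma u w 0)
                (tri gamma u v 0) (tri h u w 0)
  - 3 * p * (om `^ q / den)
    * (edot (tri gamma u v w) (tri h u v w) / enorm (tri gamma u v w) ^+ 2)
  + 3 * (om `^ q / den) * edot (derive1 gamma u) (derive1 h u).

End Menger.

(* Main.v *)
Require Import Defs.
From HB Require Import structures.
From mathcomp Require Import all_boot all_order all_algebra.
From mathcomp Require Import all_classical all_reals all_analysis.
From mathcomp Require Import measurable_realfun ring lra.

Set Implicit Arguments.
Unset Strict Implicit.
Unset Printing Implicit Defensive.

Import Order.TTheory GRing.Theory Num.Theory.
Import numFieldNormedType.Exports.

Local Open Scope classical_set_scope.
Local Open Scope ring_scope.

(* The integrand of [intM] is |(y - x) /\ (z - x)|^q times powers of the lengths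
   of six vectors, the three sides of the triangle and the three velocities.
   For a bi-Lipschitz curve a C^1 perturbation changes these six vectors by a
   small relative amount, so the only delicate quantity is the bivector, which
   may vanish while its perturbation does not.  The key estimate bounds its
   polarization: if f and g lie in W^{(3p-2)/q-1,q}, then the integral over the
   torus of
     |(f_y - f_x) /\ (g_z - g_x) + (g_y - g_x) /\ (f_z - f_x)|^q
       / (|y - z| |y - x| |z - x|)^p
   is at most a constant times the q-th power of the product of the norms.  To
   see this, take x as the middle one of the three points, at distances v and w
   from y and z, and compare the difference quotients of f and g with the
   derivatives at x; one of the two integrations can then be carried out
   explicitly, and a weighted Hardy inequality for
   (f (u + v) - f u) / v - f' u gives back the Gagliardo seminorm of f'.

   With S the sum of the norms of the normalized polarized bivectors, the
   pointwise increments of the integrand, and of its formal derivative, are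
   o(1) S^q / (|y - z| |y - x| |z - x|)^p, and the key estimate integrates this
   bound.  The derivative obtained in this way is an absolutely convergent
   integral that is symmetric in the three points.  Removing a symmetric
   neighbourhood of the diagonals makes each of its summands bounded, and the
   symmetry then merges them into the three terms of the stated formula, whose
   principal value is therefore the first variation. *)

(** * Euclidean norms and bivectors *)

(** The bivector of two chords at x is quadratic in the curve, so its derivative at gamma in
    direction h is a polarization. A single summand of it, such as (gamma_y - gamma_x) /\ (h_z -
    h_x), is only of size v w. In the sum of both summands the leading parts, multiples of gamma' /\
    h' + h' /\ gamma' = 0, cancel, and v w times Taylor errors of the difference quotients remains;
    the stated formula keeps one summand only. This also fixes the exponents: what has to be
    integrated is the q-th power of such an error times (v w)^(q - p) (v + w)^(- p). Integration in
    one variable converges at 0 because p < q + 1 and at infinity because q + 1 < 2 p, and leaves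
    the weight v^(- (3 p - 2 q - 1)), which for s = (3 p - 2) / q - 2 is exactly the Gagliardo
    weight v^(- (1 + q s)). The assumption p > 2 q / 3 + 1 says q s > 1, the condition for the
    embedding into C^1. *)

Section EuclideanTheory.
Context {R : realType} {m : nat}.
Implicit Types a b c d : 'rV[R]_m.

Lemma edotC a b : edot a b = edot b a.
Proof. by apply: eq_bigr => i _; rewrite mulrC. Qed.

Lemma edotDl a b c : edot (a + b) c = edot a c + edot b c.
Proof. by rewrite -big_split; apply: eq_bigr => i _; rewrite mxE mulrDl. Qed.

Lemma edotZl x a b : edot (x *: a) b = x * edot a b.
Proof. by rewrite mulr_sumr; apply: eq_bigr => i _; rewrite mxE mulrA. Qed.

Lemma edotNl a b : edot (- a) b = - edot a b.
Proof. by rewrite -scaleN1r edotZl mulN1r. Qed.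

Lemma edotBl a b c : edot (a - b) c = edot a c - edot b c.
Proof. by rewrite edotDl edotNl. Qed.

Lemma edotDr a b c : edot a (b + c) = edot a b + edot a c.
Proof. by rewrite edotC edotDl edotC (edotC a c). Qed.

Lemma edotZr x a b : edot a (x *: b) = x * edot a b.
Proof. by rewrite edotC edotZl edotC. Qed.

Lemma edotNr a b : edot a (- b) = - edot a b.
Proof. by rewrite edotC edotNl edotC. Qed.

Lemma edotBr a b c : edot a (b - c) = edot a b - edot a c.
Proof. by rewrite edotDr edotNr. Qed.

Lemma edot0l a : edot 0 a = 0.
Proof. by rewrite -(scale0r 0) edotZl mul0r. Qed.

Lemma edot_ge0 a : 0 <= edot a a.
Proof. by apply: sumr_ge0 => i _; rewrite -expr2 sqr_ge0. Qed.

Lemma enorm_ge0 a : 0 <= enorm a.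
Proof. exact: sqrtr_ge0. Qed.

Lemma enorm_sqr a : enorm a ^+ 2 = edot a a.
Proof. by rewrite sqr_sqrtr// edot_ge0. Qed.

Lemma edot_eq0 a : (edot a a == 0) = (a == 0).
Proof.
apply/eqP/eqP => [h|->]; last by rewrite edot0l.
apply/rowP => i; rewrite mxE.
move: h => /psumr_eq0P h.
have /eqP : a 0 i * a 0 i = 0 by apply: h => // j _; rewrite -expr2 sqr_ge0.
by rewrite -expr2 sqrf_eq0 => /eqP.
Qed.

Lemma enorm_eq0 a : (enorm a == 0) = (a == 0).
Proof. by rewrite -sqrf_eq0 enorm_sqr edot_eq0. Qed.

Lemma enorm0 : enorm (0 : 'rV[R]_m) = 0.
Proof. by apply/eqP; rewrite enorm_eq0. Qed.

Lemma enorm_gt0 a : (0 < enorm a) = (a != 0).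
Proof. by rewrite lt_def enorm_eq0 enorm_ge0 andbT. Qed.

Lemma enormZ x a : enorm (x *: a) = `|x| * enorm a.
Proof. by rewrite /enorm edotZl edotZr mulrA -expr2 sqrtrM ?sqr_ge0// sqrtr_sqr. Qed.

Lemma enormN a : enorm (- a) = enorm a.
Proof. by rewrite -scaleN1r enormZ normrN1 mul1r. Qed.

Lemma enormBC a b : enorm (a - b) = enorm (b - a).
Proof. by rewrite -opprB enormN. Qed.

Lemma edot_sqr_le a b : edot a b ^+ 2 <= edot a a * edot b b.
Proof.
have [b0|b0] := eqVneq b 0; first by rewrite b0 edotC !edot0l expr0n mulr0.
have bb : 0 < edot b b by rewrite lt_def edot_eq0 b0 edot_ge0.
have := edot_ge0 (edot b b *: a - edot a b *: b).
rewrite edotBl !edotBr !edotZl !edotZr (edotC b a) => h.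
have {h} : 0 <= edot b b * (edot a a * edot b b - edot a b ^+ 2).
  by move: h; congr (_ <= _); ring.
by rewrite pmulr_rge0// subr_ge0.
Qed.

Lemma cauchy_schwarz a b : `|edot a b| <= enorm a * enorm b.
Proof.
rewrite -(@ler_pXn2r _ 2)// ?nnegrE ?mulr_ge0 ?enorm_ge0//.
by rewrite exprMn !enorm_sqr real_normK ?num_real// edot_sqr_le.
Qed.

Lemma enormD a b : enorm (a + b) <= enorm a + enorm b.
Proof.
rewrite -(@ler_pXn2r _ 2)// ?nnegrE ?addr_ge0 ?enorm_ge0//.
rewrite sqrrD !enorm_sqr edotDl !edotDr (edotC b a).
have := le_trans (ler_norm _) (cauchy_schwarz a b).
lra.
Qed.

Lemma enormB a b : enorm (a - b) <= enorm a + enorm b.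
Proof. by rewrite -(enormN b) enormD. Qed.

Lemma enorm_subr_le a b : enorm a - enorm b <= enorm (a + b).
Proof. by rewrite lerBlDr -[X in enorm X <= _](addrK b) enormB. Qed.

Lemma coord_le_enorm a i : `|a 0 i| <= enorm a.
Proof.
rewrite -(@ler_pXn2r _ 2)// ?nnegrE ?enorm_ge0//.
rewrite enorm_sqr real_normK ?num_real// /edot (bigD1 i)//= -expr2 lerDl.
by apply: sumr_ge0 => j _; rewrite -expr2 sqr_ge0.
Qed.

Lemma enorm_le_sum a : enorm a <= \sum_i `|a 0 i|.
Proof.
rewrite -(@ler_pXn2r _ 2)// ?nnegrE ?enorm_ge0//; last exact: sumr_ge0.
rewrite enorm_sqr expr2 mulr_suml; apply: ler_sum => i _.
have : `|a 0 i| * `|a 0 i| <= `|a 0 i| * \sum_i `|a 0 i|.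
  rewrite ler_wpM2l// (bigD1 i)//= lerDl; exact: sumr_ge0.
by apply: le_trans; rewrite -normrM ler_norm.
Qed.

End EuclideanTheory.

Section Bivectors.
Context {R : realType} {n : nat}.
Implicit Types a b c d : 'rV[R]_n.

(* Simple bivectors, realized as antisymmetric matrices so that [edot] of two
   of them is [wedge_dot]. *)
Definition bivec a b : 'rV[R]_(n * n) :=
  mxvec (\matrix_(i, j) ((Num.sqrt 2)^-1 * (a 0 i * b 0 j - a 0 j * b 0 i))).

Lemma edot_mxvec (A B : 'M[R]_n) :
  edot (mxvec A) (mxvec B) = \sum_i \sum_j A i j * B i j.
Proof.
rewrite /edot pair_big_dep /=.
rewrite (reindex _ (curry_mxvec_bij _ _)) /=.
by apply: eq_bigr => -[i j] _ /=; rewrite !mxvecE.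
Qed.

(** In the antisymmetric matrix every pair i < j occurs twice; the factor (sqrt 2)^-1 in [bivec]
    compensates for it. *)
Lemma edot_bivec a b c d : edot (bivec a b) (bivec c d) = wedge_dot a b c d.
Proof.
rewrite edot_mxvec.
under eq_bigr do under eq_bigr do rewrite !mxE.
have s2 : (Num.sqrt 2)^-1 * (Num.sqrt 2)^-1 = 2^-1 :> R.
  by rewrite -invfM -expr2 sqr_sqrtr// ler0n.
transitivity (2^-1 * \sum_i \sum_j
    (a 0 i * c 0 i * (b 0 j * d 0 j) + b 0 i * d 0 i * (a 0 j * c 0 j) -
     (a 0 i * d 0 i * (b 0 j * c 0 j) + b 0 i * c 0 i * (a 0 j * d 0 j)))).
  rewrite mulr_sumr; apply: eq_bigr => i _; rewrite mulr_sumr.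
  by apply: eq_bigr => j _; rewrite mulrACA s2; congr (_ * _); ring.
under eq_bigr do rewrite sumrB !big_split /= -!mulr_sumr.
rewrite sumrB !big_split /= -!mulr_suml -!/(edot _ _) /wedge_dot.
by field.
Qed.

Lemma enorm_bivec a b : enorm (bivec a b) = wedge_norm a b.
Proof. by rewrite /enorm edot_bivec. Qed.

Lemma bivecDl a b c : bivec (a + b) c = bivec a c + bivec b c.
Proof. by rewrite -linearD; congr mxvec; apply/matrixP => i j; rewrite !mxE; ring. Qed.

Lemma bivecZl x a b : bivec (x *: a) b = x *: bivec a b.
Proof. by rewrite -linearZ; congr mxvec; apply/matrixP => i j; rewrite !mxE; ring. Qed.

Lemma bivecC a b : bivec a b = - bivec b a.
Proof. by rewrite -linearN; congr mxvec; apply/matrixP => i j; rewrite !mxE; ring. Qed.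

Lemma bivecDr a b c : bivec a (b + c) = bivec a b + bivec a c.
Proof. by rewrite bivecC bivecDl opprD -!bivecC. Qed.

Lemma bivecZr x a b : bivec a (x *: b) = x *: bivec a b.
Proof. by rewrite bivecC bivecZl -scalerN -bivecC. Qed.

Lemma bivecNl a b : bivec (- a) b = - bivec a b.
Proof. by rewrite -scaleN1r bivecZl scaleN1r. Qed.

Lemma bivecNr a b : bivec a (- b) = - bivec a b.
Proof. by rewrite -scaleN1r bivecZr scaleN1r. Qed.

Lemma bivecBr a b c : bivec a (b - c) = bivec a b - bivec a c.
Proof. by rewrite bivecDr bivecNr. Qed.

Lemma enorm_bivec_le a b : enorm (bivec a b) <= enorm a * enorm b.
Proof.
rewrite -(@ler_pXn2r _ 2)// ?nnegrE ?mulr_ge0 ?enorm_ge0//.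
rewrite enorm_sqr edot_bivec exprMn !enorm_sqr /wedge_dot (edotC b a).
by rewrite gerBl -expr2 sqr_ge0.
Qed.

End Bivectors.

Section Powers.
Context {R : realType}.
Implicit Types (a b e x y S : R).

Lemma powR_le_mono a x y : 0 <= a -> 0 <= x -> x <= y -> x `^ a <= y `^ a.
Proof.
move=> a0 x0 xy; apply: ge0_ler_powR => //; rewrite nnegrE//.
exact: le_trans xy.
Qed.

Lemma powR_predE a x : 0 < x -> x `^ (a - 1) = x `^ (a - 2) * x.
Proof.
move=> x0; rewrite -[X in _ * X]powRr1 ?ltW// -powRD ?(gt_eqF x0) ?implybT//.
by congr powR; lra.
Qed.

(** The bound 1/2 on k serves later to keep |W + d| within a factor 2 of |W|. *)
Lemma powR_near1 b e : 0 < e ->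
  exists2 k, 0 < k <= 2^-1 & forall x, `|x - 1| <= k -> `|x `^ b - 1| <= e.
Proof.
move=> e0.
have : {for (1 : R), continuous (fun x => x `^ b)}.
  apply/differentiable_continuous/derivable1_diffP.
  exact: (@ex_derive _ _ _ _ _ _ _ (is_derive1_powR b ltr01)).
move=> /cvgrPdist_le /(_ e e0).
move=> /nbhs_normP[r /= r0 h].
exists (Num.min (r / 2) 2^-1) => [|x].
  by rewrite lt_min ge_min lexx orbT divr_gt0// invr_gt0 ltr0n.
rewrite le_min => /andP[xr _]; have p1 : 1 `^ b = 1 by rewrite powR1.
rewrite distrC -p1; apply: h => /=.
by rewrite distrC (le_lt_trans xr)// ltr_pdivrMr// ltr_pMr// ltr1n.
Qed.

End Powers.

(** * Increments of powers of the norm and of their gradients *)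

Section PowerGradient.
Context {R : realType} {m : nat}.
Implicit Types (a q e S : R) (W B d eta : 'rV[R]_m).

(* The derivative of [fun W => enorm W `^ a] at [W] is [a * psi a W]. *)
Definition psi a W eta : R := enorm W `^ (a - 2) * edot W eta.

Lemma psiD a W B eta : psi a W (B + eta) = psi a W B + psi a W eta.
Proof. by rewrite /psi edotDr mulrDr. Qed.

Lemma psiZ a W x eta : psi a W (x *: eta) = x * psi a W eta.
Proof. by rewrite /psi edotZr; ring. Qed.

Lemma psi0 a eta : psi a 0 eta = 0.
Proof. by rewrite /psi edot0l mulr0. Qed.

Lemma psi_le a W eta : `|psi a W eta| <= enorm W `^ (a - 1) * enorm eta.
Proof.
have [->|W0] := eqVneq W 0.
  by rewrite psi0 normr0 mulr_ge0 ?powR_ge0 ?enorm_ge0.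
rewrite normrM ger0_norm ?powR_ge0//.
rewrite powR_predE ?enorm_gt0// -mulrA.
by rewrite ler_wpM2l ?powR_ge0// cauchy_schwarz.
Qed.

Lemma enorm_ratio k W d : W != 0 -> enorm d <= k * enorm W ->
  `|enorm (W + d) / enorm W - 1| <= k.
Proof.
move=> W0 dW; have W0' : 0 < enorm W by rewrite enorm_gt0.
rewrite (_ : _ - 1 = (enorm (W + d) - enorm W) / enorm W); last first.
  by rewrite mulrBl divff ?gt_eqF.
rewrite normrM [X in _ * X]ger0_norm ?invr_ge0 ?enorm_ge0//.
rewrite ler_pdivrMr// (le_trans _ dW)// ler_norml.
have := enormD W d; have := enorm_subr_le W d; lra.
Qed.

(** By homogeneity only the ratio |W + d| / |W| matters, which reduces the claim to continuity of
    the power at 1. For W = 0 the hypothesis forces d = 0. *)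
Lemma powR_rel a e : 0 < e -> exists2 k : R, 0 < k <= 2^-1 &
  forall W d, enorm d <= k * enorm W ->
  `|enorm (W + d) `^ a - enorm W `^ a| <= e * enorm W `^ a.
Proof.
move=> /(powR_near1 a)[k k0 h]; exists k => // W d dW.
have [W0|W0] := eqVneq W 0.
  have : enorm d <= 0 by rewrite (le_trans dW)// W0 enorm0 mulr0.
  rewrite le_eqVlt ltNge enorm_ge0 orbF enorm_eq0 => /eqP ->.
  rewrite addr0 subrr normr0 mulr_ge0 ?powR_ge0//.
  by rewrite (le_trans _ (h 1 _))// subrr normr0; case/andP: k0 => /ltW.
have W0' : 0 < enorm W by rewrite enorm_gt0.
rewrite -[enorm (W + d)](@divfK _ (enorm W)) ?gt_eqF//.
rewrite powRM ?divr_ge0 ?enorm_ge0// -[X in _ - X]mul1r -mulrBl normrM.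
rewrite [`|enorm W `^ a|]ger0_norm ?powR_ge0// ler_wpM2r ?powR_ge0//.
exact/h/enorm_ratio.
Qed.

(** The exponent is arbitrary because two cases occur: q for the bivector and 0 for the logarithmic
    derivative of the other factors. *)
Lemma psi_rel a e : 0 < e -> exists2 k : R, 0 < k <= 2^-1 &
  forall W d eta, enorm d <= k * enorm W ->
  `|psi a (W + d) eta - psi a W eta| <= e * enorm W `^ (a - 1) * enorm eta.
Proof.
move=> e0; have e4 : 0 < e / 4 by rewrite divr_gt0.
have [k /andP[k0 k2] h] := powR_rel (a - 2) e4.
(* k controls the change of the factor |W|^(a - 2), and e / 2 the change of the inner product. *)
exists (Num.min k (e / 2)) => [|W d eta].
  by rewrite lt_min k0 ge_min k2 divr_gt0.
have [->|W0] := eqVneq W 0.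
  rewrite enorm0 mulr0 => dW; have /eqP : enorm d = 0.
    by apply: le_anti; rewrite dW enorm_ge0.
  rewrite enorm_eq0 => /eqP ->; rewrite addr0 subrr normr0.
  by rewrite !mulr_ge0 ?powR_ge0 ?enorm_ge0// ltW.
have W0' : 0 < enorm W by rewrite enorm_gt0.
rewrite minr_pMl ?enorm_ge0// le_min => /andP[/[dup] dk /h{}h de].
have -> : psi a (W + d) eta - psi a W eta =
    (enorm (W + d) `^ (a - 2) - enorm W `^ (a - 2)) * edot (W + d) eta +
    enorm W `^ (a - 2) * edot d eta by rewrite /psi edotDl; ring.
rewrite (powR_predE a W0').
have P0 := powR_ge0 (enorm W) (a - 2).
apply: le_trans (ler_normD _ _) _; rewrite !normrM (ger0_norm P0).
have c1 : `|edot (W + d) eta| <= 2 * enorm W * enorm eta.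
  apply: le_trans (cauchy_schwarz _ _) _; rewrite ler_wpM2r ?enorm_ge0//.
  apply: le_trans (enormD _ _) _; apply: le_trans (lerD (lexx _) dk) _.
  have := ler_wpM2r (ltW W0') k2; lra.
have c2 : `|edot d eta| <= e / 2 * enorm W * enorm eta.
  apply: le_trans (cauchy_schwarz _ _) _; rewrite ler_wpM2r ?enorm_ge0//.
have := ler_pM (normr_ge0 _) (normr_ge0 _) h c1.
have := ler_wpM2l P0 c2.
set X := enorm W `^ (a - 2); lra.
Qed.

(* The smallness [2 * (2 * d / k) `^ (q - 1) <= e] covers the case where the
   increment is not small with respect to [W]. *)
Lemma small_powR (q e k : R) : 1 < q -> 0 < e -> 0 < k <= 1 -> exists2 d : R, 0 < d <= 1 &
  forall d' : R, 0 <= d' <= d -> 2 * (2 * d' / k) `^ (q - 1) <= e.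
Proof.
move=> q1 e0 /andP[k0 k1]; pose d0 := k / 2 * (e / 2) `^ (q - 1)^-1.
exists (Num.min d0 1) => [|d' /andP[d'0]].
  by rewrite lt_min ge_min lexx orbT ltr01 !mulr_gt0// ?powR_gt0 ?divr_gt0// invr_gt0.
rewrite le_min => /andP[dd _].
have q0 : 0 < q - 1 by rewrite subr_gt0.
have h : 2 * d' / k <= (e / 2) `^ (q - 1)^-1.
  rewrite ler_pdivrMr//; apply: le_trans (ler_wpM2l _ dd) _ => //.
  by rewrite /d0; lra.
have h0 : 0 <= 2 * d' / k by rewrite divr_ge0 ?mulr_ge0// ltW.
have := powR_le_mono (ltW q0) h0 h.
rewrite -powRrM mulVf ?gt_eqF// powRr1; last by rewrite divr_ge0// ltW.
lra.
Qed.

Lemma far_case (k d S : R) W (dl : 'rV[R]_m) : 0 < k -> enorm dl <= d * S -> k * enorm W < enorm dl ->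
  enorm W <= d / k * S.
Proof.
move=> k0 dS kW; rewrite mulrAC ler_pdivlMr// mulrC (le_trans _ dS)// ltW//.
Qed.

(** Here the increment is small only against S, not against W. Either it is small against W as well
    and [psi_rel] applies, or |W| is at most (d' / k) S and both gradients are bounded by a small
    multiple of S^(q - 1), as q > 1. This keeps the zeros of the bivector harmless also for q < 2,
    where the gradient is not Lipschitz. *)
Lemma psi_diff q e : 1 < q -> 0 < e -> exists2 d : R, 0 < d <= 1 &
  forall (d' : R) W dl eta S, 0 <= d' <= d -> 0 <= S -> enorm W <= S ->
  enorm dl <= d' * S ->
  `|psi q (W + dl) eta - psi q W eta| <= e * S `^ (q - 1) * enorm eta.
Proof.
move=> q1 e0; have [k /andP[k0 k2] h] := psi_rel q e0.
have k1 : k <= 1 by lra.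
have [d d01 hd] := small_powR q1 e0 (introT andP (conj k0 k1)).
exists d => // d' W dl eta S d'd S0 WS dS.
have q0 : 0 <= q - 1 by rewrite subr_ge0 ltW.
have [dk|kd] := leP (enorm dl) (k * enorm W).
  apply: le_trans (h _ _ _ dk) _.
  rewrite ler_wpM2r ?enorm_ge0// ler_wpM2l ?(ltW e0)//.
  by rewrite powR_le_mono ?enorm_ge0.
have Wd := far_case k0 dS kd; case/andP: (d'd) => d'0 _.
have dk0 : 0 <= d' / k by rewrite divr_ge0// ltW.
have d'k : d' <= d' / k by rewrite ler_pdivlMr// ler_piMr.
have hW : enorm W <= 2 * d' / k * S by rewrite -mulrA; nra.
have hWd : enorm (W + dl) <= 2 * d' / k * S.
  apply: le_trans (enormD _ _) _; rewrite -mulrA; nra.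
apply: le_trans (ler_normB _ _) _.
apply: le_trans (lerD (psi_le _ _ _) (psi_le _ _ _)) _.
rewrite -mulrDl ler_wpM2r ?enorm_ge0//.
apply: le_trans (lerD (powR_le_mono q0 (enorm_ge0 _) hWd)
  (powR_le_mono q0 (enorm_ge0 _) hW)) _.
rewrite powRM//; last by rewrite -mulrA mulr_ge0.
have := ler_wpM2r (powR_ge0 S (q - 1)) (hd _ d'd); lra.
Qed.

Lemma powR_diff q e : 1 < q -> 0 < e -> exists2 d : R, 0 < d <= 1 &
  forall (d' : R) W dl S, 0 <= d' <= d -> 0 <= S -> enorm W <= S ->
  enorm dl <= d' * S ->
  `|enorm (W + dl) `^ q - enorm W `^ q| <= e * S `^ q.
Proof.
move=> q1 e0; have [k /andP[k0 k2] h] := powR_rel q e0.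
have k1 : k <= 1 by lra.
(* [small_powR] bounds a power whose exponent is lowered by one, so it is used at q + 1 to obtain
   the exponent q. *)
have q2 : 1 < q + 1 by lra.
have [d d01 hd] := small_powR q2 e0 (introT andP (conj k0 k1)).
exists d => // d' W dl S d'd S0 WS dS.
have q0 : 0 <= q by lra.
have [dk|kd] := leP (enorm dl) (k * enorm W).
  apply: le_trans (h _ _ dk) _; rewrite ler_wpM2l ?(ltW e0)//.
  by rewrite powR_le_mono ?enorm_ge0.
have Wd := far_case k0 dS kd; case/andP: (d'd) => d'0 _.
have dk0 : 0 <= d' / k by rewrite divr_ge0// ltW.
have d'k : d' <= d' / k by rewrite ler_pdivlMr// ler_piMr.
have hW : enorm W <= 2 * d' / k * S by rewrite -mulrA; nra.
have hWd : enorm (W + dl) <= 2 * d' / k * S.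
  apply: le_trans (enormD _ _) _; rewrite -mulrA; nra.
apply: le_trans (ler_normB _ _) _; rewrite !ger0_norm ?powR_ge0//.
apply: le_trans (lerD (powR_le_mono q0 (enorm_ge0 _) hWd)
  (powR_le_mono q0 (enorm_ge0 _) hW)) _.
rewrite powRM//; last by rewrite -mulrA mulr_ge0.
have := ler_wpM2r (powR_ge0 S q) (hd _ d'd); rewrite (_ : q + 1 - 1 = q); lra.
Qed.

End PowerGradient.

(** * Products of powers of norms *)

Section Density.
Context {R : realType} {m n : nat} {J : Type}.
Implicit Types (s : seq J) (a : J -> R) (y f h : J -> 'rV[R]_n).
Implicit Types (W d eta : 'rV[R]_m) (q e : R).

Definition Phi s a y : R := \prod_(j <- s) enorm (y j) `^ a j.

(** Logarithmic derivative of [Phi]: [psi 0 y h] is <y, h> / |y|^2. *)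
Definition Lam s a y h : R := \sum_(j <- s) a j * psi 0 (y j) (h j).

Definition dens q s a W y : R := enorm W `^ q * Phi s a y.

(* The derivative of [dens] at [(W, y)] in the direction [(eta, h)]. *)
Definition ddens q s a W y eta h : R :=
  (q * psi q W eta + enorm W `^ q * Lam s a y h) * Phi s a y.

Lemma Phi_ge0 s a y : 0 <= Phi s a y.
Proof. by apply: prodr_ge0 => j _; exact: powR_ge0. Qed.

Lemma Phi_rel s a e : 0 < e -> exists2 d : R, 0 < d <= 1 &
  forall y f, (forall j, enorm (f j) <= d * enorm (y j)) ->
  `|Phi s a (y \+ f) - Phi s a y| <= e * Phi s a y.
Proof.
elim: s e => [|j s ih] e e0.
  exists 1 => [|y f _]; first by rewrite ltr01 lexx.
  by rewrite /Phi !big_nil subrr normr0 mulr1 ltW.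
(* The new error is u (U - V) + (u - v) V, and u <= 2 v as soon as e' <= 1; this costs 2 e' + e'. *)
pose e' := Num.min 1 (e / 3).
have e'0 : 0 < e' by rewrite lt_min ltr01 divr_gt0.
have e'1 : e' <= 1 by rewrite ge_min lexx.
have e'3 : 3 * e' <= e by rewrite mulrC -ler_pdivlMr// ge_min lexx orbT.
have [d1 /andP[d10 d11] h1] := ih _ e'0.
have [d2 /andP[d20 d22] h2] := @powR_rel R n (a j) e' e'0.
exists (Num.min d1 d2) => [|y f yf].
  by rewrite lt_min d10 d20 ge_min d11.
have /h1 {}h1 : forall j, enorm (f j) <= d1 * enorm (y j).
  by move=> i; apply: le_trans (yf i) _; rewrite ler_wpM2r ?enorm_ge0 ?ge_min ?lexx.
have /h2 {}h2 : enorm (f j) <= d2 * enorm (y j).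
  apply: le_trans (yf j) _; rewrite ler_wpM2r ?enorm_ge0//.
  by rewrite ge_min lexx orbT.
rewrite /Phi !big_cons -!/(Phi _ _ _) /=.
have := Phi_ge0 s a y; have := powR_ge0 (enorm (y j)) (a j).
set U := Phi s a (y \+ f); set V := Phi s a y; move: h2; set u := _ `^ _; set v := enorm (y j) `^ _ => h2 v0 V0.
have /andP[h21 h22] : - (e' * v) <= u - v <= e' * v by rewrite -ler_norml.
have v0' : 0 <= u by exact: powR_ge0.
have vV := mulr_ge0 v0 V0.
have E3 : 3 * e' * (v * V) <= e * (v * V) by rewrite ler_wpM2r.
have k1 : `|u * (U - V)| <= 2 * v * (e' * V).
  rewrite normrM (ger0_norm v0') ler_pM//.
  have : e' * v <= v by rewrite ler_piMl.
  lra.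
have k2 : `|(u - v) * V| <= e' * v * V.
  by rewrite normrM (ger0_norm V0) ler_wpM2r.
have -> : u * U - v * V = u * (U - V) + (u - v) * V by ring.
apply: le_trans (ler_normD _ _) _.
apply: le_trans (lerD k1 k2) _; lra.
Qed.

Definition asum s a : R := \sum_(j <- s) `|a j|.

Lemma asum_ge0 s a : 0 <= asum s a.
Proof. exact: sumr_ge0. Qed.

Lemma Lam_le s a y h r : 0 <= r ->
  (forall j, enorm (h j) <= r * enorm (y j)) ->
  `|Lam s a y h| <= asum s a * r.
Proof.
move=> r0 yh; rewrite mulr_suml; apply: le_trans (ler_norm_sum _ _ _) _.
apply: ler_sum => j _; rewrite normrM ler_wpM2l//.
have [y0|y0] := eqVneq (y j) 0; first by rewrite y0 psi0 normr0.
apply: le_trans (psi_le _ _ _) _.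
apply: le_trans (ler_wpM2l (powR_ge0 _ _) (yh j)) _.
rewrite sub0r powR_inv1 ?enorm_ge0// mulrCA mulVf ?enorm_eq0//.
by rewrite mulr1.
Qed.

Lemma Lam_rel s a e : 0 < e -> exists2 d : R, 0 < d <= 1 &
  forall y f h r, (forall j, enorm (f j) <= d * enorm (y j)) -> 0 <= r ->
  (forall j, enorm (h j) <= r * enorm (y j)) ->
  `|Lam s a (y \+ f) h - Lam s a y h| <= e * asum s a * r.
Proof.
move=> e0; have [d /andP[d0 d2] hd] := @psi_rel R n 0 _ e0.
exists d => [|y f h r yf r0 yh]; first by rewrite d0; lra.
rewrite -sumrB mulrAC mulr_sumr; apply: le_trans (ler_norm_sum _ _ _) _.
apply: ler_sum => j _; rewrite -mulrBr normrM mulrC ler_wpM2r//.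
apply: le_trans (hd _ _ _ (yf j)) _.
have [y0|y0] := eqVneq (y j) 0.
  have -> : enorm (h j) = 0.
    apply/le_anti; rewrite enorm_ge0 andbT (le_trans (yh j))//.
    by rewrite y0 enorm0 mulr0.
  by rewrite mulr0 mulr_ge0// ltW.
rewrite -mulrA ler_wpM2l ?(ltW e0)//.
apply: le_trans (ler_wpM2l (powR_ge0 _ _) (yh j)) _.
by rewrite sub0r powR_inv1 ?enorm_ge0// mulrCA mulVf ?enorm_eq0// mulr1.
Qed.

Lemma ddens_le q s a W y eta h r S : 1 < q -> 0 <= r -> 0 <= S ->
  enorm W <= S -> enorm eta <= r * S ->
  (forall j, enorm (h j) <= r * enorm (y j)) ->
  `|ddens q s a W y eta h| <= (q + asum s a) * r * S `^ q * Phi s a y.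
Proof.
move=> q1 r0 S0 WS etaS yh; rewrite /ddens normrM (ger0_norm (Phi_ge0 _ _ _)).
rewrite ler_wpM2r ?Phi_ge0//.
have q0 : 0 <= q by lra.
have q10 : 0 <= q - 1 by lra.
have k1 : `|psi q W eta| <= r * S `^ q.
  apply: le_trans (psi_le _ _ _) _; rewrite -(mulr_powRB1 S0) 1?mulrA; last lra.
  by rewrite mulrC ler_pM ?enorm_ge0 ?powR_ge0// powR_le_mono ?enorm_ge0.
have k2 : `|enorm W `^ q * Lam s a y h| <= S `^ q * (asum s a * r).
  rewrite normrM (ger0_norm (powR_ge0 _ _)) ler_pM ?powR_ge0 ?Lam_le//.
  by rewrite powR_le_mono ?enorm_ge0.
apply: le_trans (ler_normD _ _) _; rewrite normrM (ger0_norm q0).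
have := ler_wpM2l q0 k1; lra.
Qed.

(** The base moves by (dl, f) and the direction from eta to eta + eta': as the bivector is quadratic
    in the curve, its derivative in a fixed direction changes with the base point. All increments
    are measured against S or against the lengths, so that the error scales like the integrand. *)
Lemma ddens_diff q s a e : 1 < q -> 0 < e -> exists2 d : R, 0 < d <= 1 &
  forall (d' : R) W dl eta eta' y f h (r S : R), 0 <= d' <= d -> 0 <= r -> 0 <= S ->
  enorm W <= S -> enorm dl <= d' * S ->
  enorm eta <= r * S -> enorm eta' <= d' * r * S ->
  (forall j, enorm (f j) <= d' * enorm (y j)) ->
  (forall j, enorm (h j) <= r * enorm (y j)) ->
  `|ddens q s a (W + dl) (y \+ f) (eta + eta') h - ddens q s a W y eta h|
    <= e * r * S `^ q * Phi s a y.
Proof.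
move=> q1 e0; have q0 : 0 <= q by lra.
have q10 : 0 <= q - 1 by lra.
set M := asum s a; have M0 : 0 <= M by exact: asum_ge0.
pose P2 : R := 2 `^ (q - 1); have P20 : 0 <= P2 by exact: powR_ge0.
(* The first group bounds the change of the bracket in [ddens], doubled since [Phi] at most doubles;
   q + M bounds the bracket itself, which is multiplied by the change of [Phi]. *)
pose K := 1 + 2 * (q + q * P2 + 3 * M) + (q + M).
have qP20 : 0 <= q * P2 by exact: mulr_ge0.
have K0 : 0 < K by rewrite /K; lra.
pose e1 := Num.min 1 (e / K).
have e10 : 0 < e1 by rewrite lt_min ltr01 divr_gt0.
have e11 : e1 <= 1 by rewrite ge_min lexx.
have e1K : e1 * K <= e by rewrite -ler_pdivlMr// ge_min lexx orbT.
clearbody e1.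
have [d1 /andP[d10 d11] h1] := @Phi_rel s a _ e10.
have [d2 /andP[d20 d21] h2] := @Lam_rel s a _ e10.
have [d3 /andP[d30 d31] h3] := @psi_diff R m q _ q1 e10.
have [d4 /andP[d40 d41] h4] := @powR_diff R m q _ q1 e10.
exists (Num.min e1 (Num.min (Num.min d1 d2) (Num.min d3 d4))).
  by rewrite lt_min e10 !lt_min d10 d20 d30 d40 ge_min e11.
move=> d' W dl eta eta' y f h r S; rewrite !le_min.
move=> /andP[d'0 /andP[de /andP[/andP[dd1 dd2] /andP[dd3 dd4]]]].
move=> r0 S0 WS dS etaS eta'S yf yh.
have {h1} := h1 y f (fun j => le_trans (yf j) (ler_wpM2r (enorm_ge0 _) dd1)).
have {h2} := h2 y f h r (fun j => le_trans (yf j) (ler_wpM2r (enorm_ge0 _) dd2)) r0 yh.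
have {h3} := h3 d' W dl eta S (introT andP (conj d'0 dd3)) S0 WS dS.
have {h4} := h4 d' W dl S (introT andP (conj d'0 dd4)) S0 WS dS.
have WdS : enorm (W + dl) <= 2 * S.
  apply: le_trans (enormD _ _) _; have : d' * S <= S by rewrite ler_piMl//; lra.
  lra.
have Sq : S * S `^ (q - 1) = S `^ q by rewrite mulr_powRB1//; lra.
have k5 : `|psi q (W + dl) eta'| <= P2 * e1 * r * S `^ q.
  apply: le_trans (psi_le _ _ _) _; rewrite -Sq.
  have -> : P2 * e1 * r * (S * S `^ (q - 1)) = (P2 * S `^ (q - 1)) * (e1 * r * S) by ring.
  rewrite ler_pM ?powR_ge0 ?enorm_ge0//.
    by rewrite /P2 -powRM// powR_le_mono ?enorm_ge0.
  by apply: le_trans eta'S _; rewrite ler_wpM2r// ler_wpM2r.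
have L1 := Lam_le s a r0 yh; rewrite -/M in L1.
set X1 := `|psi q (W + dl) eta - _|.
rewrite -/M => h4 h3 h2 h1.
have {}h3 : X1 <= e1 * r * S `^ q.
  apply: le_trans h3 _; rewrite -Sq.
  have -> : e1 * r * (S * S `^ (q - 1)) = e1 * S `^ (q - 1) * (r * S) by ring.
  by rewrite ler_wpM2l// mulr_ge0 ?powR_ge0// ltW.
rewrite /ddens psiD.
have P0 := Phi_ge0 s a y.
set p1 := psi q (W + dl) eta in X1 h3 *; set p2 := psi q (W + dl) eta' in k5 *.
set p3 := psi q W eta in X1 h3 *.
have k3 : `|p3| <= r * S `^ q.
  apply: le_trans (psi_le _ _ _) _; rewrite -Sq mulrA mulrC.
  by rewrite ler_pM ?enorm_ge0 ?powR_ge0// powR_le_mono ?enorm_ge0.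
have k4 : enorm W `^ q <= S `^ q by rewrite powR_le_mono ?enorm_ge0.
have w0 := powR_ge0 (enorm W) q.
have w0' := powR_ge0 (enorm (W + dl)) q.
set w' := enorm (W + dl) `^ q in h4 w0' *; set w := enorm W `^ q in h4 k4 w0 *.
set l' := Lam s a (y \+ f) h in h2 *; set l := Lam s a y h in L1 h2 *.
set F' := Phi s a (y \+ f) in h1 *; set F := Phi s a y in P0 h1 *.
have T0 := powR_ge0 S q; set T := S `^ q in h3 k5 h4 k3 k4 T0 *.
have -> : (q * (p1 + p2) + w' * l') * F' - (q * p3 + w * l) * F =
  (q * (p1 - p3) + q * p2 + (w' - w) * l' + w * (l' - l)) * F'
   + (q * p3 + w * l) * (F' - F) by ring.
rewrite /X1 in h3; clearbody p1 p2 p3 l l' F F' w w' T.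
have rT : 0 <= r * T by exact: mulr_ge0.
have e1r : e1 * r <= r by rewrite ler_piMl.
have Mr : 0 <= M * r by exact: mulr_ge0.
have l'M : `|l'| <= 2 * M * r.
  have -> : l' = (l' - l) + l by ring.
  apply: le_trans (ler_normD _ _) _; apply: le_trans (lerD h2 L1) _.
  have : e1 * (M * r) <= M * r by rewrite ler_piMl.
  clear; lra.
have F'F : `|F'| <= 2 * F.
  have -> : F' = (F' - F) + F by ring.
  apply: le_trans (ler_normD _ _) _; rewrite (ger0_norm P0).
  have : e1 * F <= F by rewrite ler_piMl.
  lra.
have A1 : `|q * (p1 - p3) + q * p2 + (w' - w) * l' + w * (l' - l)| <=
    (q + q * P2 + 3 * M) * (e1 * (r * T)).
  apply: le_trans (ler_normD _ _) _; apply: le_trans (lerD (ler_normD _ _) (lexx _)) _.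
  apply: le_trans (lerD (lerD (ler_normD _ _) (lexx _)) (lexx _)) _.
  rewrite !normrM (ger0_norm q0) (ger0_norm w0).
  have b1 : q * `|p1 - p3| <= q * (e1 * r * T) by rewrite ler_wpM2l.
  have b2 : q * `|p2| <= q * (P2 * e1 * r * T) by rewrite ler_wpM2l.
  have b3 : `|w' - w| * `|l'| <= (e1 * T) * (2 * M * r) by rewrite ler_pM.
  have b4 : w * `|l' - l| <= T * (e1 * M * r) by rewrite ler_pM.
  clear -b1 b2 b3 b4; lra.
have A2 : `|q * p3 + w * l| <= (q + M) * (r * T).
  apply: le_trans (ler_normD _ _) _; rewrite !normrM (ger0_norm q0) (ger0_norm w0).
  have b1 : q * `|p3| <= q * (r * T) by rewrite ler_wpM2l.
  have b2 : w * `|l| <= T * (M * r) by rewrite ler_pM.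
  clear -b1 b2; lra.
apply: le_trans (ler_normD _ _) _; rewrite !(normrM _ F') !(normrM _ (F' - F)).
apply: le_trans (lerD (ler_pM _ _ A1 F'F) (ler_pM _ _ A2 h1)) _ => //.
have : (e1 * K) * (r * T * F) <= e * (r * T * F) by rewrite ler_wpM2r// mulr_ge0.
have : 0 <= e1 * (r * T * F) by rewrite mulr_ge0 ?(ltW e10)// mulr_ge0.
rewrite /K; clear; lra.
Qed.

End Density.

(** * Derivatives of the integrand along a path *)

Section Curves.
Context {R : realType}.

Lemma is_derive_edot m (W : R -> 'rV[R]_m) (W' : 'rV[R]_m) (t : R) :
  (forall i, is_derive t 1 (fun x => W x 0 i) (W' 0 i)) ->
  is_derive t 1 (fun x => edot (W x) (W x)) (2 * edot (W t) W').
Proof.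
move=> dW.
have -> : (fun x => edot (W x) (W x)) =
    \sum_(i < m) ((fun x => W x 0 i) * (fun x => W x 0 i)).
  by apply/funext => x; rewrite fct_sumE.
apply: is_derive_eq; rewrite /edot mulr_sumr; apply: eq_bigr => i _.
by rewrite /GRing.scale /=; lra.
Qed.

Lemma is_derive_flat (f : R -> R) (t K q : R) : 1 < q ->
  (forall x, `|x - t| <= 1 -> `|f x - f t| <= K * `|x - t| `^ q) ->
  is_derive t 1 f 0.
Proof.
move=> q1 H; apply/is_derive1_caratheodory.
exists (fun x => if x == t then 0 else (f x - f t) / (x - t)); split.
- move=> x; case: eqVneq => [->|xt]; first by rewrite !subrr mul0r.
  by rewrite divfK// subr_eq0.
- rewrite /prop_for /continuous_at eqxx.
  have q0 : 0 < q - 1 by rewrite subr_gt0.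
  apply/cvgrPdist_le => e e0; have K0 : 0 < `|K| + 1 by rewrite ltr_wpDl.
  pose d := Num.min 1 ((e / (`|K| + 1)) `^ (q - 1)^-1).
  have d0 : 0 < d by rewrite lt_min ltr01 powR_gt0// divr_gt0.
  apply/nbhs_normP; exists d => // x; rewrite /ball_ /= sub0r normrN distrC.
  case: eqVneq => [_ _|xt]; first by rewrite normr0 ltW.
  rewrite lt_min => /andP[x1 xe]; have xt0 : 0 < `|x - t| by rewrite normr_gt0 subr_eq0.
  rewrite normrM normfV ler_pdivrMr//; apply: le_trans (H _ (ltW x1)) _.
  rewrite -(mulr_powRB1 (normr_ge0 _) (lt_trans ltr01 q1)) mulrCA mulrC.
  rewrite ler_wpM2r//.
  have := powR_le_mono (ltW q0) (normr_ge0 _) (ltW xe).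
  rewrite -powRrM mulVf ?gt_eqF// powRr1; last by rewrite divr_ge0// ltW.
  rewrite ler_pdivlMr// mulrC => h; apply: le_trans h.
  by rewrite ler_wpM2r ?powR_ge0//; have := ler_norm K; lra.
- by rewrite eqxx.
Qed.

Lemma is_derive_enorm_powR m a (W : R -> 'rV[R]_m) (W' : 'rV[R]_m) (t : R) :
  W t != 0 -> (forall i, is_derive t 1 (fun x => W x 0 i) (W' 0 i)) ->
  is_derive t 1 (fun x => enorm (W x) `^ a) (a * psi a (W t) W').
Proof.
move=> Wt0 /is_derive_edot dE.
(* The squared norm is a polynomial in the coordinates, so its real powers are differentiable
   wherever it is positive. *)
have e0 : 0 < edot (W t) (W t) by rewrite -enorm_sqr exprn_gt0// enorm_gt0.
have eE b : enorm (W t) `^ b = edot (W t) (W t) `^ (b / 2).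
  rewrite /enorm -powR12_sqrt ?edot_ge0// -powRrM; congr powR; lra.
have -> : (fun x => enorm (W x) `^ a) =
    (fun z => z `^ (a / 2)) \o (fun x => edot (W x) (W x)).
  apply/funext => x /=; rewrite /enorm -powR12_sqrt ?edot_ge0// -powRrM.
  congr powR; lra.
apply: is_derive_eq; first by apply: is_derive1_comp; apply: is_derive1_powR.
rewrite /psi eE (_ : (a - 2) / 2 = a / 2 - 1); lra.
Qed.

(** At a zero of W the chain rule through the norm fails, but there |W|^q is O(|x - t|^q) with q >
    1, hence has derivative 0, which is the value of [psi] at 0. *)
Lemma is_derive_enorm_powR_gt1 m q (W : R -> 'rV[R]_m) (W' : 'rV[R]_m) (t K : R) :
  1 < q -> 0 <= K -> (forall x, `|x - t| <= 1 -> enorm (W x - W t) <= K * `|x - t|) ->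
  (forall i, is_derive t 1 (fun x => W x 0 i) (W' 0 i)) ->
  is_derive t 1 (fun x => enorm (W x) `^ q) (q * psi q (W t) W').
Proof.
move=> q1 K0 WK dW; have [Wt0|] := eqVneq (W t) 0; last first.
  by move/is_derive_enorm_powR; exact.
have q0 : q != 0 by rewrite gt_eqF//; lra.
rewrite Wt0 psi0 mulr0; apply: (@is_derive_flat _ _ (K `^ q) q) => // x /WK.
rewrite Wt0 subr0 enorm0 powR0// subr0 (ger0_norm (powR_ge0 _ _)).
by rewrite -powRM// => h; apply: powR_le_mono => //; [lra|exact: enorm_ge0].
Qed.

Lemma is_derive_quadratic (a b c t : R) :
  is_derive t 1 (fun x => a + x * b + x ^+ 2 * c) (b + 2 * t * c).
Proof.
have -> : (fun x => a + x * b + x ^+ 2 * c) =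
    horner (a%:P + 'X * b%:P + 'X ^+ 2 * c%:P).
  by apply/funext => x; rewrite !hornerE.
apply: is_derive_eq; rewrite !poly.derivE !hornerE /=; ring.
Qed.

Lemma Phi_nil n (J : Type) (a : J -> R) (y : J -> 'rV[R]_n) : Phi [::] a y = 1.
Proof. exact: big_nil. Qed.

Lemma Phi_cons n (J : Type) j (s : seq J) (a : J -> R) (y : J -> 'rV[R]_n) :
  Phi (j :: s) a y = enorm (y j) `^ a j * Phi s a y.
Proof. exact: big_cons. Qed.

Lemma Lam_nil n (J : Type) (a : J -> R) (y h : J -> 'rV[R]_n) : Lam [::] a y h = 0.
Proof. exact: big_nil. Qed.

Lemma Lam_cons n (J : Type) j (s : seq J) (a : J -> R) (y h : J -> 'rV[R]_n) :
  Lam (j :: s) a y h = a j * psi 0 (y j) (h j) + Lam s a y h.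
Proof. exact: big_cons. Qed.

Lemma is_derive_Phi n (J : Type) (s : seq J) (a : J -> R) (y h : J -> 'rV[R]_n) (t : R) :
  (forall j, y j + t *: h j != 0) ->
  is_derive t 1 (fun x => Phi s a (fun j => y j + x *: h j))
    (Lam s a (fun j => y j + t *: h j) h * Phi s a (fun j => y j + t *: h j)).
Proof.
move=> y0; elim: s => [|j s ih].
  rewrite Lam_nil mul0r.
  have -> : (fun x => Phi [::] a (fun j => y j + x *: h j)) = cst 1.
    by apply/funext => x; rewrite Phi_nil.
  exact: is_derive_cst.
have dj : is_derive t 1 (fun x => enorm (y j + x *: h j) `^ a j)
    (a j * psi (a j) (y j + t *: h j) (h j)).
  apply: (is_derive_enorm_powR _ (y0 j)) => i.
  have := is_derive_quadratic (y j 0 i) (h j 0 i) 0 t.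
  rewrite mulr0 addr0; congr is_derive.
  by apply/funext => x; rewrite !mxE mulr0 addr0.
have -> : (fun x => Phi (j :: s) a (fun j => y j + x *: h j)) =
    (fun x => enorm (y j + x *: h j) `^ a j) *
    (fun x => Phi s a (fun j => y j + x *: h j)).
  by apply/funext => x; rewrite Phi_cons.
apply: is_derive_eq; rewrite Phi_cons Lam_cons.
set P := Phi s a _; set L := Lam s a _ _.
have -> : psi (a j) (y j + t *: h j) (h j) =
    enorm (y j + t *: h j) `^ a j * psi 0 (y j + t *: h j) (h j).
  rewrite /psi mulrA -powRD ?enorm_eq0 ?y0 ?implybT//; congr (powR _ _ * _); lra.
rewrite /GRing.scale /=; ring.
Qed.

(** The path is quadratic because the bivector of gamma + x h is W + x B + x^2 Q, with B the
    polarization and Q the bivector of h. *)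
Lemma is_derive_dens m n (J : Type) q (s : seq J) (a : J -> R)
    (W B Q : 'rV[R]_m) (y h : J -> 'rV[R]_n) (t : R) : 1 < q ->
  (forall j, y j + t *: h j != 0) ->
  is_derive t 1
    (fun x => dens q s a (W + x *: B + x ^+ 2 *: Q) (fun j => y j + x *: h j))
    (ddens q s a (W + t *: B + t ^+ 2 *: Q) (fun j => y j + t *: h j)
       (B + (2 * t) *: Q) h).
Proof.
move=> q1 y0.
have dW : is_derive t 1 (fun x => enorm (W + x *: B + x ^+ 2 *: Q) `^ q)
    (q * psi q (W + t *: B + t ^+ 2 *: Q) (B + (2 * t) *: Q)).
  apply: (@is_derive_enorm_powR_gt1 _ _
    (fun x => W + x *: B + x ^+ 2 *: Q) _ t (enorm B + (2 * `|t| + 1) * enorm Q)) => //.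
  - by rewrite addr_ge0 ?mulr_ge0 ?addr_ge0 ?mulr_ge0 ?enorm_ge0.
  - move=> x xt.
    have -> : W + x *: B + x ^+ 2 *: Q - (W + t *: B + t ^+ 2 *: Q) =
      (x - t) *: (B + (x + t) *: Q).
      by apply/rowP => i; rewrite !mxE; ring.
    rewrite enormZ mulrC ler_wpM2r//; apply: le_trans (enormD _ _) _.
    rewrite lerD2l enormZ ler_wpM2r ?enorm_ge0//.
    have -> : x + t = (x - t) + 2 * t by ring.
    apply: le_trans (ler_normD _ _) _.
    rewrite normrM (ger0_norm (ler0n _ _)); lra.
  - move=> i; have := is_derive_quadratic (W 0 i) (B 0 i) (Q 0 i) t.
    rewrite !mxE; congr is_derive.
    by apply/funext => x; rewrite !mxE.
have dP := is_derive_Phi s a y0.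
have -> : (fun x => dens q s a (W + x *: B + x ^+ 2 *: Q) (fun j => y j + x *: h j))
  = (fun x => enorm (W + x *: B + x ^+ 2 *: Q) `^ q) *
    (fun x => Phi s a (fun j => y j + x *: h j)) by [].
apply: is_derive_eq; rewrite /ddens /GRing.scale /=; ring.
Qed.

(** Mean value theorem on the quadratic path, then [ddens_diff] between the intermediate time and
    time 0. *)
Lemma dens_frechet m n (J : Type) q (s : seq J) (a : J -> R) e : 1 < q -> 0 < e ->
  exists2 d : R, 0 < d & forall (W B Q : 'rV[R]_m) (y h : J -> 'rV[R]_n) r S,
  0 <= r <= d -> 0 <= S -> enorm W <= S -> enorm B <= r * S -> enorm Q <= r ^+ 2 * S ->
  (forall j, y j != 0) -> (forall j, enorm (h j) <= r * enorm (y j)) ->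
  `|dens q s a (W + B + Q) (y \+ h) - dens q s a W y - ddens q s a W y B h|
    <= e * r * S `^ q * Phi s a y.
Proof.
move=> q1 e0; have [d /andP[d0 d1] H] := @ddens_diff R m n J q s a e q1 e0.
(* At time t the direction is B + 2 t Q, and |2 t Q| <= 2 r^2 S, so [ddens_diff] is applied with
   relative size 2 r. The resulting bound r <= 1/2 also keeps all lengths nonzero along the path. *)
exists (d / 2) => [|W B Q y h r S /andP[r0 rd] S0 WS BS QS y0 yh].
  by rewrite divr_gt0.
have yt0 (t : R) : 0 <= t <= 1 -> forall j, y j + t *: h j != 0.
  move=> /andP[t0 t1] j; rewrite -enorm_gt0.
  apply: lt_le_trans (enorm_subr_le _ _); rewrite subr_gt0 enormZ (ger0_norm t0).
  have yj : 0 < enorm (y j) by rewrite enorm_gt0.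
  apply: le_lt_trans (_ : enorm (h j) < _).
    by rewrite ler_piMl ?enorm_ge0.
  apply: le_lt_trans (yh j) _; rewrite gtr_pMl//; lra.
pose F x := dens q s a (W + x *: B + x ^+ 2 *: Q) (fun j => y j + x *: h j).
have dF (t : R) : 0 <= t <= 1 -> is_derive t 1 F (ddens q s a (W + t *: B + t ^+ 2 *: Q)
    (fun j => y j + t *: h j) (B + (2 * t) *: Q) h).
  by move=> t01; apply: is_derive_dens => // j; exact: yt0.
have cF : {within `[0, 1], continuous F}.
  apply: derivable_within_continuous => t; rewrite in_itv /= => /dF dFt.
  exact: ex_derive.
have dF' (t : R) : t \in `]0, 1[%R -> is_derive t 1 F (ddens q s a (W + t *: B + t ^+ 2 *: Q)
    (fun j => y j + t *: h j) (B + (2 * t) *: Q) h).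
  by rewrite in_itv /= => /andP[t0 t1]; apply: dF; rewrite !ltW.
have [t] := MVT ltr01 dF' cF.
rewrite in_itv /= => /andP[t0 t1]; rewrite subr0 mulr1.
rewrite /F !scale1r !expr1n scale1r !scale0r expr0n /= scale0r !addr0.
have -> : (fun j => y j + 1 *: h j) = y \+ h.
  by apply/funext => j; rewrite scale1r.
have -> : (fun j => y j + 0 *: h j) = y.
  by apply/funext => j; rewrite scale0r addr0.
move=> ->; rewrite -addrA.
have r2S : r ^+ 2 * S <= r * S by rewrite ler_wpM2r// expr2 ler_piMl//; lra.
have rS : 0 <= r * S by exact: mulr_ge0.
have t2 : `|t ^+ 2| <= 1 by rewrite ger0_norm ?sqr_ge0// expr_le1// ltW.
apply: (H (2 * r)) => //.
- by rewrite mulr_ge0//=; lra.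
- apply: le_trans (enormD _ _) _; rewrite !enormZ (ger0_norm (ltW t0)).
  have : t * enorm B <= enorm B by rewrite ler_piMl ?enorm_ge0// ltW.
  have : `|t ^+ 2| * enorm Q <= enorm Q by rewrite ler_piMl ?enorm_ge0.
  lra.
- rewrite enormZ ger0_norm ?mulr_ge0 ?(ltW t0)//.
  have : t * enorm Q <= enorm Q by rewrite ler_piMl ?enorm_ge0// ltW.
  lra.
- move=> j /=; rewrite enormZ (ger0_norm (ltW t0)).
  have : t * enorm (h j) <= enorm (h j) by rewrite ler_piMl ?enorm_ge0// ltW.
  have := yh j; have : 0 <= r * enorm (y j) by rewrite mulr_ge0 ?enorm_ge0.
  lra.
Qed.

End Curves.

(** * Integrals on the line and Hardy inequalities *)

Section LineIntegrals.
Context {R : realType}.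
Local Notation mu := (@lebesgue_measure R).

Section Mono.
Import HBNNSimple.

(** The integral of a nonnegative function is the supremum over the simple functions below it, so
    monotonicity is independent of measurability. *)
Lemma integral_mono d (T : measurableType d) (m : {measure set T -> \bar R})
    (D : set T) (f g : T -> \bar R) :
  (forall x, D x -> 0 <= f x)%E -> (forall x, D x -> f x <= g x)%E ->
  (\int[m]_(x in D) f x <= \int[m]_(x in D) g x)%E.
Proof.
move=> f0 fg; rewrite !ge0_integralE//; last first.
  by move=> x Dx; exact: le_trans (f0 _ Dx) (fg _ Dx).
apply: ereal_sup_le => _ [h /= hf <-].
exists h => // x; apply: le_trans (hf x) _.
by rewrite /patch; case: ifPn => // /set_mem; exact: fg.
Qed.

End Mono.

Lemma measurable_addr (a : R) :
  measurable_fun [set: measurableTypeR R]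
    (fun x : measurableTypeR R => (x + a : measurableTypeR R)).
Proof. by apply: measurable_funD. Qed.

(** Uniqueness of Lebesgue measure: the translated measure agrees with it on half-open intervals. *)
Lemma lebesgue_measure_shift (a : R) (A : set R) : measurable A ->
  pushforward mu (fun x : measurableTypeR R => (x + a : measurableTypeR R)) A = mu A.
Proof.
have mp := measurable_addr a.
pose f := isMeasurableFun.Build _ _ (measurableTypeR R) (measurableTypeR R) _ mp.
pose g : {mfun (measurableTypeR R) >-> (measurableTypeR R)} := HB.pack (fun x : measurableTypeR R => (x + a : measurableTypeR R)) f.
move=> mA; apply/esym.
apply: (@lebesgue_measure_unique _ (pushforward mu g)) => //= _ [[b c]] _ <-.
rewrite /pushforward.
have -> : (fun x : measurableTypeR R => (x + a : measurableTypeR R)) @^-1` `]b, c] =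
    [set` `]b - a, c - a]].
  apply/seteqP; split => x /=; rewrite !in_itv /= ltrBlDr lerBrDr//.
rewrite !lebesgue_measure_itv /= !lte_fin ltrBlDr subrK -!EFinB.
by case: ifP => // _; congr (_%:E); lra.
Qed.

Lemma integral_shift (a : R) (D : set R) (f : R -> \bar R) :
  measurable D -> measurable_fun D f -> (forall x, D x -> 0 <= f x)%E ->
  (\int[mu]_(x in [set x | D (x + a)%R]) f (x + a)%R = \int[mu]_(x in D) f x)%E.
Proof.
move=> mD mf f0.
rewrite -(ge0_integral_pushforward (measurable_addr a) mu mD mf); last first.
  by move=> x /set_mem; exact: f0.
apply: eq_measure_integral => [|mp A mA _]; first exact: measurable_addr.
exact: lebesgue_measure_shift.
Qed.

Lemma lebesgue_integral_opp (D : set R) (f : R -> \bar R) :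
  measurable D -> measurable_fun D f -> (forall x, D x -> 0 <= f x)%E ->
  (\int[mu]_(x in [set x | D (- x)%R]) f (- x)%R = \int[mu]_(x in D) f x)%E.
Proof.
move=> mD mf f0.
have mN : measurable_fun [set: measurableTypeR R]
    (-%R : measurableTypeR R -> measurableTypeR R) by exact: oppr_measurable.
rewrite -(ge0_integral_pushforward mN mu mD mf); last first.
  by move=> x /set_mem; exact: f0.
by apply: eq_measure_integral => A mA _; exact: lebesgue_measureN.
Qed.

Lemma integral_shift_itv (a b c : R) (f : R -> \bar R) (s s' : bool) :
  measurable_fun [set: R] f -> (forall x, 0 <= f x)%E ->
  (\int[mu]_(x in [set` Interval (BSide s b) (BSide s' c)]) f (x + a)%R =
   \int[mu]_(x in [set` Interval (BSide s (b + a)%R) (BSide s' (c + a)%R)]) f x)%E.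
Proof.
move=> mf f0; rewrite -(@integral_shift a _ _ _ (measurable_funTS mf))//.
congr integral; apply/seteqP.
by split => x /=; rewrite !in_itv /= !lteifD2r.
Qed.

Lemma periodic_int (T : Type) (f : R -> T) : (forall x, f (x + 1) = f x) ->
  forall (n : int) x, f (x + n%:~R) = f x.
Proof.
move=> f1 n x; elim/int_ind : n => [|n ih|n ih].
- by rewrite addr0.
- by rewrite -addn1 PoszD intrD addrA f1.
- rewrite -[RHS]ih !mulrNz -!pmulrn -natr1 -[LHS]f1; congr f; ring.
Qed.

(** Translation by an integer moves the interval to [b, b + 1] with 0 <= b < 1; the part beyond 1 is
    then moved back by 1. *)
Lemma integral_period (f : R -> \bar R) (a : R) : measurable_fun [set: R] f ->
  (forall x, 0 <= f x)%E -> (forall x, f (x + 1)%R = f x) ->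
  (\int[mu]_(x in `[a, (a + 1)%R]) f x = \int[mu]_(x in `[0%R, 1%R]) f x)%E.
Proof.
move=> mf f0 f1.
have mfD D : measurable_fun D f by exact: measurable_funTS.
rewrite -!integral_itv_bndo_bndc//.
have [n [b [b0 b1 ->]]] : exists (n : int) (b : R), [/\ 0 <= b, b < 1 & a = b + n%:~R].
  exists (Num.floor a), (a - (Num.floor a)%:~R); split; last by rewrite subrK.
    by rewrite subr_ge0 floor_le.
  by have := floorD1_gt a; rewrite intrD ltrBlDl.
rewrite -addrA (addrC _ 1) addrA -(@integral_shift_itv n%:~R)//.
under eq_integral do rewrite (periodic_int f1).
have mi (x y : R) : measurable `[x, y[ by exact: measurable_itv.
have b1' : 1 <= b + 1 by lra.
have b1'' := ltW b1.
rewrite (@itv_bndbnd_setU _ _ _ (BLeft 1)) ?bnd_simp//.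
rewrite ge0_integral_setU//; [|exact: mfD|]; last first.
  by apply/disj_setPS => x [] /=; rewrite !in_itv /= => /andP[_ x1] /andP[]; lra.
have -> : (\int[mu]_(x in `[1%R, (b + 1)%R[) f x = \int[mu]_(x in `[0%R, b[) f x)%E.
  have := @integral_shift_itv 1 0 b f true true mf f0; rewrite add0r => <-.
  by apply: eq_integral => x _; exact: f1.
rewrite addeC -ge0_integral_setU//; [|exact: mfD|]; last first.
  by apply/disj_setPS => x [] /=; rewrite !in_itv /= => /andP[_ x1] /andP[]; lra.
by rewrite -itv_bndbnd_setU// bnd_simp.
Qed.

Lemma integral_period_shift (f : R -> \bar R) (a : R) : measurable_fun [set: R] f ->
  (forall x, 0 <= f x)%E -> (forall x, f (x + 1)%R = f x) ->
  (\int[mu]_(x in `[0%R, 1%R]) f (a + x)%R = \int[mu]_(x in `[0%R, 1%R]) f x)%E.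
Proof.
move=> mf f0 f1; under eq_integral do rewrite addrC.
by rewrite integral_shift_itv// add0r addrC integral_period.
Qed.

End LineIntegrals.

(** * Integrals of powers, a weak Jensen inequality and Hardy's inequality *)

Section Hardy.
Context {R : realType}.
Local Notation mu := (@lebesgue_measure R).

Lemma FTC2_closed (f F : R -> R) (a b : R) : a < b ->
  (forall x, a <= x <= b -> {for x, continuous f}) ->
  (forall x, a <= x <= b -> is_derive x 1 F (f x)) ->
  (\int[mu]_(x in `[a, b]) (f x)%:E = (F b - F a)%:E)%E.
Proof.
move=> ab cf dF.
have cF x : a <= x <= b -> {for x, continuous F}.
  move=> /dF Fx; apply/differentiable_continuous/derivable1_diffP.
  exact: ex_derive.
have aab : a <= a <= b by rewrite lexx ltW.
have bab : a <= b <= b by rewrite lexx ltW.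
rewrite EFinB; apply: continuous_FTC2 => //.
- apply: continuous_in_subspaceT => x; rewrite inE /= in_itv /=; exact: cf.
- split.
  + by move=> x; rewrite in_itv /= => /andP[/ltW ax /ltW xb]; apply/ex_derive/dF/andP.
  + by apply: cvg_at_right_filter; exact: cF.
  + by apply: cvg_at_left_filter; exact: cF.
- move=> x; rewrite in_itv /= => /andP[/ltW ax /ltW xb]; rewrite derive1E.
  by apply: derive_val; apply/dF/andP.
Qed.

Lemma measurable_powR_comp d (T : measurableType d) (D : set T) (f : T -> R) p :
  measurable_fun D f -> measurable_fun D (fun x => f x `^ p).
Proof. by move=> mf; exact: (measurableT_comp (measurable_powR p)). Qed.

Lemma powR_primitive (c x : R) : 0 < x -> c + 1 != 0 ->
  is_derive x 1 (fun y : R => (c + 1)^-1 * y `^ (c + 1)) (x `^ c).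
Proof.
move=> x0 c1.
apply: is_derive_eq; first by apply: (@is_deriveZ _ _ _ _ (c + 1)^-1); exact: is_derive1_powR.
by rewrite /GRing.scale /= addrK mulrA mulVf// mul1r.
Qed.

Lemma continuous_powR_pos c (x : R) : 0 < x -> {for x, continuous (fun y : R => y `^ c)}.
Proof.
move=> x0; apply/differentiable_continuous/derivable1_diffP.
exact: (@ex_derive _ _ _ _ _ _ _ (is_derive1_powR c x0)).
Qed.

Lemma integral_powR_itv c (x y : R) : 0 < x -> x < y -> c + 1 != 0 ->
  (\int[mu]_(w in `[x, y]) (w `^ c)%:E =
   ((c + 1)^-1 * (y `^ (c + 1) - x `^ (c + 1)))%:E)%E.
Proof.
move=> x0 xy c1; rewrite mulrBr; apply: (@FTC2_closed (fun w => w `^ c)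
  (fun z => (c + 1)^-1 * z `^ (c + 1)) x y xy) => w /andP[xw _].
  by apply: continuous_powR_pos; exact: lt_le_trans xw.
by apply: powR_primitive => //; exact: lt_le_trans xw.
Qed.

Lemma integral_powR_near0 c (v : R) : 0 < v -> -1 < c ->
  (\int[mu]_(w in `]0%R, v]) (w `^ c)%:E <= ((c + 1)^-1 * v `^ (c + 1))%:E)%E.
Proof.
move=> v0 c1; have c10 : 0 < c + 1 by lra.
(* Exhausts ]0, v] by compact intervals away from 0; the index shift by 2 keeps the left end
   strictly below v, as [integral_powR_itv] requires. *)
pose F (i : nat) := [set` `[v / i.+2%:R, v]].
have -> : [set` `]0%R, v]] = \bigcup_i F i.
  apply/seteqP; split => [x|x [i _]]; rewrite /F /= !in_itv /=; last first.
    by move=> /andP[xi ->]; rewrite andbT (lt_le_trans _ xi)// divr_gt0.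
  move=> /andP[x0 xv]; exists (Num.truncn (v / x)) => //=; rewrite in_itv /= xv andbT.
  rewrite ler_pdivrMr// mulrC -ler_pdivrMr// ltW//.
  by rewrite (lt_trans (truncnS_gt _))// ltr_nat.
have nd : nondecreasing_seq F.
  move=> i j ij; apply/subsetPset => x; rewrite /F /= !in_itv /= => /andP[xi ->].
  rewrite andbT; apply: le_trans xi; rewrite ler_pM2l// lef_pV2 ?posrE//.
  by rewrite ler_nat !ltnS.
have mF i : measurable (F i) by exact: measurable_itv.
have mf i : measurable_fun (F i) (fun w : R => (w `^ c)%:E).
  by apply/measurable_EFinP; apply: measurable_funTS; exact: measurable_powR.
have cv : (\int[mu]_(x in F i) (x `^ c)%:E @[i --> \oo] -->
    \int[mu]_(x in \bigcup_i F i) (x `^ c)%:E)%E.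
  apply: ge0_nondecreasing_set_cvg_integral => // i x _.
  by rewrite lee_fin powR_ge0.
rewrite -(cvg_lim _ cv)//; apply: lime_le; first by apply/cvg_ex; eexists; exact: cv.
apply: nearW => i; rewrite integral_powR_itv ?divr_gt0 ?gt_eqF//; last first.
  by rewrite ltr_pdivrMr// ltr_pMr// ltr1n.
rewrite lee_fin ler_wpM2l ?invr_ge0 ?(ltW c10)// gerBl; exact: powR_ge0.
Qed.

Lemma integral_powR_far c (t b : R) : 0 < t -> c < -1 ->
  (\int[mu]_(w in `[t, b]) (w `^ c)%:E <= ((- (c + 1))^-1 * t `^ (c + 1))%:E)%E.
Proof.
move=> t0 c1; have c10 : 0 < - (c + 1) by lra.
have r0 : 0 <= (- (c + 1))^-1 * t `^ (c + 1).
  by rewrite mulr_ge0 ?powR_ge0// invr_ge0 ltW.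
have [tb|bt] := ltP t b; last first.
  have [->|bt'] := eqVneq b t; first by rewrite set_itv1 integral_set1 lee_fin.
  rewrite set_itv_ge ?integral_set0 ?lee_fin// bnd_simp -ltNge lt_neqAle bt' bt//.
rewrite integral_powR_itv//; last by rewrite -oppr_eq0 gt_eqF.
have -> : (c + 1)^-1 * (b `^ (c + 1) - t `^ (c + 1)) =
  (- (c + 1))^-1 * (t `^ (c + 1) - b `^ (c + 1)) by rewrite invrN; ring.
rewrite lee_fin ler_wpM2l ?invr_ge0 ?(ltW c10)//.
by rewrite gerBl powR_ge0.
Qed.

(** A family of bounds that are affine in t^q and can therefore be integrated; the choice of l after
    the integration plays the role of convexity. *)
Lemma young_powR (q l t : R) : 1 < q -> 0 < l -> 0 <= t ->
  t <= l + l `^ (1 - q) * t `^ q.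
Proof.
move=> q1 l0 t0; have [tl|lt] := leP t l.
  by rewrite (le_trans tl)// lerDl mulr_ge0 ?powR_ge0.
have t0' := lt_trans l0 lt.
apply: le_trans (_ : l `^ (1 - q) * t `^ q <= _); last by rewrite lerDr ltW.
rewrite -(mulr_powRB1 t0 (lt_trans ltr01 q1)) mulrCA ler_peMr//.
rewrite -(opprB q 1) powRN mulrC ler_pdivlMr ?powR_gt0// mul1r.
by rewrite powR_le_mono ?ltW//; lra.
Qed.

Lemma young_powR_inv (q x m : R) : 1 < q -> 0 <= x -> 0 <= m ->
  (forall l, 0 < l -> x <= l + l `^ (1 - q) * m) -> x `^ q <= 2 `^ q * m.
Proof.
move=> q1 x0 m0 H; have q0 : 0 < q := lt_trans ltr01 q1.
have [x0'|x0'] := eqVneq x 0.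
  by rewrite x0' powR0 ?gt_eqF// mulr_ge0 ?powR_ge0.
(* The choice l = x / 2 absorbs half of x on the left. *)
have x2 : 0 < x / 2 by rewrite divr_gt0// lt_def x0' x0.
have := H _ x2; rewrite -lerBlDl (_ : x - x / 2 = x / 2); last by field.
rewrite -(opprB q 1) powRN [X in _ <= X]mulrC ler_pdivlMr ?powR_gt0//.
rewrite mulr_powRB1 ?(ltW x2)// powRM ?invr_ge0// => h.
have -> : x `^ q = 2 `^ q * (x `^ q * 2^-1 `^ q).
  rewrite mulrCA -powRM ?invr_ge0// mulfV// powR1 ?mulr1//.
by rewrite ler_wpM2l ?powR_ge0.
Qed.

(* Jensen's inequality for averages, with the harmless constant [2 `^ q]. *)
Lemma weak_jensen d (T : measurableType d) (m : {measure set T -> \bar R})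
    (D : set T) (q v x : R) (f : T -> R) :
  1 < q -> 0 < v -> measurable D -> (m D = v%:E)%E -> measurable_fun D f ->
  (forall t, D t -> 0 <= f t) -> 0 <= x ->
  ((x * v)%:E <= \int[m]_(t in D) (f t)%:E)%E ->
  ((x `^ q)%:E <= (2 `^ q / v)%:E * \int[m]_(t in D) (f t `^ q)%:E)%E.
Proof.
move=> q1 v0 mD mDv mf f0 x0 xv.
have mfq : measurable_fun D (fun t => (f t `^ q)%:E).
  by apply/measurable_EFinP/measurable_powR_comp.
have I0 : (0 <= \int[m]_(t in D) (f t `^ q)%:E)%E.
  by apply: integral_ge0 => t _; rewrite lee_fin powR_ge0.
have H l : 0 < l -> ((x * v)%:E <= (l * v)%:E +
    (l `^ (1 - q))%:E * \int[m]_(t in D) (f t `^ q)%:E)%E.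
  move=> l0; apply: le_trans xv _.
  rewrite -ge0_integralZl//; [|by move=> t _; rewrite lee_fin powR_ge0
    |by rewrite lee_fin powR_ge0].
  have -> : (l * v)%:E = (\int[m]_(t in D) (cst l%:E) t)%E.
    by rewrite integral_cst// mDv.
  rewrite -ge0_integralD//.
  - apply: integral_mono => t Dt; first by rewrite lee_fin f0.
    by rewrite -EFinM -EFinD lee_fin young_powR// f0.
  - by move=> t _; rewrite lee_fin ltW.
  - by move=> t _; rewrite mule_ge0// lee_fin powR_ge0.
  - by apply: emeasurable_funM => //; exact: measurable_cst.
case: (\int[m]_(t in D) (f t `^ q)%:E)%E I0 H => [M| |]//=; last first.
  by move=> _ _; rewrite gt0_muley ?leey// lte_fin divr_gt0// powR_gt0.
rewrite lee_fin => M0 H; rewrite -EFinM lee_fin -mulrA.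
apply: young_powR_inv => //; first by rewrite mulr_ge0// invr_ge0 ltW.
move=> l l0; have := H l l0; rewrite -EFinM -EFinD lee_fin => h.
by rewrite -(ler_pM2r v0) (le_trans h)// mulrDl -mulrA mulrA mulrA mulrAC mulfVK ?gt_eqF// lexx.
Qed.

End Hardy.

Section Hardy.
Context {R : realType}.
Local Notation mu := (@lebesgue_measure R).

Lemma integral_ifE d (T : measurableType d) (m : {measure set T -> \bar R})
    (P : T -> bool) (f : T -> \bar R) :
  (\int[m]_x (if P x then f x else 0) = \int[m]_(x in [set x | P x]) f x)%E.
Proof.
rewrite [RHS]integral_mkcond; apply: eq_integral => x _; rewrite /patch.
by case: ifPn => Px; [rewrite mem_set|rewrite memNset//; exact/negP].
Qed.

Lemma ge0_integral_scale d (T : measurableType d) (m : {measure set T -> \bar R})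
    (D : set T) (k : R) (f : T -> R) :
  measurable D -> measurable_fun D f -> 0 <= k -> (forall x, D x -> 0 <= f x) ->
  (\int[m]_(x in D) (k * f x)%:E = k%:E * \int[m]_(x in D) (f x)%:E)%E.
Proof.
move=> mD mf k0 f0; under eq_integral do rewrite EFinM.
by rewrite ge0_integralZl//; exact/measurable_EFinP.
Qed.

Lemma tonelli2 (f : R * R -> \bar R) :
  measurable_fun [set: measurableTypeR R * measurableTypeR R] f ->
  (forall x, 0 <= f x)%E ->
  (\int[mu]_x \int[mu]_y f (x, y) = \int[mu]_y \int[mu]_x f (x, y))%E.
Proof. by move=> mf f0; exact: (@fubini_tonelli _ _ _ _ _ mu mu f). Qed.

Lemma continuous_measurable (f : R -> R) (D : set R) : continuous f -> measurable_fun D f.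
Proof. by move=> /continuous_measurable_fun; exact: measurable_funTS. Qed.

(** By the fundamental theorem of calculus chi v / v is the mean of chi' over ]0, v]. *)
Lemma average_derivative_le (q v : R) (chi chi' : R -> R) : 1 < q -> 0 < v ->
  (forall x : R, is_derive x 1 chi (chi' x)) -> continuous chi' -> chi 0 = 0 ->
  ((`|chi v / v| `^ q)%:E <=
   (2 `^ q / v)%:E * \int[mu]_(t in `]0%R, v]) (`|chi' t| `^ q)%:E)%E.
Proof.
move=> q1 v0 dchi cchi chi0.
have mchi D : measurable_fun D chi' by exact: continuous_measurable.
have mn D : measurable_fun D (fun t => `|chi' t|) by exact: measurableT_comp.
apply: weak_jensen => //=.
  by rewrite lebesgue_measure_itv /= lte_fin v0 sube0.
  exact: mn.
rewrite normrM mulrAC -mulrA normfV (ger0_norm (ltW v0)) mulfV ?gt_eqF// mulr1.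
rewrite integral_itv_obnd_cbnd; last by apply/measurable_EFinP.
have -> : (`|chi v|%:E = `| \int[mu]_(t in `[0%R, v]) (chi' t)%:E |)%E.
  have -> := @FTC2_closed _ chi' chi 0 v v0 (fun x _ => cchi x) (fun x _ => dchi x).
  by rewrite chi0 subr0.
apply: le_trans (le_abse_integral _ _ _) _; rewrite ?lexx//.
by apply/measurable_EFinP; exact: mchi.
Qed.

(** The power of the mean is replaced by the mean of the power; then Tonelli applies on the triangle
    0 < t <= v <= b, where the integral of v^(- a - 1) over v >= t is at most t^(- a) / a. *)
Lemma hardy (q a b : R) (chi chi' : R -> R) : 1 < q -> 0 < a ->
  (forall x : R, is_derive x 1 chi (chi' x)) -> continuous chi' -> chi 0 = 0 ->
  (\int[mu]_(v in `]0%R, b]) (`|chi v / v| `^ q * v `^ (- a))%:E <=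
   (2 `^ q / a)%:E * \int[mu]_(t in `]0%R, b]) (`|chi' t| `^ q * t `^ (- a))%:E)%E.
Proof.
move=> q1 a0 dchi cchi chi0.
have mchi D : measurable_fun D chi' by exact: continuous_measurable.
have mf D : measurable_fun D (fun t => `|chi' t| `^ q).
  by apply: measurable_powR_comp; exact: measurableT_comp.
pose P (x : R * R) := [&& 0 < x.2, x.2 <= x.1 & x.1 <= b].
pose g (x : R * R) : \bar R :=
  if P x then (x.1 `^ (- a - 1) * `|chi' x.2| `^ q)%:E else 0%E.
have g0 x : (0 <= g x)%E.
  by rewrite /g; case: ifP => // _; rewrite lee_fin mulr_ge0 ?powR_ge0.
have m1 : measurable_fun [set: measurableTypeR R * measurableTypeR R] (fun x => x.1 : R).
  exact: measurable_fst.
have m2 : measurable_fun [set: measurableTypeR R * measurableTypeR R] (fun x => x.2 : R).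
  exact: measurable_snd.
have mg : measurable_fun [set: measurableTypeR R * measurableTypeR R] g.
  apply: measurable_fun_ifT => //.
  - apply: measurable_and; first exact: measurable_fun_ltr.
    by apply: measurable_and; apply: measurable_fun_ler.
  - apply/measurable_EFinP/measurable_funM; first exact: measurable_powR_comp.
    by apply: (measurableT_comp (mf setT)).
have q20 : 0 <= 2 `^ q :> R by exact: powR_ge0.
apply: (@le_trans _ _ ((2 `^ q)%:E * \int[mu]_v \int[mu]_t g (v, t))%E).
  rewrite -ge0_integralZl//; last 2 first.
  - by apply: measurable_fun_fubini_tonelli_F.
  - by move=> v _; apply: integral_ge0.
  rewrite [leLHS]integral_mkcond; apply: integral_mono => v _; rewrite /patch.
    by case: ifPn => // _; rewrite lee_fin mulr_ge0 ?powR_ge0.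
  case: ifPn => [|_]; last by rewrite mule_ge0// integral_ge0.
  rewrite inE /= in_itv /= => /andP[v0 vb].
  have -> : (\int[mu]_t g (v, t) = (v `^ (- a - 1))%:E *
      \int[mu]_(t in `]0%R, v]) (`|chi' t| `^ q)%:E)%E.
    rewrite -ge0_integralZl//; last 2 first.
    - by apply/measurable_EFinP; exact: mf.
    - by rewrite lee_fin powR_ge0.
    rewrite /g integral_ifE /P /=; under eq_set do rewrite vb andbT.
    rewrite (_ : [set x | (0 < x <= v)] = `]0, v]%classic)//.
  rewrite mulrC EFinM.
  apply: le_trans (lee_wpmul2l _ (average_derivative_le q1 v0 dchi cchi chi0)) _.
    by rewrite lee_fin powR_ge0.
  rewrite !muleA -!EFinM; apply: lee_wpmul2r; first by apply: integral_ge0 => t _; rewrite lee_fin powR_ge0.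
  rewrite lee_fin mulrCA ler_wpM2l// powRD; last by rewrite (gt_eqF v0) implybT.
  by rewrite powR_inv1// ltW.
rewrite tonelli2// EFinM -muleA; apply: lee_wpmul2l; first by rewrite lee_fin.
have mfa : measurable_fun `]0, b] (fun t => (`|chi' t| `^ q * t `^ (- a))%:E).
  apply/measurable_EFinP/measurable_funM => //.
  exact: measurable_powR_comp.
rewrite -ge0_integralZl//; last 2 first.
- by move=> t _; rewrite lee_fin mulr_ge0 ?powR_ge0.
- by rewrite lee_fin invr_ge0 ltW.
rewrite [leRHS]integral_mkcond; apply: integral_mono => t _.
  exact: integral_ge0.
have [t0|t0] := ltP 0 t; last first.
  rewrite integral0_eq; last first.
    by move=> v _; rewrite /g /P /= ltNge t0.
  apply: erestrict_ge0 => z _; rewrite mule_ge0// lee_fin ?invr_ge0 ?(ltW a0)//.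
  by rewrite mulr_ge0 ?powR_ge0.
rewrite /g integral_ifE /P /= t0 /=.
have [tb|bt] := leP t b; last first.
  rewrite (_ : [set _ | _] = set0) ?integral_set0; last first.
    by apply/seteqP; split => v //= /andP[tv vb]; have := le_trans tv vb; rewrite leNgt bt.
  apply: erestrict_ge0 => z _; rewrite mule_ge0// lee_fin ?invr_ge0 ?(ltW a0)//.
  by rewrite mulr_ge0 ?powR_ge0.
rewrite /patch mem_set; last by rewrite /= in_itv /= t0.
rewrite (_ : [set x : R | (t <= x <= b)] = `[t, b]%classic)//.
under eq_integral do rewrite mulrC.
rewrite ge0_integral_scale; [|exact: measurable_itv|exact: measurable_powR_comp
  |exact: powR_ge0|by move=> v _; exact: powR_ge0].
have a1 : - a - 1 < -1 by lra.
apply: le_trans (lee_wpmul2l _ (integral_powR_far b t0 a1)) _.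
  by rewrite lee_fin powR_ge0.
rewrite subrK opprK -!EFinM lee_fin; by rewrite mulrCA.
Qed.

End Hardy.

Section WeightedHardy.
Context {R : realType}.
Local Notation mu := (@lebesgue_measure R).

Lemma powRD_pos (x a b : R) : 0 < x -> x `^ (a + b) = x `^ a * x `^ b.
Proof. by move=> x0; rewrite powRD// (gt_eqF x0) implybT. Qed.

Lemma powRN_le (x y p : R) : 0 <= p -> 0 < x -> x <= y -> y `^ (- p) <= x `^ (- p).
Proof.
move=> p0 x0 xy; rewrite !powRN lef_pV2 ?posrE ?powR_gt0 ?(lt_le_trans x0)//.
by rewrite powR_le_mono// ltW.
Qed.

(** [powR] with exponent -1 is the inverse only on nonnegative numbers, hence the detour through f /
    f^2; both sides vanish where f does. *)
Lemma measurable_funV d (T : measurableType d) (D : set T) (f : T -> R) :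
  measurable_fun D f -> measurable_fun D (fun x => (f x)^-1).
Proof.
move=> mf; rewrite (_ : (fun _ => _) = (fun x => f x * (f x ^+ 2) `^ (-1))).
  by apply: measurable_funM => //; apply/measurable_powR_comp/measurable_funX.
apply/funext => x; rewrite powR_inv1 ?sqr_ge0//.
have [->|fx0] := eqVneq (f x) 0; first by rewrite invr0 mul0r.
by rewrite expr2 invfM mulrA mulfV// mul1r.
Qed.

Definition weight_const (p q : R) : R := (q - p + 1)^-1 + (2 * p - q - 1)^-1.

(** Split at w = v. Below, (v + w)^(- p) is at most v^(- p) and p < q + 1 gives integrability at 0;
    above, it is at most w^(- p) and q + 1 < 2 p gives decay. The pieces yield the two summands of
    [weight_const]. *)
Lemma weight_integral (p q v b : R) : 0 <= p -> p < q + 1 -> q + 1 < 2 * p ->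
  0 < v <= b ->
  (\int[mu]_(w in `]0%R, b]) (w `^ (q - p) * (v + w) `^ (- p))%:E <=
   (weight_const p q * v `^ (q - 2 * p + 1))%:E)%E.
Proof.
move=> p0 pq qp /andP[v0 vb].
have mf D : measurable_fun D (fun w : R => (w `^ (q - p) * (v + w) `^ (- p))%:E).
  apply/measurable_EFinP/measurable_funM; first exact: measurable_powR_comp.
  by apply: measurable_powR_comp; apply: measurable_funD.
have f0 w : (0 <= (w `^ (q - p) * (v + w) `^ (- p))%:E)%E.
  by rewrite lee_fin mulr_ge0 ?powR_ge0.
rewrite (@itv_bndbnd_setU _ _ _ (BRight v)) ?bnd_simp ?(ltW v0)//.
rewrite ge0_integral_setU//; [|exact: mf|]; last first.
  by apply/disj_setPS => x [] /=; rewrite !in_itv /= => /andP[_ x1] /andP[]; lra.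
rewrite /weight_const mulrDl EFinD; apply: leeD.
- apply: (@le_trans _ _ (\int[mu]_(w in `]0%R, v]) (v `^ (- p) * w `^ (q - p))%:E)%E).
    apply: integral_mono => // w; rewrite /= in_itv /= => /andP[w0 wv].
    rewrite lee_fin mulrC ler_wpM2r ?powR_ge0// powRN_le//; lra.
  rewrite ge0_integral_scale; [|exact: measurable_itv|exact: measurable_powR_comp
    |exact: powR_ge0|by move=> w _; exact: powR_ge0].
  have qp1 : -1 < q - p by lra.
  apply: le_trans (lee_wpmul2l _ (integral_powR_near0 v0 qp1)) _.
    by rewrite lee_fin powR_ge0.
  rewrite -EFinM lee_fin mulrCA -powRD_pos//.
  by rewrite (_ : - p + (q - p + 1) = q - 2 * p + 1)//; ring.
- apply: (@le_trans _ _ (\int[mu]_(w in `]v, b]) (w `^ (q - 2 * p))%:E)%E).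
    apply: integral_mono => // w; rewrite /= in_itv /= => /andP[vw wb].
    have w0 : 0 < w := lt_trans v0 vw.
    rewrite lee_fin (_ : q - 2 * p = (q - p) + (- p)); last by ring.
    by rewrite (powRD_pos (q - p) (- p) w0) ler_wpM2l ?powR_ge0// powRN_le//; lra.
  rewrite integral_itv_obnd_cbnd; last first.
    by apply/measurable_EFinP; exact: measurable_powR_comp.
  have qp1 : q - 2 * p < -1 by lra.
  apply: le_trans (integral_powR_far b v0 qp1) _.
  by rewrite (_ : - (q - 2 * p + 1) = 2 * p - q - 1)//; ring.
Qed.

Lemma weight_const_ge0 (p q : R) : p < q + 1 -> q + 1 < 2 * p -> 0 <= weight_const p q.
Proof. by move=> ? ?; rewrite addr_ge0 ?invr_ge0//; lra. Qed.

Lemma hardy_weighted (p q b : R) (chi chi' : R -> R) : 1 < q -> 0 <= p ->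
  p < q + 1 -> q + 1 < 2 * p -> 0 < 3 * p - 2 * q - 1 ->
  (forall x : R, is_derive x 1 chi (chi' x)) -> continuous chi' -> chi 0 = 0 ->
  (\int[mu]_(v in `]0%R, b]) \int[mu]_(w in `]0%R, b])
     (`|chi v / v| `^ q * v `^ (q - p) * (w `^ (q - p) * (v + w) `^ (- p)))%:E <=
   (weight_const p q * (2 `^ q / (3 * p - 2 * q - 1)))%:E *
   \int[mu]_(t in `]0%R, b]) (`|chi' t| `^ q * t `^ (- (3 * p - 2 * q - 1)))%:E)%E.
Proof.
move=> q1 p0 pq qp a0 dchi cchi chi0.
have W0 := weight_const_ge0 pq qp.
have cchi' : continuous chi.
  move=> x; apply/differentiable_continuous/derivable1_diffP.
  exact: ex_derive.
rewrite EFinM -muleA.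
apply: le_trans (lee_wpmul2l _ (hardy b q1 a0 dchi cchi chi0)); last by rewrite lee_fin.
rewrite -ge0_integral_scale//; last 2 first.
- apply: measurable_funM; last exact: measurable_powR_comp.
  apply: measurable_powR_comp; apply: measurableT_comp => //.
  apply: measurable_funM; first exact: continuous_measurable.
  exact: measurable_funV.
- by move=> x _; rewrite mulr_ge0 ?powR_ge0.
apply: integral_mono => v; rewrite /= in_itv /= => vb.
  by apply: integral_ge0 => w _; rewrite lee_fin !mulr_ge0 ?powR_ge0.
rewrite ge0_integral_scale; last 4 first.
- exact: measurable_itv.
- apply: measurable_funM; first exact: measurable_powR_comp.
  by apply: measurable_powR_comp; apply: measurable_funD.
- by rewrite mulr_ge0 ?powR_ge0.
- by move=> w _; rewrite mulr_ge0 ?powR_ge0.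
apply: le_trans (lee_wpmul2l _ (weight_integral p0 pq qp vb)) _.
  by rewrite lee_fin mulr_ge0 ?powR_ge0.
rewrite -EFinM lee_fin.
have v0 : 0 < v by case/andP: vb.
rewrite mulrCA -!mulrA -powRD_pos//.
by rewrite (_ : q - p + (q - 2 * p + 1) = - (3 * p - 2 * q - 1))//; ring.
Qed.

End WeightedHardy.

(** * Continuously differentiable representatives *)

Lemma powR_le_cancel (R : realType) (q x y : R) : 0 < q -> 0 <= x -> 0 <= y ->
  x `^ q <= y `^ q -> x <= y.
Proof.
move=> q0 x0 y0; apply: contra_le => yx.
by apply: gt0_ltr_powR; rewrite ?nnegrE.
Qed.

Definition gagliardo_le (R : realType) (D : R -> R) (q al r : R) : Prop :=
  (\int[@lebesgue_measure R]_(u in `[0%R, 1%R])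
     \int[@lebesgue_measure R]_(w in `[(- 2^-1)%R, (2^-1)%R])
     (`|D (u + w) - D u| `^ q / `|w| `^ al)%:E <= (r `^ q)%:E)%E.

Definition slope (R : realType) (f : R -> R) (a b : R) : R := (f b - f a) / (b - a).

(** * Oscillation of the averages of the derivative *)

Section SlopeOscillation.
Context {R : realType}.
Local Notation mu := (@lebesgue_measure R).
Variables (f D : R -> R) (q al r : R).
Hypotheses (q1 : 1 < q) (al2 : 2 < al) (r0 : 0 <= r).
Hypothesis mD : measurable_fun [set: R] D.
Hypothesis D1 : forall x, D (x + 1) = D x.
Hypothesis iD : forall a b, mu.-integrable `[a, b] (EFin \o D).
Hypothesis fD : forall a b, a <= b -> f b - f a = \int[mu]_(t in `[a, b]) D t.
Hypothesis Dr : gagliardo_le D q al r.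

Let S (y : R) : \bar R := (\int[mu]_(w in `[(- 2^-1)%R, (2^-1)%R])
  (`|D (y + w) - D y| `^ q / `|w| `^ al)%:E)%E.

Let mDdist : measurable_fun [set: measurableTypeR R * measurableTypeR R]
  (fun x => `|D x.2 - D x.1| `^ q).
Proof.
apply: measurable_powR_comp; apply: measurableT_comp => //.
apply: measurable_funB; first exact: (measurableT_comp mD measurable_snd).
exact: (measurableT_comp mD measurable_fst).
Qed.

Let mS : measurable_fun [set: R] S.
Proof.
pose F (x : measurableTypeR R * measurableTypeR R) : \bar R :=
  if x.2 \in `[(- 2^-1), 2^-1]%R then
    (`|D (x.1 + x.2) - D x.1| `^ q / `|x.2| `^ al)%:E else 0%E.
have -> : S = fun y => (\int[mu]_w F (y, w))%E.
  by apply/funext => y; rewrite /F integral_ifE.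
have m1 : measurable_fun [set: measurableTypeR R * measurableTypeR R] (fun x => x.1 : R).
  exact: measurable_fst.
have m2 : measurable_fun [set: measurableTypeR R * measurableTypeR R] (fun x => x.2 : R).
  exact: measurable_snd.
apply: (measurable_fun_fubini_tonelli_F F).
- apply: measurable_fun_ifT => //.
    rewrite (_ : (fun _ => _) = (fun x : measurableTypeR R * measurableTypeR R =>
      ((- 2^-1 : R) <= x.2) && (x.2 <= (2^-1 : R)))); last first.
      by apply/funext => x; rewrite in_itv.
    by apply: measurable_and; apply: measurable_fun_ler.
  apply/measurable_EFinP/measurable_funM.
    apply: measurable_powR_comp; apply: measurableT_comp => //.
    apply: measurable_funB; last exact: (measurableT_comp mD m1).
    by apply: (measurableT_comp mD); exact: measurable_funD.
  by apply/measurable_funV/measurable_powR_comp; exact: measurableT_comp.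
- by move=> x; rewrite /F; case: ifP => // _; rewrite lee_fin divr_ge0 ?powR_ge0.
Qed.

(** A Campanato-type bound: on the square |z - y| <= b - a, so the factor (b - a)^al / |z - y|^al
    that produces the Gagliardo integrand is at least 1 off the diagonal, where alone the integrand
    is nonzero. *)
Let double_integral_le (a b : R) : a <= b -> b - a <= 2^-1 ->
  (\int[mu]_(y in `[a, b]) \int[mu]_(z in `[a, b]) (`|D z - D y| `^ q)%:E <=
   ((b - a) `^ al * r `^ q)%:E)%E.
Proof.
move=> ab ab2; move: (q1) (al2) (r0) => q1' al2' r0'.
apply: (@le_trans _ _ (\int[mu]_(y in `[a, b]) (((b - a) `^ al)%:E * S y))%E).
  suff step (y : R) : a <= y -> y <= b ->
      (\int[mu]_(z in `[a, b]) (`|D z - D y| `^ q)%:E <= ((b - a) `^ al)%:E * S y)%E.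
    apply: integral_mono => y; rewrite /= in_itv /= => /andP[ay yb].
      by apply: integral_ge0 => z _; rewrite lee_fin powR_ge0.
    exact: step.
  move=> ay yb; have -> : `[a, b]%classic = [set z | `[a - y, b - y]%classic (z + (- y))].
    by apply/seteqP; split => z /=; rewrite !in_itv /= !lerD2r.
  under eq_integral => z _ do rewrite -[X in D X - _](subrK y) (addrC _ y).
  have mz : measurable_fun [set: R] (fun w => (`|D (y + w) - D y| `^ q)%:E).
    apply/measurable_EFinP/measurable_powR_comp; apply: measurableT_comp => //.
    apply: measurable_funB => //; apply: (measurableT_comp mD).
    exact: measurable_funD.
  rewrite (@integral_shift _ (- y) _ (fun w => (`|D (y + w) - D y| `^ q)%:E)
    (measurable_itv _) (measurable_funTS mz) (fun w _ => powR_ge0 _ _)).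
  have mw : measurable_fun [set: R] (fun w => `|D (y + w) - D y| `^ q / `|w| `^ al).
    apply: measurable_funM.
      apply: measurable_powR_comp; apply: measurableT_comp => //.
      apply: measurable_funB => //; apply: (measurableT_comp mD).
      exact: measurable_funD.
    by apply/measurable_funV/measurable_powR_comp; exact: normr_measurable.
  rewrite /S -ge0_integral_scale; [|exact: measurable_itv|exact: measurable_funTS
    |exact: powR_ge0|by move=> w _; rewrite divr_ge0 ?powR_ge0].
  apply: (@le_trans _ _ (\int[mu]_(w in `[(a - y)%R, (b - y)%R])
      ((b - a) `^ al * (`|D (y + w) - D y| `^ q / `|w| `^ al))%:E)%E).
    have key (w : R) : a - y <= w <= b - y -> `|D (y + w) - D y| `^ q <=
        (b - a) `^ al * (`|D (y + w) - D y| `^ q / `|w| `^ al).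
      move=> /andP[w1 w2]; have [->|w0] := eqVneq w 0.
        by rewrite addr0 subrr normr0 powR0 ?mul0r ?mulr0// gt_eqF//; lra.
      rewrite mulrCA ler_peMr ?powR_ge0// ler_pdivlMr ?powR_gt0 ?normr_gt0// mul1r.
      apply: powR_le_mono => //; first by lra.
      by rewrite ler_norml; apply/andP; split; lra.
    apply: integral_mono => w; rewrite /= in_itv /= => wab.
      by rewrite lee_fin powR_ge0.
    by rewrite lee_fin; exact: key.
  have sub : `[a - y, b - y]%classic `<=` `[- 2^-1, 2^-1]%classic.
    by move=> w; rewrite /= !in_itv /= => /andP[w1 w2]; apply/andP; split; lra.
  apply: ge0_subset_integral => //.
  - by apply/measurable_EFinP; apply: measurable_funTS; apply: measurable_funM.
  - by move=> w _; rewrite lee_fin !mulr_ge0 ?invr_ge0 ?powR_ge0.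
have S0 y : (0 <= S y)%E.
  by apply: integral_ge0 => w _; rewrite lee_fin divr_ge0 ?powR_ge0.
rewrite ge0_integralZl//; [|exact: measurable_funTS|by rewrite lee_fin powR_ge0].
rewrite EFinM; apply: lee_wpmul2l; first by rewrite lee_fin powR_ge0.
apply: le_trans Dr; rewrite -/S.
(* By periodicity [a, b] may be regarded as part of a single period. *)
have S1 x : S (x + 1) = S x.
  by apply: eq_integral => w _; rewrite D1 (addrAC x) D1.
rewrite -(integral_period a mS S0 S1).
have sub : `[a, b]%classic `<=` `[a, a + 1]%classic.
  by move=> x; rewrite /= !in_itv /= => /andP[ax xb]; apply/andP; split; lra.
apply: ge0_subset_integral => //; first exact: measurable_funTS.
by move=> x _; exact: S0.
Qed.

(** By the integral representation of f, [slope f a b] is the mean of D over [a, b]. *)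
Let slope_deviation (a b c : R) : a < b ->
  ((`|slope f a b - c| * (b - a))%:E <= \int[mu]_(z in `[a, b]) (`|D z - c|)%:E)%E.
Proof.
move=> ab; have ba : 0 < b - a by rewrite subr_gt0.
have icst : mu.-integrable `[a, b] (EFin \o cst c).
  apply: continuous_compact_integrable; first exact: segment_compact.
  by apply: continuous_subspaceT => x; exact: cst_continuous.
have iDc : mu.-integrable `[a, b] (EFin \o (fun z => D z - c)).
  by have := integrableB _ (iD a b) icst; apply; exact: measurable_itv.
have -> : `|slope f a b - c| * (b - a) = `|\int[mu]_(z in `[a, b]) (D z - c)|.
  rewrite (RintegralB _ (iD a b) icst)// -fD ?ltW// Rintegral_cst//.
  rewrite /= lebesgue_measure_itv /= lte_fin ab /=.
  rewrite -[X in _ * X](ger0_norm (ltW ba)) -normrM mulrBl divfK ?gt_eqF//.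
rewrite EFin_normr_Rintegral//; apply: le_abse_integral => //.
by case/integrableP : iDc.
Qed.

(* Applying [weak_jensen] on [I] and then on [J] bounds the [q]-th power of the
   difference of the two averages by the double average of [|D z - D y| ^ q]. *)
Lemma slope_near (a b a' b' : R) : a <= a' -> a' < b' -> b' <= b -> b - a <= 2^-1 ->
  b - a <= 2 * (b' - a') ->
  `|slope f a' b' - slope f a b| <= 8 * r * (b - a) `^ ((al - 2) / q).
Proof.
move=> aa' ab' bb' ab2 abab'; move: (q1) (al2) (r0) => q1' al2' r0'.
have ab : a < b by lra.
have l0 : 0 < b - a by rewrite subr_gt0.
have l0' : 0 < b' - a' by rewrite subr_gt0.
have mDc c E : measurable_fun E (fun z => `|D z - c|).
  apply: measurableT_comp => //; apply: measurable_funB => //.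
  exact: measurable_funTS.
have muI (x y : R) : x < y -> mu `[x, y] = (y - x)%:E.
  by move=> xy; rewrite /= lebesgue_measure_itv /= lte_fin xy.
have J1 y : ((`|slope f a b - D y| `^ q)%:E <= (2 `^ q / (b - a))%:E *
    \int[mu]_(z in `[a, b]) (`|D z - D y| `^ q)%:E)%E.
  apply: weak_jensen => //=; [exact: muI|exact: mDc|exact: slope_deviation].
have J2 : ((`|slope f a' b' - slope f a b| `^ q)%:E <= (2 `^ q / (b' - a'))%:E *
    \int[mu]_(y in `[a', b']) (`|D y - slope f a b| `^ q)%:E)%E.
  apply: weak_jensen => //=; [exact: muI|exact: mDc|exact: slope_deviation].
have F0 y : (0 <= \int[mu]_(z in `[a, b]) (`|D z - D y| `^ q)%:E)%E.
  by apply: integral_ge0 => z _; rewrite lee_fin powR_ge0.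
have mF : measurable_fun [set: R] (fun y => \int[mu]_(z in `[a, b]) (`|D z - D y| `^ q)%:E)%E.
  pose F (x : measurableTypeR R * measurableTypeR R) : \bar R :=
    if x.2 \in `[a, b]%R then (`|D x.2 - D x.1| `^ q)%:E else 0%E.
  have -> : (fun y => \int[mu]_(z in `[a, b]) (`|D z - D y| `^ q)%:E)%E =
      fun y => (\int[mu]_w F (y, w))%E.
    by apply/funext => y; rewrite /F integral_ifE.
  apply: (measurable_fun_fubini_tonelli_F F).
  - apply: measurable_fun_ifT => //; last exact/measurable_EFinP.
    rewrite (_ : (fun _ => _) = (fun x : measurableTypeR R * measurableTypeR R =>
      ((a : R) <= x.2) && (x.2 <= (b : R)))); last first.
      by apply/funext => x; rewrite in_itv.
    have m2 : measurable_fun [set: measurableTypeR R * measurableTypeR R] (fun x => x.2 : R).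
      exact: measurable_snd.
    by apply: measurable_and; apply: measurable_fun_ler.
  - by move=> x; rewrite /F; case: ifP => // _; rewrite lee_fin powR_ge0.
have {}J2 : ((`|slope f a' b' - slope f a b| `^ q)%:E <= (2 `^ q / (b' - a'))%:E *
    ((2 `^ q / (b - a))%:E * ((b - a) `^ al * r `^ q)%:E))%E.
  apply: le_trans J2 _; apply: lee_wpmul2l.
    by rewrite lee_fin divr_ge0 ?powR_ge0// ltW.
  have c0 : (0 <= (2 `^ q / (b - a))%:E)%E.
    by rewrite lee_fin divr_ge0 ?powR_ge0// ltW.
  apply: le_trans (lee_wpmul2l c0 (double_integral_le (ltW ab) ab2)).
  rewrite -ge0_integralZl//; last exact: measurable_funTS.
  have sub : `[a', b']%classic `<=` `[a, b]%classic.
    by move=> y; rewrite /= !in_itv /= => /andP[y1 y2]; apply/andP; split; lra.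
  apply: (@le_trans _ _ (\int[mu]_(y in `[a', b']) ((2 `^ q / (b - a))%:E *
    \int[mu]_(z in `[a, b]) (`|D z - D y| `^ q)%:E))%E).
    apply: integral_mono => y _; first by rewrite lee_fin powR_ge0.
    by rewrite distrC.
  apply: ge0_subset_integral => //.
  - apply: measurable_funTS; apply: emeasurable_funM => //; exact: measurable_cst.
  - by move=> y _; rewrite mule_ge0.
move: J2; rewrite -!EFinM lee_fin => J2.
have q0 : 0 < q by lra.
have l20 : 0 <= (b - a) `^ ((al - 2) / q) by exact: powR_ge0.
apply: (powR_le_cancel q0) => //; first by rewrite !mulr_ge0.
apply: le_trans J2 _; rewrite !powRM ?mulr_ge0// -powRrM divfK ?gt_eqF//.
have -> : (b - a) `^ al = (b - a) `^ (al - 2) * (b - a) ^+ 2.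
  by rewrite -powR_mulrn ?ltW// -powRD_pos// subrK.
(* Two factors 2^q come from the two uses of [weak_jensen]; the third absorbs the ratio of lengths
   (b - a) / (b' - a') <= 2. *)
have -> : 8 `^ q = 2 `^ q * (2 `^ q * 2 `^ q) :> R.
  by rewrite -!powRM//; congr powR; ring.
set P := (b - a) `^ (al - 2); set Q := 2 `^ q; set T := r `^ q.
have P0 : 0 <= P by exact: powR_ge0.
have T0 : 0 <= T by exact: powR_ge0.
have Q2 : 2 <= Q by apply: le1r_powR; [rewrite ler1n|exact: ltW].
have -> : Q / (b' - a') * (Q / (b - a) * (P * (b - a) ^+ 2 * T)) =
  (Q * Q * T * P) * ((b - a) / (b' - a')) by field; rewrite !gt_eqF.
have -> : Q * (Q * Q) * T * P = (Q * Q * T * P) * Q by ring.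
apply: ler_wpM2l; first by rewrite !mulr_ge0// /Q powR_ge0.
by apply: le_trans Q2; rewrite ler_pdivrMr.
Qed.

End SlopeOscillation.

(** * From Hoelder bounds on slopes to a Hoelder continuous derivative *)

Section HoelderSlopes.
Context {R : realType}.

Lemma small_powR_le (K b e : R) : 0 <= K -> 0 < b -> 0 < e ->
  exists2 d : R, 0 < d <= 2^-1 & forall t, 0 <= t <= d -> K * t `^ b <= e.
Proof.
move=> K0 b0 e0; have K1 : 0 < K + 1 by lra.
exists (Num.min 2^-1 ((e / (K + 1)) `^ b^-1)) => [|t].
  by rewrite lt_min ge_min lexx powR_gt0 ?divr_gt0// invr_gt0 ltr0n.
rewrite le_min => /and3P[t0 _ te].
have := powR_le_mono (ltW b0) t0 te.
rewrite -powRrM mulVf ?gt_eqF// powRr1; last by rewrite divr_ge0 ?ltW.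
rewrite ler_pdivlMr// => h; have := powR_ge0 t b; lra.
Qed.

Variables (f : R -> R) (C b : R).
Hypotheses (C0 : 0 <= C) (b0 : 0 < b).
Hypothesis near_slopes : forall x y x' y' : R,
  x <= x' -> x' < y' -> y' <= y -> y - x <= 2^-1 -> y - x <= 2 * (y' - x') ->
  `|slope f x' y' - slope f x y| <= C * (y - x) `^ b.

(** C times the sum of the geometric series over intervals of successively halved length. *)
Definition slope_const : R := C / (1 - 2 `^ (- b)).

Let th_lt1 : 2 `^ (- b) < 1 :> R.
Proof.
rewrite powRN invf_lt1 ?powR_gt0//.
have := @gt0_ltr_powR R b b0 1 2; rewrite powR1; apply; rewrite ?nnegrE//.
by rewrite ltr1n.
Qed.

Let K := slope_const.

Lemma slope_const_ge0 : 0 <= slope_const.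
Proof. by rewrite divr_ge0// subr_ge0 ltW. Qed.

Let C_le_K : C <= K.
Proof.
rewrite /K /slope_const ler_pdivlMr ?subr_gt0// ler_piMr// gerBl; exact: powR_ge0.
Qed.

(** Removes the condition that the two lengths be comparable: one passes from [x, y] to [x', y']
    through nested intervals of halved length, and the errors form a geometric series. *)
Lemma slope_sub (x y x' y' : R) : x <= x' -> x' < y' -> y' <= y -> y - x <= 2^-1 ->
  `|slope f x' y' - slope f x y| <= K * (y - x) `^ b.
Proof.
have [n] : exists n, y - x <= 2 ^+ n * (y' - x') \/ y' <= x'.
  have [yx|xy] := leP y' x'; first by exists 0%N; right.
  exists (Num.truncn ((y - x) / (y' - x'))).+1; left.
  rewrite -ler_pdivrMr ?subr_gt0//; apply/ltW/(lt_trans (truncnS_gt _)).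
  by rewrite -natrX ltr_nat ltn_expl.
elim: n x y => [|n ih] x y [h xx' xy' yy' yx|h _ xy']; try by rewrite ltNge h in xy'.
  rewrite expr0 mul1r in h; apply: le_trans (near_slopes xx' xy' yy' yx _) _; first lra.
  by rewrite ler_wpM2r ?powR_ge0.
have [h2|h2] := leP (y - x) (2 * (y' - x')).
  apply: le_trans (near_slopes xx' xy' yy' yx h2) _.
  by rewrite ler_wpM2r ?powR_ge0.
(* An interval of half the length between the two: it starts at x' unless it would then extend
   beyond y. *)
pose c := Num.min x' (y - (y - x) / 2); pose d := c + (y - x) / 2.
have cx' : c <= x' by rewrite ge_min lexx.
have cy : c <= y - (y - x) / 2 by rewrite ge_min lexx orbT.
have xc : x <= c by rewrite le_min xx'; lra.
have y'd : y' <= d.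
  by rewrite /d /c; case: (leP x') => _; lra.
have dE : d - c = (y - x) / 2 by rewrite /d; lra.
have h3 : `|slope f x' y' - slope f c d| <= K * (d - c) `^ b.
  apply: ih => //; last by rewrite dE; lra.
  by left; rewrite dE; move: h; rewrite exprS; lra.
have h4 : `|slope f c d - slope f x y| <= C * (y - x) `^ b.
  by apply: near_slopes => //; rewrite ?dE; lra.
have -> : slope f x' y' - slope f x y =
  (slope f x' y' - slope f c d) + (slope f c d - slope f x y) by ring.
apply: le_trans (ler_normD _ _) _; apply: le_trans (lerD h3 h4) _.
have yx0 : 0 <= y - x by lra.
rewrite dE powRM ?invr_ge0// -[2^-1]powR_inv1// -powRrM mulN1r mulrA mulrAC -mulrDl.
rewrite ler_wpM2r ?powR_ge0// /K /slope_const.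
have h1 : 1 - 2 `^ (- b) != 0 :> R by rewrite gt_eqF// subr_gt0.
by rewrite le_eqVlt; apply/orP; left; apply/eqP; field.
Qed.

Lemma slopeC (x y : R) : slope f x y = slope f y x.
Proof. by rewrite /slope -(opprB (f x)) -(opprB x) invrN mulrNN. Qed.

Lemma quotientE (x h : R) : h^-1 *: ((f \o shift x) (h *: 1) - f x) = slope f x (x + h).
Proof. by rewrite /slope /= (addrC x) addrK /GRing.scale /= mulr1 mulrC. Qed.

Lemma slope_at (x y z h : R) : x <= z <= y -> x <= z + h <= y -> h != 0 -> y - x <= 2^-1 ->
  `|slope f z (z + h) - slope f x y| <= K * (y - x) `^ b.
Proof.
move=> /andP[xz zy] /andP[xzh zhy] h0 yx; have [hp|hn] := ltP 0 h.
  by apply: slope_sub => //; lra.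
have hn' : h < 0 by rewrite lt_neqAle h0.
by rewrite slopeC; apply: slope_sub => //; lra.
Qed.

(** All difference quotients at x with small increments are close to the slope of one symmetric
    interval, hence Cauchy. This gives a classical derivative at every point, where [W1] provides
    one only almost everywhere. *)
Lemma slope_derivable (x : R) : derivable f x 1.
Proof.
apply/cauchy_cvgP/cauchy_exP => e e0.
have e2 : 0 < e / 2 by rewrite divr_gt0.
have [d /andP[d0 d2] hd] := small_powR_le slope_const_ge0 b0 e2.
exists (slope f (x - d / 2) (x + d / 2)).
rewrite nbhs_simpl /=; apply/nbhs_normP; exists (d / 2) => /=; first by rewrite divr_gt0.
move=> h /=; rewrite /ball_ /= sub0r normrN => hd2 h0.
rewrite -ball_normE /= quotientE distrC.
move: hd2; rewrite ltr_norml => /andP[h1 h2].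
apply: le_lt_trans (@slope_at _ _ _ _ _ _ h0 _) _; try by apply/andP; split; lra.
  by lra.
apply: le_lt_trans (hd _ _) _; last by lra.
by apply/andP; split; lra.
Qed.

Lemma derive1_slope (x y z : R) : x <= z <= y -> x < y -> y - x <= 2^-1 ->
  `|derive1 f z - slope f x y| <= K * (y - x) `^ b.
Proof.
move=> /andP[xz zy] xy yx; apply/ler_addgt0Pr => e e0.
have : (h^-1 *: ((f \o shift z) (h *: 1) - f z)) @[h --> 0^'] --> derive1 f z.
  by rewrite derive1E; exact: slope_derivable.
move=> /cvgrPdist_le /(_ e e0).
move=> /nbhs_normP[d /= d0 hd].
(* The increment has to point into [x, y], hence is negative when z = y. *)
have [h [h0 hd' hxy]] : exists h, [/\ h != 0, `|h| < d & x <= z + h <= y].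
  have [zy'|yz] := ltP z y.
    pose h := Num.min (d / 2) (y - z).
    have h0 : 0 < h by rewrite lt_min divr_gt0//= subr_gt0.
    have h1 : h <= d / 2 by rewrite ge_min lexx.
    have h2 : h <= y - z by rewrite ge_min lexx orbT.
    exists h; split; [by rewrite gt_eqF| |by apply/andP; split; lra].
    by rewrite gtr0_norm//; lra.
  pose h := Num.min (d / 2) (z - x).
  have h0 : 0 < h by rewrite lt_min divr_gt0//= subr_gt0 (lt_le_trans xy).
  have h1 : h <= d / 2 by rewrite ge_min lexx.
  have h2 : h <= z - x by rewrite ge_min lexx orbT.
  exists (- h); split; [by rewrite oppr_eq0 gt_eqF| |by apply/andP; split; lra].
  by rewrite normrN gtr0_norm//; lra.
have := hd h; rewrite /ball_ /= sub0r normrN => /(_ hd' h0).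
rewrite quotientE => he.
have -> : derive1 f z - slope f x y =
    (derive1 f z - slope f z (z + h)) + (slope f z (z + h) - slope f x y) by ring.
apply: le_trans (ler_normD _ _) _; rewrite addrC lerD//.
by apply: slope_at => //; rewrite ?xz.
Qed.

Lemma derive1_hoelder (x y : R) : `|x - y| <= 2^-1 ->
  `|derive1 f x - derive1 f y| <= 2 * K * `|x - y| `^ b.
Proof.
wlog xy : x y / x <= y.
  move=> H xy; have [xy'|/ltW xy'] := leP x y; first exact: H.
  by rewrite distrC (distrC x); apply: H => //; rewrite distrC.
move=> xy2; have [->|xy'] := eqVneq x y.
  by rewrite !subrr !normr0 powR0 ?mulr0// gt_eqF.
have {}xy' : x < y by rewrite lt_neqAle xy'.
rewrite distrC ger0_norm ?subr_ge0// in xy2.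
have hx := @derive1_slope x y x (introT andP (conj (lexx _) xy)) xy' xy2.
have hy := @derive1_slope x y y (introT andP (conj xy (lexx _))) xy' xy2.
rewrite (distrC x) (@ger0_norm _ (y - x)) ?subr_ge0//.
have -> : derive1 f x - derive1 f y =
    (derive1 f x - slope f x y) - (derive1 f y - slope f x y) by ring.
apply: le_trans (ler_normB _ _) _; lra.
Qed.

Lemma derive1_continuous : continuous (derive1 f).
Proof.
move=> x; apply/cvgrPdist_le => e e0.
have K20 : 0 <= 2 * K by rewrite mulr_ge0 ?slope_const_ge0.
have [d /andP[d0 d2] hd] := small_powR_le K20 b0 e0.
apply/nbhs_normP; exists d => //= y; rewrite /ball_ /= => xy.
apply: le_trans (derive1_hoelder _) _; first by rewrite (le_trans (ltW xy)).
by apply: hd; rewrite normr_ge0 ltW.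
Qed.

(** By Rolle a periodic function has a critical point c between x and x + 1; one of these two points
    is within 1/2 of c, and there the Hoelder bound applies. Thus the oscillation of the derivative
    controls its size. *)
Lemma derive1_le_of_periodic : (forall x, f (x + 1) = f x) ->
  forall x, `|derive1 f x| <= 2 * K.
Proof.
move=> f1 x.
have fc y : {for y, continuous f}.
  by apply/differentiable_continuous/derivable1_diffP; exact: slope_derivable.
have x1 : x < x + 1 by rewrite ltrDl.
have [c cx] := @Rolle R f x (x + 1) x1 (fun y _ => @slope_derivable y)
  (continuous_subspaceT fc) (esym (f1 x)).
move=> c0.
have c0' : derive1 f c = 0 by rewrite derive1E (@derive_val _ _ _ _ _ _ _ c0).
have d1 y : derive1 f (y + 1) = derive1 f y.
  rewrite /derive1; congr (lim _); apply: congr2 => //.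
  by apply/funext => h /=; rewrite !addrA !f1.
have b1 (t : R) : 0 <= t <= 2^-1 -> 2 * K * t `^ b <= 2 * K.
  move=> /andP[t0 t2]; have K0 := slope_const_ge0; rewrite ler_piMr//; first exact: mulr_ge0.
  have t1 : t <= 1 by lra.
  by have := powR_le_mono (ltW b0) t0 t1; rewrite powR1.
move: cx; rewrite in_itv /= => /andP[xc cx1].
have [h|h] := leP (c - x) 2^-1.
  rewrite -[derive1 f x]subr0 -c0'.
  have h' : `|x - c| <= 2^-1 by rewrite distrC ger0_norm//; lra.
  by apply: le_trans (derive1_hoelder h') _; rewrite b1// normr_ge0.
rewrite -d1 -[derive1 f (x + 1)]subr0 -c0'.
have h' : `|x + 1 - c| <= 2^-1 by rewrite ger0_norm; lra.
by apply: le_trans (derive1_hoelder h') _; rewrite b1// normr_ge0.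
Qed.

End HoelderSlopes.

Lemma ge0_integral_escale (R : realType) d (T : measurableType d)
    (m : {measure set T -> \bar R}) (D : set T) (k : R) (f : T -> \bar R) :
  measurable D -> measurable_fun D f -> 0 <= k -> (forall x, D x -> 0 <= f x)%E ->
  (\int[m]_(x in D) (k%:E * f x) = k%:E * \int[m]_(x in D) f x)%E.
Proof. by move=> mD mf k0 f0; rewrite ge0_integralZl. Qed.

Section CurveSpaces.
Context {R : realType} {n : nat}.
Local Notation mu := (@lebesgue_measure R).
Implicit Types (f g h : R -> 'rV[R]_n) (q al r s : R).

Definition C1_periodic h : Prop :=
  [/\ forall x, h (x + 1) = h x,
      forall i (x : R), is_derive x 1 (fun u => h u 0 i) (derive1 h x 0 i)
    & forall i, continuous (fun u => derive1 h u 0 i)].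

Definition curve_gagliardo_le q al h r : Prop :=
  (\int[mu]_(u in `[0%R, 1%R]) \int[mu]_(w in `[(- 2^-1)%R, (2^-1)%R])
     (enorm (derive1 h (u + w) - derive1 h u) `^ q / `|w| `^ al)%:E
   <= (r `^ q)%:E)%E.

(* The norm of [W1s], up to constants and modulo translations. *)
Definition W1s_ball q al h r : Prop :=
  [/\ C1_periodic h, forall x, enorm (derive1 h x) <= r
    & curve_gagliardo_le q al h r].

Lemma derive1_coord h (x : R) (v : 'rV[R]_n) :
  (forall i, is_derive x 1 (fun u => h u 0 i) (v 0 i)) -> derive1 h x = v.
Proof.
move=> hv; rewrite derive1E derive_mx; last first.
  by apply/derivable_mxP => i j; rewrite (ord1 i); exact: ex_derive.
by apply/rowP => i; rewrite mxE; apply: derive_val.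
Qed.

Lemma derive1_periodic (V : normedModType R) (h : R -> V) :
  (forall x, h (x + 1) = h x) -> forall x, derive1 h (x + 1) = derive1 h x.
Proof.
move=> h1 x; rewrite /derive1; congr (lim _); apply: congr2 => //.
by apply/funext => t /=; rewrite !addrA !h1.
Qed.

Lemma derive1_lin g h a x : C1_periodic g -> C1_periodic h ->
  derive1 (g + a *: h) x = derive1 g x + a *: derive1 h x.
Proof.
move=> [_ dg _] [_ dh _]; apply: derive1_coord => i; rewrite !mxE.
have -> : (fun u => (g + a *: h) u 0 i) =
    (fun u => g u 0 i) + a *: (fun u => h u 0 i).
  by apply/funext => u; rewrite !mxE.
exact: is_deriveD.
Qed.

Lemma C1_periodic_lin g h a : C1_periodic g -> C1_periodic h ->
  C1_periodic (g + a *: h).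
Proof.
move=> cg ch; case: (cg) (ch) => [g1 dg kg] [h1 dh kh]; split.
- by move=> x; rewrite /GRing.add /= /GRing.scale /= g1 h1.
- move=> i x; rewrite derive1_lin// !mxE.
  have -> : (fun u => (g + a *: h) u 0 i) =
      (fun u => g u 0 i) + a *: (fun u => h u 0 i).
    by apply/funext => u; rewrite !mxE.
  exact: is_deriveD.
- move=> i.
  have -> : (fun u => derive1 (g + a *: h) u 0 i) =
      (fun u => derive1 g u 0 i + a * derive1 h u 0 i).
    by apply/funext => u; rewrite derive1_lin// !mxE.
  move=> x; apply: cvgD; first exact: kg.
  by apply: cvgM; [exact: cvg_cst|exact: kh].
Qed.

Lemma is_derive_coord0 i (x : R) :
  is_derive x 1 (fun u : R => (0 : R -> 'rV[R]_n) u 0 i) 0.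
Proof.
have -> : (fun u : R => (0 : R -> 'rV[R]_n) u 0 i) = cst 0.
  by apply/funext => u; rewrite mxE.
exact: is_derive_cst.
Qed.

Lemma derive10 (x : R) : derive1 (0 : R -> 'rV[R]_n) x = 0.
Proof.
apply: derive1_coord => i; apply: is_derive_eq (is_derive_coord0 i x) _.
by rewrite mxE.
Qed.

Lemma C1_periodic0 : C1_periodic 0.
Proof.
split => //.
- move=> i x; apply: is_derive_eq (is_derive_coord0 i x) _.
  by rewrite derive10 mxE.
- move=> i; have -> : (fun u : R => derive1 (0 : R -> 'rV[R]_n) u 0 i) = cst 0.
    by apply/funext => u; rewrite derive10 mxE.
  by move=> x; exact: cvg_cst.
Qed.

Lemma C1_periodicZ h a : C1_periodic h -> C1_periodic (a *: h).
Proof. by move=> ch; have := C1_periodic_lin a C1_periodic0 ch; rewrite add0r. Qed.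

Lemma derive1Z h a x : C1_periodic h -> derive1 (a *: h) x = a *: derive1 h x.
Proof.
move=> ch; have := derive1_lin a x C1_periodic0 ch; rewrite add0r => ->.
by rewrite derive10 add0r.
Qed.

Lemma measurable_enorm d (T : measurableType d) (D : set T) (f : T -> 'rV[R]_n) :
  (forall i, measurable_fun D (fun t => f t 0 i)) ->
  measurable_fun D (fun t => enorm (f t)).
Proof.
move=> mf; rewrite /enorm.
rewrite (_ : (fun _ => _) = (fun t => edot (f t) (f t) `^ 2^-1)); last first.
  by apply/funext => t; rewrite powR12_sqrt ?edot_ge0.
apply: measurable_powR_comp; rewrite /edot.
by apply: measurable_sum => i; exact: measurable_funM.
Qed.

Lemma measurable_derive1 d (T : measurableType d) (D : set T) h (f : T -> R) :
  C1_periodic h -> measurable_fun D f ->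
  forall i, measurable_fun D (fun t => derive1 h (f t) 0 i).
Proof.
move=> [_ _ ch] mf i.
apply: (@measurableT_comp _ _ _ _ _ _ (fun x => derive1 h x 0 i)) mf.
by apply: continuous_measurable_fun; exact: ch.
Qed.

Lemma measurable_coord d (T : measurableType d) (D : set T) h (f : T -> R) :
  C1_periodic h -> measurable_fun D f ->
  forall i, measurable_fun D (fun t => h (f t) 0 i).
Proof.
move=> [_ dh _] mf i.
apply: (@measurableT_comp _ _ _ _ _ _ (fun x => h x 0 i)) mf.
apply: continuous_measurable_fun => x.
by apply/differentiable_continuous/derivable1_diffP; exact: ex_derive.
Qed.

Lemma measurable_curve_quotient q al h u : C1_periodic h ->
  measurable_fun [set: R]
    (fun w => enorm (derive1 h (u + w) - derive1 h u) `^ q / `|w| `^ al).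
Proof.
move=> ch; apply: measurable_funM.
  apply: measurable_powR_comp; apply: measurable_enorm => i.
  have -> : (fun t => (derive1 h (u + t) - derive1 h u) 0 i) =
      (fun t => derive1 h (u + t) 0 i - derive1 h u 0 i).
    by apply/funext => t; rewrite !mxE.
  by apply: measurable_funB => //; apply: measurable_derive1 => //; exact: measurable_funD.
by apply/measurable_funV/measurable_powR_comp; exact: normr_measurable.
Qed.

Lemma measurable_curve_gagliardo q al h : C1_periodic h ->
  measurable_fun [set: measurableTypeR R] (fun u =>
    (\int[mu]_(w in `[(- 2^-1)%R, (2^-1)%R])
     (enorm (derive1 h (u + w) - derive1 h u) `^ q / `|w| `^ al)%:E)%E).
Proof.
move=> ch.
pose F (x : measurableTypeR R * measurableTypeR R) : \bar R :=
  if x.2 \in `[(- 2^-1), 2^-1]%R then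
    (enorm (derive1 h (x.1 + x.2) - derive1 h x.1) `^ q / `|x.2| `^ al)%:E else 0%E.
have -> : (fun u => (\int[mu]_(w in `[(- 2^-1)%R, (2^-1)%R])
     (enorm (derive1 h (u + w) - derive1 h u) `^ q / `|w| `^ al)%:E)%E) =
    fun y => (\int[mu]_w F (y, w))%E.
  by apply/funext => y; rewrite /F integral_ifE.
have m1 : measurable_fun [set: measurableTypeR R * measurableTypeR R] (fun x => x.1 : R).
  exact: measurable_fst.
have m2 : measurable_fun [set: measurableTypeR R * measurableTypeR R] (fun x => x.2 : R).
  exact: measurable_snd.
apply: (measurable_fun_fubini_tonelli_F F).
- apply: measurable_fun_ifT => //.
    rewrite (_ : (fun _ => _) = (fun x : measurableTypeR R * measurableTypeR R =>
      ((- 2^-1 : R) <= x.2) && (x.2 <= (2^-1 : R)))); last first.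
      by apply/funext => x; rewrite in_itv.
    by apply: measurable_and; apply: measurable_fun_ler.
  apply/measurable_EFinP/measurable_funM.
    apply: measurable_powR_comp; apply: measurable_enorm => i.
    have -> : (fun t : measurableTypeR R * measurableTypeR R =>
        (derive1 h (t.1 + t.2) - derive1 h t.1) 0 i) =
        (fun t => derive1 h (t.1 + t.2) 0 i - derive1 h t.1 0 i).
      by apply/funext => t; rewrite !mxE.
    by apply: measurable_funB; apply: measurable_derive1 => //; exact: measurable_funD.
  by apply/measurable_funV/measurable_powR_comp; exact: measurableT_comp.
- by move=> x; rewrite /F; case: ifP => // _; rewrite lee_fin divr_ge0 ?powR_ge0.
Qed.

Lemma W1s_ballZ q al h r a : 0 <= r -> W1s_ball q al h r ->
  W1s_ball q al (a *: h) (`|a| * r).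
Proof.
move=> r0 [ch hr hs]; split; first exact: C1_periodicZ.
  by move=> x; rewrite derive1Z// enormZ ler_wpM2l.
rewrite /curve_gagliardo_le powRM// EFinM.
apply: le_trans (lee_wpmul2l _ hs); last by rewrite lee_fin powR_ge0.
have mu_ : measurable_fun [set: measurableTypeR R] (fun u => (\int[mu]_(w in `[(- 2^-1)%R, (2^-1)%R])
     (enorm (derive1 h (u + w) - derive1 h u) `^ q / `|w| `^ al)%:E)%E).
  exact: measurable_curve_gagliardo.
rewrite -ge0_integral_escale; last 4 first.
- exact: measurable_itv.
- exact: measurable_funTS.
- exact: powR_ge0.
- by move=> u _; apply: integral_ge0 => w _; rewrite lee_fin divr_ge0 ?powR_ge0.
apply: integral_mono => u _.
  by apply: integral_ge0 => w _; rewrite lee_fin divr_ge0 ?powR_ge0.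
rewrite -ge0_integral_scale; last 4 first.
- exact: measurable_itv.
- exact: measurable_funTS (measurable_curve_quotient _ _ _ ch).
- exact: powR_ge0.
- by move=> w _; rewrite divr_ge0 ?powR_ge0.
apply: integral_mono => w _; first by rewrite lee_fin divr_ge0 ?powR_ge0.
by rewrite !derive1Z// -scalerBr enormZ powRM ?enorm_ge0// mulrA lee_fin.
Qed.

End CurveSpaces.

(** * Embedding of the Sobolev space into C^1 *)

Section SobolevEmbedding.
Context {R : realType} {n : nat}.
Local Notation mu := (@lebesgue_measure R).
Implicit Types (f g h : R -> 'rV[R]_n) (q s r : R).

Lemma seminorm_curve_gagliardo q s f r : 0 < q -> 0 <= r ->
  (slobodeckij_seminorm s q f <= r%:E)%E -> curve_gagliardo_le q (1 + q * s) f r.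
Proof.
rewrite /slobodeckij_seminorm /curve_gagliardo_le; set I := integral _ _ _ => q0 r0 Ir.
have I0 : (0 <= I)%E.
  apply: integral_ge0 => u _; apply: integral_ge0 => w _.
  by rewrite lee_fin divr_ge0 ?powR_ge0.
have -> : I = ((I `^ q^-1) `^ q)%E.
  by rewrite -poweRrM mulVf ?gt_eqF// poweRe1.
rewrite -poweR_EFin; apply: gt0_ler_poweR => //; first exact: ltW.
  by rewrite in_itv /= poweR_ge0 leey.
by rewrite in_itv /= lee_fin r0 leey.
Qed.

Lemma curve_gagliardo_coord q al f r i : 0 < q -> curve_gagliardo_le q al f r ->
  gagliardo_le (fun u => derive1 f u 0 i) q al r.
Proof.
move=> q0; apply: le_trans; apply: integral_mono => u _.
  by apply: integral_ge0 => w _; rewrite lee_fin divr_ge0 ?powR_ge0.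
apply: integral_mono => w _; first by rewrite lee_fin divr_ge0 ?powR_ge0.
rewrite lee_fin ler_wpM2r ?invr_ge0 ?powR_ge0// powR_le_mono ?(ltW q0)//.
by have := coord_le_enorm (derive1 f (u + w) - derive1 f u) i; rewrite !mxE.
Qed.

Lemma integrable_of_periodic (D : R -> R) : measurable_fun [set: R] D ->
  (forall x, D (x + 1) = D x) ->
  (\int[mu]_(u in `[0%R, 1%R]) `|D u|%:E < +oo)%E ->
  forall a b, mu.-integrable `[a, b] (EFin \o D).
Proof.
move=> mD D1 Doo a b.
have mA E : measurable_fun E (fun u => `|D u|%:E).
  by apply/measurable_EFinP; apply: measurableT_comp => //; exact: measurable_funTS.
have step (N : nat) : (\int[mu]_(u in `[a, (a + N%:R)%R]) `|D u|%:E < +oo)%E.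
  elim: N => [|N ih]; first by rewrite addr0 set_itv1 integral_set1.
  have aN : a <= a + N%:R by rewrite lerDl.
  have NN : a + N%:R <= a + N.+1%:R by rewrite lerD2l ler_nat.
  rewrite (@itv_bndbnd_setU _ _ _ (BRight (a + N%:R))) ?bnd_simp//.
  rewrite ge0_integral_setU//; [|exact: mA|]; last first.
    by apply/disj_setPS => x [] /=; rewrite !in_itv /= => /andP[_ x1] /andP[]; lra.
  rewrite lte_add_pinfty//; apply: le_lt_trans Doo.
  rewrite integral_itv_obnd_cbnd; last exact: mA.
  rewrite -natr1 addrA (@integral_period _ (fun u => `|D u|%:E))// => x.
  by rewrite D1.
apply/integrableP; split; first by apply/measurable_EFinP; exact: measurable_funTS.
have [ba|ab] := ltP b a.
  by rewrite set_itv_ge ?integral_set0// bnd_simp -ltNge.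
apply: le_lt_trans (step (Num.truncn (b - a)).+1).
apply: ge0_subset_integral => //; first exact: mA.
move=> x; rewrite /= !in_itv /= => /andP[-> xb] /=; apply: (le_trans xb).
by have := truncnS_gt (b - a); rewrite ltrBlDl => /ltW.
Qed.

Definition embedding_slope_const q s : R := 8 / (1 - 2 `^ (- ((1 + q * s - 2) / q))).

Section Embedding.
Variables (q s : R) (q1 : 1 < q) (qs : 1 < q * s).

Let al2 : 2 < 1 + q * s. Proof. by have := qs; lra. Qed.

Let b0 : 0 < (1 + q * s - 2) / q.
Proof. by rewrite divr_gt0//; have := qs; have := q1; lra. Qed.

Lemma W1_component f r i : periodic f 1 ->
  measurable_fun [set: R] (fun u => derive1 f u 0 i) ->
  (forall a b, mu.-integrable `[a, b] (EFin \o (fun u => derive1 f u 0 i))) ->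
  (forall a b : R, a <= b ->
     f b 0 i - f a 0 i = \int[mu]_(u in `[a, b]) (derive1 f u 0 i)) ->
  0 <= r -> curve_gagliardo_le q (1 + q * s) f r ->
  [/\ forall x : R, derivable (fun u => f u 0 i) x 1,
      continuous (derive1 (fun u => f u 0 i))
    & forall x, `|derive1 (fun u => f u 0 i) x| <= 2 * (embedding_slope_const q s * r)].
Proof.
move=> f1 mD iD fD r0 hr.
have q0 : 0 < q by have := q1; lra.
have D1 x : derive1 f (x + 1) 0 i = derive1 f x 0 i.
  by rewrite (derive1_periodic f1).
have G := curve_gagliardo_coord i q0 hr.
have near := slope_near q1 al2 r0 mD D1 iD fD G.
have C0 : 0 <= 8 * r by rewrite mulr_ge0.
have near' x y x' y' := @near x y x' y'.
split.
- by move=> x; exact: (slope_derivable C0 b0 near').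
- exact: (derive1_continuous C0 b0 near').
- move=> x; apply: le_trans (derive1_le_of_periodic C0 b0 near' _ x) _.
    by move=> y; rewrite f1.
  by rewrite /slope_const /embedding_slope_const mulrAC.
Qed.

End Embedding.
End SobolevEmbedding.

Section SobolevEmbedding2.
Context {R : realType} {n : nat}.
Local Notation mu := (@lebesgue_measure R).
Implicit Types (f g h : R -> 'rV[R]_n) (q s r : R).

(** The slope estimates apply to each coordinate, with the almost everywhere derivative in the role
    of D; they upgrade it to a continuous classical derivative. *)
Lemma C1_periodic_of_W1s q s f : 1 < q -> 1 < q * s -> W1s s q f -> C1_periodic f.
Proof.
move=> q1 qs [[f1 mD fD W1oo] Noo].
have q0 : 0 < q by lra.
have sem0 : (0 <= slobodeckij_seminorm s q f)%E by exact: poweR_ge0.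
have [r r0 hr] : exists2 r, 0 <= r & curve_gagliardo_le q (1 + q * s) f r.
  have semoo : (slobodeckij_seminorm s q f < +oo)%E.
    apply: le_lt_trans Noo; rewrite /W1s_norm leeDr//.
    by rewrite adde_ge0 ?poweR_ge0.
  exists (fine (slobodeckij_seminorm s q f)); first exact: fine_ge0.
  apply: seminorm_curve_gagliardo => //; first exact: fine_ge0.
  by rewrite fineK// ge0_fin_numE.
have mE D : measurable_fun D (fun u => enorm (derive1 f u) `^ q).
  by apply: measurable_powR_comp; apply: measurable_enorm => i; exact: measurable_funTS.
have Eoo : (\int[mu]_(u in `[0%R, 1%R]) (enorm (derive1 f u) `^ q)%:E < +oo)%E.
  apply: (@lty_poweRy _ _ q^-1); first by rewrite invr_eq0 gt_eqF.
  apply: le_lt_trans W1oo; rewrite leeDr// poweR_ge0//.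
have iD i : forall a b, mu.-integrable `[a, b] (EFin \o (fun u => derive1 f u 0 i)).
  apply: (integrable_of_periodic (mD i)).
    by move=> x; rewrite (derive1_periodic f1).
  (* On the unit interval L^q is contained in L^1, by |t| <= 1 + |t|^q. *)
  apply: (@le_lt_trans _ _ (\int[mu]_(u in `[0%R, 1%R])
      (1%:E + (enorm (derive1 f u) `^ q)%:E))%E).
    apply: integral_mono => u _; first by rewrite lee_fin.
    rewrite -EFinD lee_fin; apply: le_trans (coord_le_enorm _ _) _.
    have := young_powR q1 ltr01 (enorm_ge0 (derive1 f u)).
    by rewrite powR1 mul1r.
  rewrite ge0_integralD//.
  - rewrite lte_add_pinfty// integral_cst//= mul1e lebesgue_measure_itv /= lte_fin ltr01.
    by rewrite -EFinB ltry.
  - by move=> u _; rewrite lee_fin powR_ge0.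
  - by apply/measurable_EFinP; exact: mE.
have H i := W1_component (r := r) q1 qs f1 (mD i) (iD i) (fun a b ab => fD a b i ab) r0 hr.
have dE x : derive1 f x = \row_i derive1 (fun u => f u 0 i) x.
  apply: derive1_coord => i; rewrite mxE derive1E; apply/derivableP.
  by have [+ _ _] := H i; exact.
split => //.
- move=> i x; rewrite dE mxE derive1E; apply/derivableP.
  by have [+ _ _] := H i; exact.
- move=> i; have -> : (fun u => derive1 f u 0 i) = derive1 (fun u => f u 0 i).
    by apply/funext => u; rewrite dE mxE.
  by have [_ + _] := H i.
Qed.

(** The summand 1 makes the resulting radius at least r, as the Gagliardo part of [W1s_ball]
    requires; n comes from bounding the norm of the derivative by the sum over its coordinates. *)
Definition embedding_const q s : R := 1 + n%:R * (2 * embedding_slope_const q s).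

Lemma embedding_slope_const_ge0 q s : 1 < q -> 1 < q * s -> 0 <= embedding_slope_const q s.
Proof.
move=> q1 qs; have b0 : 0 < (1 + q * s - 2) / q by rewrite divr_gt0; lra.
have C0 : (0 : R) <= 8 by [].
exact: (slope_const_ge0 C0 b0).
Qed.

Lemma embedding_const_gt0 q s : 1 < q -> 1 < q * s -> 0 < embedding_const q s.
Proof.
move=> q1 qs; have := embedding_slope_const_ge0 q1 qs => h.
by rewrite ltr_pwDl// mulr_ge0// mulr_ge0.
Qed.

Lemma W1s_ball_of_seminorm q s f r : 1 < q -> 1 < q * s -> C1_periodic f -> 0 <= r ->
  (slobodeckij_seminorm s q f <= r%:E)%E ->
  W1s_ball q (1 + q * s) f (embedding_const q s * r).
Proof.
move=> q1 qs cf r0 fr; have q0 : 0 < q by lra.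
have [f1 df kf] := cf.
have hr := seminorm_curve_gagliardo q0 r0 fr.
have c0 := embedding_slope_const_ge0 q1 qs.
have iD i a b : mu.-integrable `[a, b] (EFin \o (fun u => derive1 f u 0 i)).
  apply: continuous_compact_integrable; first exact: segment_compact.
  by apply: continuous_subspaceT => x; exact: kf.
have mD i : measurable_fun [set: R] (fun u => derive1 f u 0 i).
  by apply: continuous_measurable_fun; exact: kf.
have fD i a b : a <= b ->
    f b 0 i - f a 0 i = \int[mu]_(u in `[a, b]) (derive1 f u 0 i).
  rewrite le_eqVlt => /predU1P[->|ab].
    by rewrite subrr /Rintegral set_itv1 integral_set1.
  rewrite /Rintegral (@FTC2_closed _ (fun u => derive1 f u 0 i) (fun u => f u 0 i))//.
  by move=> x _; exact: kf.
have H i := W1_component (r := r) q1 qs f1 (mD i) (iD i) (fD i) r0 hr.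
have rK : r <= embedding_const q s * r.
  by rewrite /embedding_const mulrDl mul1r lerDl mulr_ge0// mulr_ge0// mulr_ge0.
split => //; last first.
  by apply: le_trans hr _; rewrite lee_fin powR_le_mono// ltW.
move=> x; apply: le_trans (enorm_le_sum _) _.
apply: (@le_trans _ _ (\sum_(i < n) 2 * (embedding_slope_const q s * r))).
  apply: ler_sum => i _; have [_ _ /(_ x)] := H i.
  by rewrite derive1E (@derive_val _ _ _ _ _ _ _ (df i x)).
rewrite sumr_const card_ord -mulr_natl /embedding_const; lra.
Qed.

End SobolevEmbedding2.

(** * Integrals over the torus *)

Section ProductIntegrals.
Context d1 d2 (T1 : measurableType d1) (T2 : measurableType d2) {R : realType}.
Variables (m1 : {sigma_finite_measure set T1 -> \bar R})
  (m2 : {sigma_finite_measure set T2 -> \bar R}).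
Variable f : T1 * T2 -> \bar R.
Hypotheses (mf : measurable_fun setT f) (f0 : forall x, (0 <= f x)%E).

Let patch0 (D : set (T1 * T2)) x : (0 <= (f \_ D) x)%E.
Proof. by rewrite /patch; case: ifP. Qed.

Let measurable_patch A B : measurable A -> measurable B ->
  measurable_fun setT (f \_ (A `*` B)).
Proof.
move=> mA mB; apply: (measurable_restrictT _ (measurableX mA mB)).1; exact: measurable_funTS.
Qed.

Let inner_patch A B x : (\int[m2]_y (f \_ (A `*` B)) (x, y) =
  if x \in A then \int[m2]_(y in B) f (x, y) else 0)%E.
Proof.
case: ifPn => xA.
  rewrite [RHS]integral_mkcond; apply: eq_integral => y _; rewrite /patch.
  by rewrite in_setX /= xA.
rewrite integral0_eq// => y _; rewrite /patch.
by rewrite in_setX /= (negbTE xA).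
Qed.

Lemma measurable_partial_integral B : measurable B ->
  measurable_fun setT (fun x => \int[m2]_(y in B) f (x, y))%E.
Proof.
move=> mB; have mT := measurable_patch measurableT mB.
have := measurable_fun_fubini_tonelli_F (m2 := m2) _ mT (patch0 _).
rewrite /fubini_F; under eq_fun do rewrite inner_patch in_setT.
by [].
Qed.

Lemma integral_prod A B : measurable A -> measurable B ->
  (\int[m1 \x m2]_(z in A `*` B) f z = \int[m1]_(x in A) \int[m2]_(y in B) f (x, y))%E.
Proof.
move=> mA mB; rewrite integral_mkcond.
apply: etrans (fubini_tonelli1 _ (measurable_patch mA mB) (@patch0 _)) _.
rewrite /fubini_F [RHS]integral_mkcond; apply: eq_integral => x _.
by rewrite inner_patch /patch.
Qed.

End ProductIntegrals.

Section Tonelli.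
Context d1 d2 (T1 : measurableType d1) (T2 : measurableType d2) {R : realType}.
Variables (m1 : {sigma_finite_measure set T1 -> \bar R})
  (m2 : {sigma_finite_measure set T2 -> \bar R}).

Lemma tonelli_rect (f : T1 * T2 -> \bar R) A B : measurable_fun setT f ->
  (forall x, 0 <= f x)%E -> measurable A -> measurable B ->
  (\int[m1]_(x in A) \int[m2]_(y in B) f (x, y) =
   \int[m2]_(y in B) \int[m1]_(x in A) f (x, y))%E.
Proof.
move=> mf f0 mA mB.
pose g := f \_ (A `*` B).
have mg : measurable_fun setT g.
  apply: (measurable_restrictT _ (measurableX mA mB)).1; exact: measurable_funTS.
have g0 x : (0 <= g x)%E by rewrite /g /patch; case: ifP.
transitivity (\int[m1]_x \int[m2]_y g (x, y))%E.
  rewrite integral_mkcond; apply: eq_integral => x _; rewrite {1}/patch.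
  case: ifPn => xA.
    rewrite integral_mkcond; apply: eq_integral => y _; rewrite /g /patch.
    by rewrite in_setX /= xA.
  by rewrite integral0_eq// => y _; rewrite /g /patch in_setX /= (negbTE xA).
apply: etrans (fubini_tonelli g mg g0) _.
rewrite [RHS]integral_mkcond; apply: eq_integral => y _; rewrite [RHS]/patch.
case: ifPn => yB.
  rewrite [RHS]integral_mkcond; apply: eq_integral => x _; rewrite /g /patch.
  by rewrite in_setX /= yB andbT.
by rewrite integral0_eq// => x _; rewrite /g /patch in_setX /= (negbTE yB) andbF.
Qed.

End Tonelli.

(* The canonical structure on [m1 \x m2] is attached to probability measures
   only, so the sigma-finite one has to be given by hand. *)
Section SigmaFiniteProduct.
Context d1 d2 (T1 : measurableType d1) (T2 : measurableType d2) {R : realType}.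
Variables (m1 : {sigma_finite_measure set T1 -> \bar R})
  (m2 : {sigma_finite_measure set T2 -> \bar R}).

Lemma product_sigma_finite : sigma_finite setT (m1 \x m2)%E.
Proof.
have /sigma_finiteP[F [FT ndF Foo]] := sigma_finiteT m1.
have /sigma_finiteP[G [GT ndG Goo]] := sigma_finiteT m2.
exists (fun i => F i `*` G i) => [|i]; last first.
  have [mF Fi] := Foo i; have [mG Gi] := Goo i.
  split; first exact: measurableX.
  by rewrite product_measure1E// lte_mul_pinfty// ge0_fin_numE.
apply/seteqP; split => // -[x y] _.
have [i _ Fx] : (\bigcup_i F i) x by rewrite -FT.
have [j _ Gy] : (\bigcup_i G i) y by rewrite -GT.
exists (maxn i j) => //; split => /=.
- by have /subsetPset := ndF _ _ (leq_maxl i j); exact.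
- by have /subsetPset := ndG _ _ (leq_maxr i j); exact.
Qed.

Definition product_measure : {sigma_finite_measure set (T1 * T2)%type -> \bar R} :=
  HB.pack (m1 \x m2)%E
    (Measure_isSigmaFinite.Build _ _ _ (m1 \x m2)%E product_sigma_finite).

End SigmaFiniteProduct.

(** * Decomposition of the torus by the middle point of a triple *)

Section CubeIntegrals.
Context {R : realType}.
Local Notation mu := (@lebesgue_measure R).
Local Notation T := (measurableTypeR R).
Local Notation T3 := (T * T * T)%type.
Local Notation I := (`[0%R, 1%R]%classic : set T).
Implicit Types F : R * R * R -> \bar R.

Lemma torus3E : @torus3 R = I `*` I `*` I.
Proof.
apply/seteqP; split => [[[a b] c]|[[a b] c]] /=; rewrite !in_itv /=.
  by move=> [/= -> -> ->].
by move=> [[? ?] ?]; split.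
Qed.

Lemma measurable_torus3 : measurable (torus3 : set T3).
Proof.
by rewrite torus3E; apply: measurableX; [apply: measurableX|]; exact: measurable_itv.
Qed.

Lemma measurable_triple d (S : measurableType d) (f1 f2 f3 : S -> R) :
  measurable_fun setT f1 -> measurable_fun setT f2 -> measurable_fun setT f3 ->
  measurable_fun setT (fun t => ((f1 t, f2 t), f3 t) : T3).
Proof.
by move=> m1 m2 m3; apply: measurable_fun_pair => //; exact: measurable_fun_pair.
Qed.

Lemma measurable_proj1 : measurable_fun [set: T3] (fun t => t.1.1 : R).
Proof. exact: measurableT_comp measurable_fst measurable_fst. Qed.

Lemma measurable_proj2 : measurable_fun [set: T3] (fun t => t.1.2 : R).
Proof. exact: measurableT_comp measurable_snd measurable_fst. Qed.

Lemma measurable_proj3 : measurable_fun [set: T3] (fun t => t.2 : R).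
Proof. exact: measurable_snd. Qed.

Lemma integral_cube F : measurable_fun [set: T3] F -> (forall t, 0 <= F t)%E ->
  (\int[mu \x mu \x mu]_(t in torus3) F t =
   \int[mu]_(a in I) \int[mu]_(b in I) \int[mu]_(c in I) F (a, b, c))%E.
Proof.
move=> mF F0; rewrite torus3E.
have mI : measurable I by exact: measurable_itv.
have mII : measurable (I `*` I : set (T * T)) by exact: measurableX.
transitivity (\int[mu \x mu]_(x in I `*` I) \int[mu]_(c in I) F (x, c))%E.
  exact: (integral_prod (product_measure mu mu) mu mF F0 mII mI).
have mG := measurable_partial_integral mu mF F0 mI.
have G0 x : (0 <= \int[mu]_(c in I) F (x, c))%E by exact: integral_ge0.
exact: (integral_prod mu mu mG G0 mI mI).
Qed.

Lemma measurable_section F a : measurable_fun [set: T3] F ->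
  measurable_fun [set: T * T] (fun z => F (a, z.1, z.2)).
Proof.
move=> mF; apply: (measurableT_comp mF); exact: measurable_triple.
Qed.

Lemma integral_cube23 F : measurable_fun [set: T3] F -> (forall t, 0 <= F t)%E ->
  (\int[mu \x mu \x mu]_(t in torus3) F (t.1.1, t.2, t.1.2) =
   \int[mu \x mu \x mu]_(t in torus3) F t)%E.
Proof.
move=> mF F0.
have mF' : measurable_fun [set: T3] (fun t => F (t.1.1, t.2, t.1.2)).
  apply: (measurableT_comp mF); apply: measurable_triple.
  - exact: measurable_proj1.
  - exact: measurable_proj3.
  - exact: measurable_proj2.
apply: etrans (integral_cube mF' (fun t => F0 _)) _.
apply: etrans _ (esym (integral_cube mF F0)).
have mI : measurable I by exact: measurable_itv.
apply: eq_integral => a _ /=.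
by apply: (@tonelli_rect _ _ _ _ _ mu mu (fun z => F (a, z.2, z.1))) => //;
  exact: (measurable_section a mF').
Qed.

Lemma integral_cube12 F : measurable_fun [set: T3] F -> (forall t, 0 <= F t)%E ->
  (\int[mu \x mu \x mu]_(t in torus3) F (t.1.2, t.1.1, t.2) =
   \int[mu \x mu \x mu]_(t in torus3) F t)%E.
Proof.
move=> mF F0.
have mF' : measurable_fun [set: T3] (fun t => F (t.1.2, t.1.1, t.2)).
  apply: (measurableT_comp mF); apply: measurable_triple.
  - exact: measurable_proj2.
  - exact: measurable_proj1.
  - exact: measurable_proj3.
apply: etrans (integral_cube mF' (fun t => F0 _)) _.
apply: etrans _ (esym (integral_cube mF F0)).
have mI : measurable I by exact: measurable_itv.
have mG := measurable_partial_integral mu mF F0 mI.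
have G0 x : (0 <= \int[mu]_(c in I) F (x, c))%E by exact: integral_ge0.
exact: esym (@tonelli_rect _ _ _ _ _ mu mu _ _ _ mG G0 mI mI).
Qed.

Lemma integral_shiftT (f : R -> \bar R) (a : R) : measurable_fun [set: R] f ->
  (forall x, 0 <= f x)%E -> (\int[mu]_x f (x + a)%R = \int[mu]_x f x)%E.
Proof.
by move=> mf f0; rewrite -(@integral_shift _ a setT f).
Qed.

Lemma integral_reflT (f : R -> \bar R) (a : R) : measurable_fun [set: R] f ->
  (forall x, 0 <= f x)%E -> (\int[mu]_x f (a - x)%R = \int[mu]_x f x)%E.
Proof.
move=> mf f0; rewrite -(integral_shiftT a mf f0).
rewrite -[RHS](@lebesgue_integral_opp _ setT (fun x => f (x + a)%R))//; last first.
  by apply: (measurableT_comp mf); exact: measurable_funD.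
rewrite (_ : [set x | setT (- x)] = setT); last by apply/seteqP; split.
by apply: eq_integral => x _; rewrite addrC.
Qed.

(* [(a + v, a, a - w)] with [v] and [w] two arcs of the circle whose complement
   is the longest of the three arcs cut out by three points. *)
Definition short_arcs (v w : R) : bool :=
  [&& 0 <= v, v <= 2^-1, 0 <= w, w <= 2^-1 & v + w <= 2 / 3].

Definition middle_part F a v w : \bar R :=
  if short_arcs v w then F (a, (a + v)%R, (a - w)%R) else 0%E.

(** Three lifts suffice: in a sorted triple the middle point is the second one (no wrapping), the
    last one (its successor is the first one plus 1) or the first one (its predecessor is the last
    one minus 1). *)
Definition middle_sum F (t : R * R * R) : \bar R :=
  (middle_part F t.1.1 (t.1.2 - t.1.1)%R (t.1.1 - t.2)%R +
   middle_part F t.1.1 (t.1.2 + 1 - t.1.1)%R (t.1.1 - t.2)%R +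
   middle_part F t.1.1 (t.1.2 - t.1.1)%R (t.1.1 - t.2 + 1)%R)%E.

Definition middle_sym F (t : R * R * R) : \bar R :=
  (middle_sum F t + middle_sum F (t.1.1, t.2, t.1.2))%E.

Lemma middle_part_ge0 F a v w : (forall t, 0 <= F t)%E -> (0 <= middle_part F a v w)%E.
Proof. by move=> F0; rewrite /middle_part; case: ifP. Qed.

Lemma middle_sum_ge0 F t : (forall t, 0 <= F t)%E -> (0 <= middle_sum F t)%E.
Proof. by move=> F0; rewrite !adde_ge0 ?middle_part_ge0. Qed.

Lemma middle_sym_ge0 F t : (forall t, 0 <= F t)%E -> (0 <= middle_sym F t)%E.
Proof. by move=> F0; rewrite !adde_ge0 ?middle_part_ge0. Qed.

Lemma measurable_middle_part F d (S : measurableType d) (fa fv fw : S -> R) :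
  measurable_fun [set: T3] F ->
  measurable_fun setT fa -> measurable_fun setT fv -> measurable_fun setT fw ->
  measurable_fun setT (fun t => middle_part F (fa t) (fv t) (fw t)).
Proof.
move=> mF ma mv mw; apply: measurable_fun_ifT => //.
- apply: measurable_and; first exact: measurable_fun_ler.
  apply: measurable_and; first exact: measurable_fun_ler.
  apply: measurable_and; first exact: measurable_fun_ler.
  apply: measurable_and; first exact: measurable_fun_ler.
  by apply: measurable_fun_ler => //; exact: measurable_funD.
- apply: (measurableT_comp mF); apply: measurable_triple => //.
  + exact: measurable_funD.
  + exact: measurable_funB.
Qed.

Lemma measurable_middle_sum F : measurable_fun [set: T3] F ->
  measurable_fun [set: T3] (middle_sum F).
Proof.
move=> mF; have p1 := measurable_proj1; have p2 := measurable_proj2.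
have p3 := measurable_proj3.
apply: emeasurable_funD; first apply: emeasurable_funD.
- by apply: measurable_middle_part => //; exact: measurable_funB.
- apply: measurable_middle_part => //; last exact: measurable_funB.
  by apply: measurable_funB => //; exact: measurable_funD.
- apply: measurable_middle_part => //; first exact: measurable_funB.
  by apply: measurable_funD => //; exact: measurable_funB.
Qed.

Definition middle_integral F : \bar R :=
  (\int[mu]_(a in I) \int[mu]_v \int[mu]_w middle_part F a v w)%E.

(** Substitution v = b + k - a and w = a - c + l, extended to the whole line by positivity;
    [middle_part] itself restricts to short arcs. *)
Lemma integral_middle_part F (k l : R) : measurable_fun [set: T3] F ->
  (forall t, 0 <= F t)%E ->
  (\int[mu \x mu \x mu]_(t in torus3)
     middle_part F t.1.1 (t.1.2 + k - t.1.1)%R (t.1.1 - t.2 + l)%R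
   <= middle_integral F)%E.
Proof.
move=> mF F0; have p1 := measurable_proj1; have p2 := measurable_proj2.
have p3 := measurable_proj3.
have mM : measurable_fun [set: T3]
    (fun t => middle_part F t.1.1 (t.1.2 + k - t.1.1) (t.1.1 - t.2 + l)).
  apply: measurable_middle_part => //.
  - by apply: measurable_funB => //; exact: measurable_funD.
  - by apply: measurable_funD => //; exact: measurable_funB.
have G0 a v w := middle_part_ge0 a v w F0.
apply: le_trans (_ : _ <= \int[mu]_(a in I) \int[mu]_(b in I) \int[mu]_(c in I)
    middle_part F a (b + k - a)%R (a - c + l)%R)%E _.
  by rewrite (integral_cube mM)// => t; exact: G0.
apply: integral_mono => a _.
  by apply: integral_ge0 => b _; apply: integral_ge0.
have mw v : measurable_fun [set: R] (fun w => middle_part F a v w).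
  by apply: measurable_middle_part.
have mv : measurable_fun [set: R] (fun v => \int[mu]_w middle_part F a v w)%E.
  apply: (@measurable_partial_integral _ _ _ _ _ mu
    (fun z : T * T => middle_part F a z.1 z.2) _ _ setT) => //.
  exact: measurable_middle_part.
rewrite -[leRHS](integral_shiftT (k - a) mv); last first.
  by move=> v; exact: integral_ge0.
apply: (@le_trans _ _ (\int[mu]_(b in I) \int[mu]_w middle_part F a (b + (k - a)) w)%E).
  apply: integral_mono => b _; first exact: integral_ge0.
  rewrite -[leRHS](integral_reflT (a + l) (mw _) (G0 a _)) addrA.
  under eq_integral do rewrite (addrAC a).
  by apply: ge0_subset_integral => //; apply: (measurableT_comp (mw _)); exact: measurable_funB.
apply: ge0_subset_integral => //.
- by apply: (measurableT_comp mv); exact: measurable_funD.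
- by move=> b _; exact: integral_ge0.
Qed.

End CubeIntegrals.

Lemma ge0_integral_plus (R : realType) d (T : measurableType d)
    (m : {measure set T -> \bar R}) (D : set T) (f g : T -> \bar R) :
  measurable D -> measurable_fun setT f -> measurable_fun setT g ->
  (forall x, 0 <= f x)%E -> (forall x, 0 <= g x)%E ->
  (\int[m]_(x in D) (f x + g x) = \int[m]_(x in D) f x + \int[m]_(x in D) g x)%E.
Proof.
by move=> mD mf mg f0 g0; apply: ge0_integralD => //; exact: measurable_funTS.
Qed.

Section CubeCover.
Context {R : realType}.
Local Notation mu := (@lebesgue_measure R).
Local Notation T := (measurableTypeR R).
Local Notation T3 := (T * T * T)%type.
Local Notation mu3 := (mu \x mu \x mu)%E.
Variable F : R * R * R -> \bar R.
Hypotheses (mF : measurable_fun [set: T3] F) (F0 : forall t, (0 <= F t)%E).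

Lemma integral_middle_sum :
  (\int[mu3]_(t in torus3) middle_sum F t <= 3%:E * middle_integral F)%E.
Proof.
have p1 := @measurable_proj1 R; have p2 := @measurable_proj2 R.
have p3 := @measurable_proj3 R.
have m00 : measurable_fun [set: T3] (fun t => middle_part F t.1.1 (t.1.2 - t.1.1) (t.1.1 - t.2)).
  by apply: measurable_middle_part => //; exact: measurable_funB.
have m10 : measurable_fun [set: T3] (fun t => middle_part F t.1.1 (t.1.2 + 1 - t.1.1) (t.1.1 - t.2)).
  apply: measurable_middle_part => //; last exact: measurable_funB.
  by apply: measurable_funB => //; exact: measurable_funD.
have m01 : measurable_fun [set: T3] (fun t => middle_part F t.1.1 (t.1.2 - t.1.1) (t.1.1 - t.2 + 1)).
  apply: measurable_middle_part => //; first exact: measurable_funB.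
  by apply: measurable_funD => //; exact: measurable_funB.
have mD := @measurable_torus3 R.
have G0 a v w := middle_part_ge0 a v w F0.
have J00 := integral_middle_part 0 0 mF F0.
have J10 := integral_middle_part 1 0 mF F0.
have J01 := integral_middle_part 0 1 mF F0.
have m2 := emeasurable_funD m00 m10.
have G2 t : (0 <= middle_part F t.1.1 (t.1.2 - t.1.1)%R (t.1.1 - t.2)%R +
   middle_part F t.1.1 (t.1.2 + 1 - t.1.1)%R (t.1.1 - t.2)%R)%E by exact: adde_ge0.
rewrite /middle_sum (ge0_integral_plus mu3 mD m2 m01 G2 (fun t => G0 _ _ _)).
rewrite (ge0_integral_plus mu3 mD m00 m10 (fun t => G0 _ _ _) (fun t => G0 _ _ _)).
have -> : (3%:E * middle_integral F =
    middle_integral F + middle_integral F + middle_integral F)%E.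
  rewrite (_ : 3%:E = 1%:E + 1%:E + 1%:E)%E; last first.
    by rewrite -!EFinD; congr (_%:E); ring.
  by rewrite !ge0_muleDl ?mul1e// -?EFinD ?lee_fin.
apply: leeD; first apply: leeD.
- apply: le_trans J00; rewrite le_eqVlt; apply/orP; left; apply/eqP.
  by apply: eq_integral => t _; rewrite !addr0.
- apply: le_trans J10; rewrite le_eqVlt; apply/orP; left; apply/eqP.
  by apply: eq_integral => t _; rewrite !addr0.
- apply: le_trans J01; rewrite le_eqVlt; apply/orP; left; apply/eqP.
  by apply: eq_integral => t _; rewrite !addr0.
Qed.

Let S1 t := middle_sum F t.
Let mS1 : measurable_fun [set: T3] S1.
Proof. exact: measurable_middle_sum. Qed.
Let S10 t : (0 <= S1 t)%E.
Proof. exact: middle_sum_ge0. Qed.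

Let mS23 : measurable_fun [set: T3] (fun t => S1 (t.1.1, t.2, t.1.2)).
Proof.
apply: (measurableT_comp mS1); apply: measurable_triple.
- exact: measurable_proj1.
- exact: measurable_proj3.
- exact: measurable_proj2.
Qed.

Let S2 t := middle_sym F t.
Let mS2 : measurable_fun [set: T3] S2.
Proof. exact: emeasurable_funD. Qed.
Let S20 t : (0 <= S2 t)%E.
Proof. exact: middle_sym_ge0. Qed.

Lemma integral_middle_sym :
  (\int[mu3]_(t in torus3) middle_sym F t <= 6%:E * middle_integral F)%E.
Proof.
rewrite /middle_sym (ge0_integral_plus mu3 (@measurable_torus3 R) mS1 mS23 S10
  (fun t => S10 _)).
rewrite (integral_cube23 mS1 S10).
have H := integral_middle_sum.
apply: le_trans (leeD H H) _.
rewrite (_ : 6%:E = 3%:E + 3%:E)%E ?ge0_muleDl//.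
by rewrite -EFinD; congr (_%:E); ring.
Qed.

Hypothesis F12 : forall a b c, F (b, a, c) = F (a, b, c).
Hypothesis F23 : forall a b c, F (a, c, b) = F (a, b, c).
Hypothesis Fper : forall a b c, F (a, b + 1, c) = F (a, b, c).

(** The arcs y - x, z - y and 1 - (z - x) add up to 1. Dropping a longest one leaves two arcs of
    total length at most 2/3, each at most 1/2 since it is not longer than the dropped one; the
    point between them is the middle one. *)
Lemma sorted_cover (x y z : R) : 0 <= x -> x <= y -> y <= z -> z <= 1 ->
  [\/ F (x, y, z) <= S1 (y, z, x), F (x, y, z) <= S1 (z, x, y)
    | F (x, y, z) <= S1 (x, y, z)]%E.
Proof.
move=> x0 xy yz z1.
have G0 a v w := middle_part_ge0 a v w F0.
have [A|A] : (y - x <= 1 - (z - x)) && (z - y <= 1 - (z - x)) \/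
    (1 - (z - x) < y - x) || (1 - (z - x) < z - y).
  by rewrite !ltNge -negb_and; case: (_ && _); [left|right].
  apply: Or31; have [A1 A2] := andP A.
  apply: (@le_trans _ _ (middle_part F y (z - y) (y - x))); last first.
    by rewrite /S1 /middle_sum /= -addeA leeDl// adde_ge0.
  rewrite /middle_part ifT; last first.
    by apply/and5P; split; lra.
  rewrite (_ : y + (z - y) = z); last by ring.
  rewrite (_ : y - (y - x) = x); last by ring.
  by rewrite (F23 y x z) (F12 x y z).
have [B|B] := leP (z - y) (y - x).
  apply: Or32; apply: (@le_trans _ _ (middle_part F z (x + 1 - z) (z - y))); last first.
    by rewrite /S1 /middle_sum /= addeAC leeDr// adde_ge0.
  rewrite /middle_part ifT; last first.
    by apply/and5P; split; case/orP: A => A; lra.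
  rewrite (_ : z + (x + 1 - z) = x + 1); last by ring.
  rewrite (_ : z - (z - y) = y); last by ring.
  by rewrite (Fper z x y) (F12 x z y) (F23 x y z).
apply: Or33; apply: (@le_trans _ _ (middle_part F x (y - x) (x - z + 1))); last first.
  by rewrite /S1 /middle_sum /= leeDr// adde_ge0.
rewrite /middle_part ifT; last first.
  by apply/and5P; split; case/orP: A => A; lra.
rewrite (_ : x + (y - x) = y); last by ring.
rewrite (_ : x - (x - z + 1) = z - 1); last by ring.
by rewrite (F23 x (z - 1) y) -(Fper x (z - 1) y) subrK (F23 x y z).
Qed.

Let S3 t := (S2 t + S2 (t.1.2, t.1.1, t.2) + S2 (t.2, t.1.1, t.1.2))%E.

Lemma cube_cover t : torus3 t -> (F t <= S3 t)%E.
Proof.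
case: t => -[a b] c [/= a01 b01 c01].
have ub p : p \in [:: S1 (a, b, c); S1 (a, c, b); S1 (b, a, c); S1 (b, c, a);
    S1 (c, a, b); S1 (c, b, a)] -> (p <= S3 (a, b, c))%E.
  have e1 (u v : \bar R) : (0 <= v)%E -> (u <= u + v)%E by move=> ?; rewrite leeDl.
  have e2 (u v : \bar R) : (0 <= v)%E -> (u <= v + u)%E by move=> ?; rewrite leeDr.
  have P t := S10 t; have Q t := S20 t.
  have k1 : (S2 (a, b, c) <= S3 (a, b, c))%E.
    by apply: le_trans (e1 _ _ (Q (b, a, c))) (e1 _ _ (Q (c, a, b))).
  have k2 : (S2 (b, a, c) <= S3 (a, b, c))%E.
    by apply: le_trans (e2 _ _ (Q (a, b, c))) (e1 _ _ (Q (c, a, b))).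
  have k3 : (S2 (c, a, b) <= S3 (a, b, c))%E.
    by apply: e2; exact: adde_ge0.
  rewrite !inE => /orP[|/orP[|/orP[|/orP[|/orP[|]]]]] /eqP ->.
  - exact: le_trans (e1 _ _ (P (a, c, b))) k1.
  - exact: le_trans (e2 _ _ (P (a, b, c))) k1.
  - exact: le_trans (e1 _ _ (P (b, c, a))) k2.
  - exact: le_trans (e2 _ _ (P (b, a, c))) k2.
  - exact: le_trans (e1 _ _ (P (c, b, a))) k3.
  - exact: le_trans (e2 _ _ (P (c, a, b))) k3.
have perm x y z : F (x, y, z) = F (a, b, c) ->
    0 <= x -> x <= y -> y <= z -> z <= 1 ->
    (forall p, p \in [:: S1 (y, z, x); S1 (z, x, y); S1 (x, y, z)] ->
      (p <= S3 (a, b, c))%E) -> (F (a, b, c) <= S3 (a, b, c))%E.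
  move=> <- x0 xy yz z1 H; case: (sorted_cover x0 xy yz z1) => h;
    by apply: le_trans h (H _ _); rewrite !inE eqxx ?orbT.
have ubS l : {subset l <= [:: S1 (a, b, c); S1 (a, c, b); S1 (b, a, c); S1 (b, c, a);
    S1 (c, a, b); S1 (c, b, a)]} -> forall p, p \in l -> (p <= S3 (a, b, c))%E.
  by move=> sub p /sub; exact: ub.
have sub3 (p1 p2 p3 : \bar R) l : p1 \in l -> p2 \in l -> p3 \in l ->
    {subset [:: p1; p2; p3] <= l}.
  by move=> h1 h2 h3 p; rewrite !inE => /or3P[] /eqP ->.
move: a01 b01 c01 => /andP[a0 a1] /andP[b0 b1] /andP[c0 c1].
have [ab|/ltW ba] := leP a b; have [bc|/ltW cb] := leP b c; have [ac|/ltW ca] := leP a c.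
- by apply: (perm a b c) => //; apply/ubS/sub3; rewrite !inE eqxx ?orbT.
- by apply: (perm a b c) => //; apply/ubS/sub3; rewrite !inE eqxx ?orbT.
- by apply: (perm a c b) => //; apply/ubS/sub3; rewrite !inE eqxx ?orbT.
- by apply: (perm c a b) => //; [rewrite F12 F23|apply/ubS/sub3; rewrite !inE eqxx ?orbT].
- by apply: (perm b a c) => //; apply/ubS/sub3; rewrite !inE eqxx ?orbT.
- by apply: (perm b c a) => //; [rewrite F23 F12|apply/ubS/sub3; rewrite !inE eqxx ?orbT].
- by apply: (perm c b a) => //; [rewrite F12 F23 F12|apply/ubS/sub3; rewrite !inE eqxx ?orbT].
- by apply: (perm c b a) => //; [rewrite F12 F23 F12|apply/ubS/sub3; rewrite !inE eqxx ?orbT].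
Qed.

(** 18 counts three choices of the middle point, two orders of the other points and three lifts. *)
Lemma integral_cover :
  (\int[mu3]_(t in torus3) F t <= 18%:E * middle_integral F)%E.
Proof.
have m12 : measurable_fun [set: T3] (fun t => S2 (t.1.2, t.1.1, t.2)).
  apply: (measurableT_comp mS2); apply: measurable_triple.
  - exact: measurable_proj2.
  - exact: measurable_proj1.
  - exact: measurable_proj3.
have m123 : measurable_fun [set: T3] (fun t => S2 (t.2, t.1.1, t.1.2)).
  apply: (measurableT_comp mS2); apply: measurable_triple.
  - exact: measurable_proj3.
  - exact: measurable_proj1.
  - exact: measurable_proj2.
apply: (@le_trans _ _ (\int[mu3]_(t in torus3) S3 t)%E).
  by apply: integral_mono => t Dt; [exact: F0|exact: cube_cover].
have mD := @measurable_torus3 R.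
have P2 t : (0 <= S2 t + S2 (t.1.2, t.1.1, t.2))%E by exact: adde_ge0.
rewrite /S3 (ge0_integral_plus mu3 mD (emeasurable_funD mS2 m12) m123 P2 (fun t => S20 _)).
rewrite (ge0_integral_plus mu3 mD mS2 m12 S20 (fun t => S20 _)).
rewrite (integral_cube12 mS2 S20).
have E : (\int[mu3]_(t in torus3) S2 (t.2, t.1.1, t.1.2) =
    \int[mu3]_(t in torus3) S2 t)%E.
  apply: etrans (integral_cube23 m12 (fun t => S20 _)) _.
  exact: (integral_cube12 mS2 S20).
rewrite E.
have H := integral_middle_sym.
apply: le_trans (leeD (leeD H H) H) _.
rewrite (_ : 18%:E = 6%:E + 6%:E + 6%:E)%E; last first.
  by rewrite -!EFinD; congr (_%:E); ring.
by rewrite !ge0_muleDl// -?EFinD ?lee_fin.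
Qed.

End CubeCover.

(** * The key estimate *)

Section BoxIntegrals.
Context {R : realType}.
Local Notation mu := (@lebesgue_measure R).
Local Notation T := (measurableTypeR R).
Local Notation T3 := (T * T * T)%type.
Local Notation mu3 := (mu \x mu \x mu)%E.
Local Notation I := (`[0%R, 1%R]%classic : set T).
Local Notation V := (`]0%R, 2^-1%R]%classic : set T).
Implicit Types F : R * R * R -> \bar R.

Definition box : set (R * R * R) := I `*` V `*` V.

Lemma measurable_box : measurable (box : set T3).
Proof. by apply: measurableX; [apply: measurableX|]; exact: measurable_itv. Qed.

Lemma integral_box F : measurable_fun [set: T3] F -> (forall t, 0 <= F t)%E ->
  (\int[mu3]_(t in box) F t =
   \int[mu]_(a in I) \int[mu]_(v in V) \int[mu]_(w in V) F (a, v, w))%E.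
Proof.
move=> mF F0.
have mI : measurable I by exact: measurable_itv.
have mV : measurable V by exact: measurable_itv.
have mIV : measurable (I `*` V : set (T * T)) by exact: measurableX.
transitivity (\int[mu \x mu]_(x in I `*` V) \int[mu]_(c in V) F (x, c))%E.
  exact: (integral_prod (product_measure mu mu) mu mF F0 mIV mV).
have mG := measurable_partial_integral mu mF F0 mV.
have G0 x : (0 <= \int[mu]_(c in V) F (x, c))%E by exact: integral_ge0.
exact: (integral_prod mu mu mG G0 mI mV).
Qed.

Lemma integral_box23 F : measurable_fun [set: T3] F -> (forall t, 0 <= F t)%E ->
  (\int[mu3]_(t in box) F (t.1.1, t.2, t.1.2) = \int[mu3]_(t in box) F t)%E.
Proof.
move=> mF F0.
have mF' : measurable_fun [set: T3] (fun t => F (t.1.1, t.2, t.1.2)).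
  apply: (measurableT_comp mF); apply: measurable_triple.
  - exact: measurable_proj1.
  - exact: measurable_proj3.
  - exact: measurable_proj2.
apply: etrans (integral_box mF' (fun t => F0 _)) _.
apply: etrans _ (esym (integral_box mF F0)).
have mV : measurable V by exact: measurable_itv.
apply: eq_integral => a _ /=.
by apply: (@tonelli_rect _ _ _ _ _ mu mu (fun z => F (a, z.2, z.1))) => //;
  exact: (measurable_section a mF').
Qed.

(** First-order Taylor remainder at a. The sign e, which is 1 or -1, lets both neighbours of the
    middle point be treated with t > 0. *)
Definition taylor_chi (phi : R -> R) (a e t : R) : R :=
  phi (a + e * t) - phi a - e * t * derive1 phi a.

(** The factor (v w)^q from the bivector against (v w (v + w))^(- p) from the three sides. *)
Definition hardy_weight (p q v w : R) : R :=
  v `^ (q - p) * (w `^ (q - p) * (v + w) `^ (- p)).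

Definition hardy_term (p q e : R) (phi : R -> R) (t : R * R * R) : R :=
  `|taylor_chi phi t.1.1 e t.1.2 / t.1.2| `^ q * hardy_weight p q t.1.2 t.2.

Lemma hardy_term_ge0 p q e phi t : 0 <= hardy_term p q e phi t.
Proof. by rewrite !mulr_ge0 ?powR_ge0. Qed.

Section HardyTerm.
Variables (p q al r : R) (phi : R -> R).
Hypotheses (q1 : 1 < q) (p0 : 0 <= p) (pq : p < q + 1) (qp : q + 1 < 2 * p).
Hypotheses (alE : al = 3 * p - 2 * q - 1) (al0 : 0 < al).
Hypotheses (dphi : forall x : R, is_derive x 1 phi (derive1 phi x))
  (cphi : continuous (derive1 phi)).
Hypothesis phi_r : gagliardo_le (derive1 phi) q al r.

Let mphi' : measurable_fun [set: R] (derive1 phi).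
Proof. exact: continuous_measurable_fun. Qed.

Let mphi : measurable_fun [set: R] phi.
Proof.
apply: continuous_measurable_fun => x.
by apply/differentiable_continuous/derivable1_diffP; exact: ex_derive.
Qed.

Lemma measurable_hardy_term e : measurable_fun [set: T3] (fun t => (hardy_term p q e phi t)%:E).
Proof.
have p1 := @measurable_proj1 R; have p2 := @measurable_proj2 R.
have p3 := @measurable_proj3 R.
apply/measurable_EFinP/measurable_funM.
  apply: measurable_powR_comp; apply: measurableT_comp => //.
  apply: measurable_funM; last exact: measurable_funV.
  apply: measurable_funB; first apply: measurable_funB.
  - by apply: (measurableT_comp mphi); apply: measurable_funD => //; exact: measurable_funM.
  - exact: (measurableT_comp mphi).
  - by apply: measurable_funM; [exact: measurable_funM|exact: (measurableT_comp mphi')].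
apply: measurable_funM; first exact: measurable_powR_comp.
apply: measurable_funM; first exact: measurable_powR_comp.
by apply: measurable_powR_comp; exact: measurable_funD.
Qed.

Let is_derive_chi a e (t : R) : is_derive t 1 (taylor_chi phi a e)
  (e * (derive1 phi (a + e * t) - derive1 phi a)).
Proof.
have d1 : is_derive t 1 (fun t => a + e * t) e.
  have := is_derive_quadratic a e 0 t; rewrite mulr0 addr0; congr is_derive.
  by apply/funext => x; rewrite mulr0 addr0 mulrC.
have d2 := @is_derive1_comp _ phi (fun t => a + e * t) t _ _ (dphi (a + e * t)) d1.
have d3 := is_derive_quadratic (phi a) (e * derive1 phi a) 0 t.
have := is_deriveB d2 d3; rewrite mulr0 addr0; congr is_derive.
  by apply/funext => x /=; rewrite /taylor_chi !fctE mulr0 addr0 opprD addrA mulrAC (mulrC x).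
by rewrite mulrBr mulrC.
Qed.

Let increment_integral e : e = 1 \/ e = -1 ->
  (\int[mu]_(a in I) \int[mu]_(t in V)
     (`|derive1 phi (a + e * t) - derive1 phi a| `^ q * t `^ (- al))%:E <= (r `^ q)%:E)%E.
Proof.
move=> eE; apply: le_trans phi_r; apply: integral_mono => a _.
  by apply: integral_ge0 => t _; rewrite lee_fin mulr_ge0 ?powR_ge0.
pose k w := (`|derive1 phi (a + w) - derive1 phi a| `^ q / `|w| `^ al)%:E.
have mk : measurable_fun [set: R] k.
  apply/measurable_EFinP/measurable_funM.
    apply: measurable_powR_comp; apply: measurableT_comp => //.
    apply: measurable_funB => //; apply: (measurableT_comp mphi').
    exact: measurable_funD.
  by apply/measurable_funV/measurable_powR_comp; exact: normr_measurable.
have k0 w : (0 <= k w)%E by rewrite lee_fin divr_ge0 ?powR_ge0.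
have kE t : 0 < t -> (`|derive1 phi (a + e * t) - derive1 phi a| `^ q * t `^ (- al))%:E =
    k (e * t).
  move=> t0; rewrite /k powRN; congr (_ * _^-1)%:E; congr powR.
  by case: eE => ->; rewrite ?mul1r ?mulN1r ?normrN gtr0_norm.
have sub : (`]0, 2^-1]%classic : set R) `<=` `[- 2^-1, 2^-1]%classic.
  by move=> x; rewrite /= !in_itv /= => /andP[x1 x2]; apply/andP; split; lra.
have sub' : (`[- 2^-1, 0[%classic : set R) `<=` `[- 2^-1, 2^-1]%classic.
  by move=> x; rewrite /= !in_itv /= => /andP[x1 x2]; apply/andP; split; lra.
case: eE => eE.
  apply: (@le_trans _ _ (\int[mu]_(t in V) k t)%E).
    apply: integral_mono => t; first by rewrite lee_fin mulr_ge0 ?powR_ge0.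
    by rewrite /= in_itv /= => /andP[t0 _]; rewrite kE// eE mul1r.
  by apply: ge0_subset_integral => //; exact: measurable_funTS.
apply: (@le_trans _ _ (\int[mu]_(t in V) k (- t)%R)%E).
  apply: integral_mono => t; first by rewrite lee_fin mulr_ge0 ?powR_ge0.
  by rewrite /= in_itv /= => /andP[t0 _]; rewrite kE// eE mulN1r.
have -> : V = [set t | (`[- 2^-1, 0[%classic : set R) (- t)].
  by apply/seteqP; split => t /=; rewrite !in_itv /= oppr_lt0 lerN2 andbC.
rewrite lebesgue_integral_opp//; last exact: measurable_funTS.
by apply: ge0_subset_integral => //; exact: measurable_funTS.
Qed.

Definition hardy_const : R := weight_const p q * (2 `^ q / al).

(** [hardy_weighted] is applied to the remainder [taylor_chi], whose derivative is up to sign an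
    increment of phi'; integration over the base point a then gives the part of the Gagliardo
    integral with increments of one sign. *)
Lemma integral_hardy_term e : e = 1 \/ e = -1 ->
  (\int[mu3]_(t in box) (hardy_term p q e phi t)%:E <= (hardy_const * r `^ q)%:E)%E.
Proof.
move=> eE; rewrite integral_box; last 2 first.
- exact: measurable_hardy_term.
- by move=> t; rewrite lee_fin hardy_term_ge0.
have W0 := weight_const_ge0 pq qp.
have C0 : 0 <= hardy_const by rewrite mulr_ge0// divr_ge0 ?powR_ge0// ltW.
pose G a := (\int[mu]_(t in V)
     (`|derive1 phi (a + e * t) - derive1 phi a| `^ q * t `^ (- al))%:E)%E.
have mG : measurable_fun [set: R] G.
  apply: (@measurable_partial_integral _ _ _ _ _ mu (fun z : T * T =>
    (`|derive1 phi (z.1 + e * z.2) - derive1 phi z.1| `^ q * z.2 `^ (- al))%:E)) => //.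
  - have m1 : measurable_fun [set: T * T] (fun z => z.1 : R) by exact: measurable_fst.
    have m2 : measurable_fun [set: T * T] (fun z => z.2 : R) by exact: measurable_snd.
    apply/measurable_EFinP/measurable_funM; last exact: measurable_powR_comp.
    apply: measurable_powR_comp; apply: measurableT_comp => //.
    apply: measurable_funB; last exact: (measurableT_comp mphi').
    by apply: (measurableT_comp mphi'); apply: measurable_funD => //; exact: measurable_funM.
  - by move=> z; rewrite lee_fin mulr_ge0 ?powR_ge0.
have G0 a : (0 <= G a)%E.
  by apply: integral_ge0 => t _; rewrite lee_fin mulr_ge0 ?powR_ge0.
rewrite EFinM.
have c0 : (0 <= hardy_const%:E)%E by rewrite lee_fin.
apply: le_trans (lee_wpmul2l c0 (increment_integral eE)).
rewrite -(@ge0_integral_escale _ _ _ mu _ hardy_const G)//; last first.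
  exact: measurable_funTS.
apply: integral_mono => a _.
  apply: integral_ge0 => v _; apply: integral_ge0 => w _.
  by rewrite lee_fin hardy_term_ge0.
have cchi : continuous (fun t => e * (derive1 phi (a + e * t) - derive1 phi a)).
  move=> t; apply: cvgM; first exact: cvg_cst.
  apply: cvgB; last exact: cvg_cst.
  apply: (@continuous_comp _ _ _ (fun t => a + e * t) (derive1 phi)); last exact: cphi.
  by apply: cvgD; [exact: cvg_cst|apply: cvgM; [exact: cvg_cst|exact: cvg_id]].
have chi0 : taylor_chi phi a e 0 = 0.
  by rewrite /taylor_chi mulr0 addr0 mul0r subr0 subrr.
have al0' : 0 < 3 * p - 2 * q - 1 by rewrite -alE.
have := hardy_weighted 2^-1 q1 p0 pq qp al0' (is_derive_chi a e) cchi chi0.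
rewrite -alE -/hardy_const.
set X := integral _ _ _; set Y := integral _ _ _ => XY.
have <- : X = (\int[mu]_(v in V) \int[mu]_(w in V) (hardy_term p q e phi (a, v, w))%:E)%E.
  apply: eq_integral => v _; apply: eq_integral => w _.
  by rewrite /hardy_term /hardy_weight /= -mulrA.
suff <- : Y = G a by exact: XY.
apply: eq_integral => t _; congr (_ `^ _ * _)%:E.
have e1 : `|e| = 1 by case: eE => ->; rewrite ?normrN normr1.
by rewrite normrM e1 mul1r.
Qed.

End HardyTerm.
End BoxIntegrals.

(** Each term is at most the q-th root of the sum of the q-th powers. *)
Lemma powR_sum_le (R : realType) (I : eqType) (s : seq I) (q : R) (x : I -> R) :
  0 < q -> (forall i, 0 <= x i) ->
  (\sum_(i <- s) x i) `^ q <= (size s)%:R `^ q * \sum_(i <- s) x i `^ q.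
Proof.
move=> q0 x0; set S := \sum_(i <- s) x i `^ q.
have S0 : 0 <= S by apply: sumr_ge0 => i _; exact: powR_ge0.
have xS i : i \in s -> x i <= S `^ q^-1.
  move=> si; apply: (@powR_le_cancel _ q) => //; first exact: powR_ge0.
  rewrite -powRrM mulVf ?gt_eqF// powRr1//.
  rewrite /S (big_rem i)//= lerDl; apply: sumr_ge0 => j _; exact: powR_ge0.
have : \sum_(i <- s) x i <= (size s)%:R * S `^ q^-1.
  have -> : (size s)%:R * S `^ q^-1 = \sum_(i <- s) S `^ q^-1.
    by rewrite big_const_seq count_predT iter_addr_0 mulr_natl.
  rewrite big_seq [leRHS]big_seq; exact: ler_sum.
have X0 : 0 <= \sum_(i <- s) x i by exact: sumr_ge0.
move=> /(powR_le_mono (ltW q0) X0) /le_trans; apply.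
rewrite powRM ?powR_ge0// -powRrM mulVf ?gt_eqF// powRr1//.
Qed.

Lemma powRD_le (R : realType) (q x y : R) : 0 < q -> 0 <= x -> 0 <= y ->
  (x + y) `^ q <= 2 `^ q * (x `^ q + y `^ q).
Proof.
move=> q0 x0 y0.
have := @powR_sum_le R _ [:: true; false] q (fun b => if b then x else y) q0.
by rewrite !big_cons !big_nil !addr0; apply; case.
Qed.

(** * Polarized bivectors and the chord-arc condition *)

Section Cross.
Context {R : realType} {n : nat}.
Implicit Types (f g h k : R -> 'rV[R]_n) (a b c r x y : R).

Definition cross f g a b c : 'rV[R]_(n * n) :=
  bivec (f b - f a) (g c - g a) + bivec (g b - g a) (f c - f a).

Definition menger_den k a b c : R :=
  enorm (k b - k c) * enorm (k b - k a) * enorm (k c - k a).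

(** A periodic curve on the line can separate points only at distances below 1; 2/3 is the largest
    distance that [short_arcs] allows between two of the three points. *)
Definition bilip c k : Prop :=
  forall x y, `|x - y| <= 2 / 3 -> c * `|x - y| <= enorm (k x - k y).

(** Apart from the sign, the change of base point only adds Bf /\ Bg + Bg /\ Bf = 0. Together with
    [cross23] this makes the polarized density symmetric in the three points. *)
Lemma cross12 f g a b c : cross f g b a c = - cross f g a b c.
Proof.
have E h : h c - h b = (h c - h a) - (h b - h a) by rewrite opprB addrA subrK.
rewrite /cross !E -(opprB (f b)) -(opprB (g b)).
move: (f b - f a) (g b - g a) (f c - f a) (g c - g a) => Bf Bg Cf Cg.
rewrite !bivecNl !bivecBr (bivecC Bg Bf) !opprB.
by rewrite addrACA subrr add0r opprD.
Qed.

Lemma cross23 f g a b c : cross f g a c b = - cross f g a b c.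
Proof.
by rewrite /cross (bivecC (f c - _)) (bivecC (g c - _)) opprD addrC.
Qed.

Lemma cross_periodic f g a b c : (forall x, f (x + 1) = f x) ->
  (forall x, g (x + 1) = g x) -> cross f g a (b + 1) c = cross f g a b c.
Proof. by move=> pf pg; rewrite /cross pf pg. Qed.

Lemma menger_den12 k a b c : menger_den k b a c = menger_den k a b c.
Proof. by rewrite /menger_den (enormBC (k a) (k b)) (enormBC (k a)) (enormBC (k c) (k b)); ring. Qed.

Lemma menger_den23 k a b c : menger_den k a c b = menger_den k a b c.
Proof. by rewrite /menger_den (enormBC (k c)); ring. Qed.

Lemma menger_den_ge0 k a b c : 0 <= menger_den k a b c.
Proof. by rewrite !mulr_ge0 ?enorm_ge0. Qed.

(** The scalar mean value theorem, tested against the vector to be estimated. The vector e is 0 for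
    Lipschitz bounds and a value of the derivative for remainder bounds. *)
Lemma mean_value_le h r (e : 'rV[R]_n) x y : C1_periodic h ->
  (forall t, `|t - y| <= `|x - y| -> enorm (derive1 h t - e) <= r) ->
  enorm (h x - h y - (x - y) *: e) <= r * `|x - y|.
Proof.
move=> [_ dh ch] hr.
have r0 : 0 <= r by apply: le_trans (enorm_ge0 _) (hr y _); rewrite subrr normr0.
have [<-|xy] := eqVneq x y.
  by rewrite !subrr scale0r subr0 enorm0 normr0 mulr0.
set d := _ - _.
have [->|d0] := eqVneq d 0; first by rewrite enorm0 mulr_ge0.
pose phi := \sum_(i < n) d 0 i *: (fun t : R => h t 0 i).
have dphi (t : R) : is_derive t 1 phi (edot d (derive1 h t)).
  apply: is_derive_eq (is_derive_sum (fun i => is_deriveZ (d 0 i) (dh i t))) _.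
  by apply: eq_bigr => i _.
have phiE u : phi u = edot d (h u).
  by rewrite /phi fct_sumE; apply: eq_bigr.
have cphi (a b : R) : {within `[a, b], continuous phi}.
  apply: continuous_subspaceT => t.
  by apply/differentiable_continuous/derivable1_diffP; exact: ex_derive.
have [t tE dE] : exists2 t, `|t - y| <= `|x - y| &
    phi x - phi y = edot d (derive1 h t) * (x - y).
  have [lt|gt|E] := ltgtP x y; last by rewrite E eqxx in xy.
  - have [t + E] := MVT lt (fun t _ => dphi t) (cphi _ _).
    rewrite in_itv /= => /andP[t1 t2]; exists t; last by rewrite -opprB E -mulrN opprB.
    by rewrite !ltr0_norm ?subr_lt0// !opprB lerD2l lerN2 ltW.
  - have [t + E] := MVT gt (fun t _ => dphi t) (cphi _ _).
    rewrite in_itv /= => /andP[t1 t2]; exists t => //.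
    by rewrite !gtr0_norm ?subr_gt0// lerD2r ltW.
have {}dE : enorm d ^+ 2 = edot d (derive1 h t - e) * (x - y).
  by rewrite enorm_sqr {2}/d edotBr edotZr edotBr -!phiE dE edotBr; ring.
have d1 : 0 < enorm d by rewrite enorm_gt0.
rewrite -(ler_pM2l d1) -expr2 dE; apply: le_trans (ler_norm _) _.
rewrite normrM mulrA ler_wpM2r//; apply: le_trans (cauchy_schwarz _ _) _.
by rewrite ler_wpM2l ?enorm_ge0// hr.
Qed.

Lemma lipschitz_le h r x y : C1_periodic h ->
  (forall x, enorm (derive1 h x) <= r) -> enorm (h x - h y) <= r * `|x - y|.
Proof.
move=> ch hr; have := @mean_value_le h r 0 x y ch; rewrite scaler0 subr0; apply.
by move=> t _; rewrite subr0.
Qed.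

Definition curve_error h a v : 'rV[R]_n := h (a + v) - h a - v *: derive1 h a.

Definition error_slopes h a v w : R :=
  enorm (curve_error h a v) / v + enorm (curve_error h a (- w)) / w.

Lemma cross_le f g rf rg a v w : C1_periodic f -> C1_periodic g ->
  (forall x, enorm (derive1 f x) <= rf) -> (forall x, enorm (derive1 g x) <= rg) ->
  0 < v -> 0 < w ->
  enorm (cross f g a (a + v) (a - w)) <=
    v * w * (rg * error_slopes f a v w + rf * error_slopes g a v w).
Proof.
move=> cf cg hf hg v0 w0.
have step h : enorm (w *: (h (a + v) - h a) + v *: (h (a - w) - h a)) <= v * w * error_slopes h a v w.
  have -> : w *: (h (a + v) - h a) + v *: (h (a - w) - h a) =
      w *: curve_error h a v + v *: curve_error h a (- w).
    rewrite /curve_error !scalerBr !scalerA mulrN scaleNr (mulrC w v).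
    by rewrite opprK [RHS]addrACA addNr addr0.
  apply: le_trans (enormD _ _) _; rewrite !enormZ !gtr0_norm// /error_slopes.
  move: (enorm _) (enorm _) => X Y.
  by rewrite le_eqVlt; apply/orP; left; apply/eqP; field; rewrite !gt_eqF.
have lip h r : C1_periodic h -> (forall x, enorm (derive1 h x) <= r) ->
    enorm (h (a - w) - h a) <= r * w.
  by move=> ch hr; have := lipschitz_le (a - w) a ch hr; rewrite addrAC subrr add0r normrN gtr0_norm.
(* The terms added on the right, v times (f_z - f_x) /\ (g_z - g_x) and v times (g_z - g_x) /\ (f_z
   - f_x) with x = a and z = a - w, are opposite. They are chosen so that the linear parts of the
   first factors cancel. *)
have Ew : w *: cross f g a (a + v) (a - w) =
    bivec (w *: (f (a + v) - f a) + v *: (f (a - w) - f a)) (g (a - w) - g a) +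
    bivec (w *: (g (a + v) - g a) + v *: (g (a - w) - g a)) (f (a - w) - f a).
  rewrite !bivecDl !bivecZl (bivecC (g (a - w) - g a)) scalerN addrACA subrr addr0.
  by rewrite scalerDr.
have E1 : w * enorm (cross f g a (a + v) (a - w)) <=
    enorm (w *: (f (a + v) - f a) + v *: (f (a - w) - f a)) * (rg * w) +
    enorm (w *: (g (a + v) - g a) + v *: (g (a - w) - g a)) * (rf * w).
  rewrite -{1}(gtr0_norm w0) -enormZ Ew; apply: le_trans (enormD _ _) _.
  apply: lerD; apply: le_trans (enorm_bivec_le _ _) _; rewrite ler_wpM2l ?enorm_ge0//.
    exact: lip.
  exact: lip.
rewrite -(ler_pM2l w0); apply: le_trans E1 _.
have rf0 : 0 <= rf := le_trans (enorm_ge0 _) (hf 0).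
have rg0 : 0 <= rg := le_trans (enorm_ge0 _) (hg 0).
have h1 := ler_wpM2r (mulr_ge0 rg0 (ltW w0)) (step f).
have h2 := ler_wpM2r (mulr_ge0 rf0 (ltW w0)) (step g).
apply: le_trans (lerD h1 h2) _.
move: (error_slopes f a v w) (error_slopes g a v w) => X Y.
by rewrite le_eqVlt; apply/orP; left; apply/eqP; ring.
Qed.

Lemma menger_den_ge c k a v w : 0 < c -> bilip c k -> 0 <= v -> v <= 2^-1 -> 0 <= w ->
  w <= 2^-1 -> v + w <= 2 / 3 ->
  c ^+ 3 * (v * w * (v + w)) <= menger_den k a (a + v) (a - w).
Proof.
move=> c0 bk v0 v1 w0 w1 vw.
have b1 : c * (v + w) <= enorm (k (a + v) - k (a - w)).
  have := bk (a + v) (a - w); rewrite (_ : a + v - (a - w) = v + w); last by ring.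
  by rewrite ger0_norm ?addr_ge0//; exact.
have b2 : c * v <= enorm (k (a + v) - k a).
  have := bk (a + v) a; rewrite (_ : a + v - a = v); last by ring.
  by rewrite ger0_norm//; apply; lra.
have b3 : c * w <= enorm (k (a - w) - k a).
  have := bk (a - w) a; rewrite (_ : a - w - a = - w); last by ring.
  by rewrite normrN ger0_norm//; apply; lra.
have c0' := ltW c0.
rewrite (_ : _ * _ = c * (v + w) * (c * v) * (c * w)); last by ring.
by rewrite /menger_den; do ![apply: ler_pM => //]; rewrite ?mulr_ge0 ?addr_ge0.
Qed.

End Cross.

Section ErrorTerms.
Context {R : realType} {n : nat}.
Local Notation mu := (@lebesgue_measure R).
Local Notation T := (measurableTypeR R).
Local Notation T3 := (T * T * T)%type.
Local Notation mu3 := (mu \x mu \x mu)%E.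
Local Notation I := (`[0%R, 1%R]%classic : set T).
Local Notation V := (`]0%R, 2^-1%R]%classic : set T).
Implicit Types (f g h k : R -> 'rV[R]_n).

(** The backward remainder belongs to the variable w, hence the exchange of the last two variables;
    [hardy_weight] is symmetric in them. *)
Definition error_term (p q : R) h (t : R * R * R) : R :=
  \sum_(i < n) (hardy_term p q 1 (fun u => h u 0 i) t +
     hardy_term p q (-1) (fun u => h u 0 i) (t.1.1, t.2, t.1.2)).

Lemma error_term_ge0 p q h t : 0 <= error_term p q h t.
Proof. by apply: sumr_ge0 => i _; rewrite addr_ge0 ?hardy_term_ge0. Qed.

Lemma derive1_component h i : C1_periodic h ->
  derive1 (fun u => h u 0 i) = (fun u => derive1 h u 0 i).
Proof.
move=> [_ dh _]; apply/funext => u; rewrite derive1E.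
exact: (@derive_val _ _ _ _ _ _ _ (dh i u)).
Qed.

Lemma hardy_weightC (p q v w : R) : hardy_weight p q w v = hardy_weight p q v w.
Proof. by rewrite /hardy_weight mulrCA (addrC w). Qed.

Section Constants.
Variables (p q al : R).
Hypotheses (q1 : 1 < q) (p0 : 0 <= p) (pq : p < q + 1) (qp : q + 1 < 2 * p).
Hypotheses (alE : al = 3 * p - 2 * q - 1) (al0 : 0 < al).

Lemma error_slopes_powR h a v w : C1_periodic h -> 0 < v -> 0 < w ->
  error_slopes h a v w `^ q * hardy_weight p q v w <=
    2 `^ q * (n%:R `^ q * error_term p q h (a, v, w)).
Proof.
move=> ch v0 w0; have q0 : 0 < q by move: (q1) => q1'; lra.
have W0 : 0 <= hardy_weight p q v w by rewrite /hardy_weight !mulr_ge0 ?powR_ge0.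
have comp e t : 0 < t -> (enorm (curve_error h a (e * t)) / t) `^ q <=
    n%:R `^ q * \sum_(i < n) `|taylor_chi (fun u => h u 0 i) a e t / t| `^ q.
  move=> t0; have := @powR_sum_le R _ (index_enum 'I_n) q
    (fun i => `|taylor_chi (fun u => h u 0 i) a e t / t|) q0 (fun i => normr_ge0 _).
  have -> : size (index_enum 'I_n) = n.
    by rewrite -sum1_size big_const_ord iter_addn_0 mul1n.
  apply: le_trans; apply: powR_le_mono; first exact: ltW.
    by rewrite divr_ge0 ?enorm_ge0 ?(ltW t0).
  rewrite ler_pdivrMr// mulr_suml; apply: le_trans (enorm_le_sum _) _.
  apply: ler_sum => i _; rewrite normrM normfV (gtr0_norm t0) divfK ?gt_eqF//.
  by rewrite /curve_error /taylor_chi derive1_component// !mxE.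
have s0 t : 0 < t -> forall x, 0 <= enorm (curve_error h a x) / t.
  by move=> t0 x; rewrite divr_ge0 ?enorm_ge0 ?(ltW t0).
have h1 := comp 1 v v0; have h2 := comp (-1) w w0.
rewrite mul1r in h1; rewrite mulN1r in h2.
have := powRD_le q0 (s0 v v0 v) (s0 w w0 (- w)) => /(ler_wpM2r W0).
move=> /le_trans; apply; rewrite -mulrA ler_wpM2l ?powR_ge0//.
apply: le_trans (ler_wpM2r W0 (lerD h1 h2)) _.
rewrite -mulrDr -mulrA ler_wpM2l ?powR_ge0// -big_split/= mulr_suml.
rewrite le_eqVlt; apply/orP; left; apply/eqP; apply: eq_bigr => i _.
by rewrite mulrDl /hardy_term /= (hardy_weightC p q v w).
Qed.

Lemma component_hyps h r i : W1s_ball q al h r ->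
  [/\ forall x : R, is_derive x 1 (fun u => h u 0 i) (derive1 (fun u => h u 0 i) x),
      continuous (derive1 (fun u => h u 0 i))
    & gagliardo_le (derive1 (fun u => h u 0 i)) q al r].
Proof.
move=> [ch _ hg]; rewrite (derive1_component i ch); have [_ dh ch'] := ch.
split; [exact: dh|exact: ch'|].
by apply: curve_gagliardo_coord hg; move: (q1) => q1'; lra.
Qed.

Lemma measurable_error_term h r : W1s_ball q al h r ->
  measurable_fun [set: T3] (fun t => (error_term p q h t)%:E).
Proof.
move=> hb; apply/measurable_EFinP; apply: measurable_sum => i.
have [dh ch gh] := component_hyps i hb.
have m e : measurable_fun [set: T3] (hardy_term p q e (fun u => h u 0 i)).
  by apply/measurable_EFinP; exact: (@measurable_hardy_term R p q _ dh ch e).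
apply: measurable_funD => //.
apply: (measurableT_comp (m (-1))); apply: measurable_triple.
- exact: measurable_proj1.
- exact: measurable_proj3.
- exact: measurable_proj2.
Qed.

Lemma integral_error_term h r : W1s_ball q al h r ->
  (\int[mu3]_(t in box) (error_term p q h t)%:E <=
   (n%:R * (2 * hardy_const p q al) * r `^ q)%:E)%E.
Proof.
move=> hb; rewrite /error_term.
have mb := @measurable_box R.
have m e i : measurable_fun [set: T3] (fun t => (hardy_term p q e (fun u => h u 0 i) t)%:E).
  have [dh ch gh] := component_hyps i hb; exact: (@measurable_hardy_term R p q _ dh ch e).
have m' i : measurable_fun [set: T3]
    (fun t => (hardy_term p q (-1) (fun u => h u 0 i) (t.1.1, t.2, t.1.2))%:E).
  apply: (measurableT_comp (m (-1) i)); apply: measurable_triple.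
  - exact: measurable_proj1.
  - exact: measurable_proj3.
  - exact: measurable_proj2.
have t0 e i t : (0 <= (hardy_term p q e (fun u => h u 0 i) t)%:E)%E.
  by rewrite lee_fin hardy_term_ge0.
under eq_integral do rewrite -sumEFin.
rewrite ge0_integral_sum//; last 2 first.
- move=> i; apply: measurable_funTS; apply/measurable_EFinP.
  apply: measurable_funD; apply/measurable_EFinP; [exact: m|exact: m'].
- by move=> i t _; rewrite lee_fin addr_ge0 ?hardy_term_ge0.
apply: le_trans (_ : (\sum_(i < n) (2 * hardy_const p q al * r `^ q)%:E <= _)%E); last first.
  by rewrite sumEFin sumr_const card_ord lee_fin -[leRHS]mulrA [leRHS]mulr_natl.
apply: (big_ind2 (fun x y => (x <= y)%E)) => [//|*|i _]; first exact: leeD.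
have [dh ch gh] := component_hyps i hb.
under eq_integral do rewrite EFinD.
rewrite (ge0_integral_plus mu3 mb (m 1 i) (m' i) (t0 1 i) (fun t => t0 _ _ _)).
have -> : (\int[mu3]_(t in box) (hardy_term p q (-1) (fun u => h u 0 i) (t.1.1, t.2, t.1.2))%:E
    = \int[mu3]_(t in box) (hardy_term p q (-1) (fun u => h u 0 i) t)%:E)%E.
  exact: (integral_box23 (m (-1) i) (t0 _ _)).
rewrite -mulrA mulr_natl mulr2n EFinD; apply: leeD.
  by apply: (integral_hardy_term q1 p0 pq qp alE al0 dh ch gh); left.
by apply: (integral_hardy_term q1 p0 pq qp alE al0 dh ch gh); right.
Qed.

End Constants.
End ErrorTerms.

Lemma powR_lin_le (R : realType) (q a x b y : R) : 0 < q ->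
  0 <= a -> 0 <= x -> 0 <= b -> 0 <= y ->
  (a * x + b * y) `^ q <= 2 `^ q * (a `^ q * x `^ q + b `^ q * y `^ q).
Proof. by move=> *; rewrite -!powRM// powRD_le ?mulr_ge0. Qed.

Lemma bivec0l (R : realType) n (a : 'rV[R]_n) : bivec 0 a = 0.
Proof. by rewrite -(scale0r a) bivecZl scale0r. Qed.

Lemma bivec0r (R : realType) n (a : 'rV[R]_n) : bivec a 0 = 0.
Proof. by rewrite bivecC bivec0l oppr0. Qed.

Lemma integral_escale_le (R : realType) d (T : measurableType d)
    (m : {measure set T -> \bar R}) (D : set T) (k c : R) (f : T -> \bar R) :
  measurable D -> measurable_fun setT f -> 0 <= k -> (forall x, 0 <= f x)%E ->
  (\int[m]_(x in D) f x <= c%:E)%E -> (\int[m]_(x in D) (k%:E * f x) <= (k * c)%:E)%E.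
Proof.
move=> mD mf k0 f0 fc; rewrite ge0_integral_escale//; last exact: measurable_funTS.
by rewrite EFinM lee_wpmul2l// lee_fin.
Qed.

Lemma integral_plus_le (R : realType) d (T : measurableType d)
    (m : {measure set T -> \bar R}) (D : set T) (a b : R) (f g : T -> \bar R) :
  measurable D -> measurable_fun setT f -> measurable_fun setT g ->
  (forall x, 0 <= f x)%E -> (forall x, 0 <= g x)%E ->
  (\int[m]_(x in D) f x <= a%:E)%E -> (\int[m]_(x in D) g x <= b%:E)%E ->
  (\int[m]_(x in D) (f x + g x) <= (a + b)%:E)%E.
Proof. by move=> *; rewrite ge0_integral_plus// EFinD leeD. Qed.

Section CrossDensity.
Context {R : realType} {n : nat}.
Local Notation mu := (@lebesgue_measure R).
Local Notation T := (measurableTypeR R).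
Local Notation T3 := (T * T * T)%type.
Local Notation mu3 := (mu \x mu \x mu)%E.
Local Notation I := (`[0%R, 1%R]%classic : set T).
Local Notation V := (`]0%R, 2^-1%R]%classic : set T).
Implicit Types (f g h k : R -> 'rV[R]_n).
Variables (p q al : R).
Hypotheses (q1 : 1 < q) (p0 : 0 <= p) (pq : p < q + 1) (qp : q + 1 < 2 * p).
Hypotheses (alE : al = 3 * p - 2 * q - 1) (al0 : 0 < al).

Definition cross_density f g k (t : R * R * R) : R :=
  enorm (cross f g t.1.1 t.1.2 t.2) `^ q * menger_den k t.1.1 t.1.2 t.2 `^ (- p).

Lemma cross_density_ge0 f g k t : 0 <= cross_density f g k t.
Proof. by rewrite mulr_ge0 ?powR_ge0. Qed.

Lemma measurable_increment h (f1 f2 : T3 -> R) : C1_periodic h ->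
  measurable_fun setT f1 -> measurable_fun setT f2 ->
  forall i, measurable_fun setT (fun t => (h (f1 t) - h (f2 t)) 0 i).
Proof.
move=> ch m1 m2 i.
have -> : (fun t => (h (f1 t) - h (f2 t)) 0 i) = (fun t => h (f1 t) 0 i - h (f2 t) 0 i).
  by apply/funext => t; rewrite !mxE.
by apply: measurable_funB; exact: measurable_coord.
Qed.

Lemma measurable_bivec (f1 f2 : T3 -> 'rV[R]_n) :
  (forall i, measurable_fun setT (fun t => f1 t 0 i)) ->
  (forall i, measurable_fun setT (fun t => f2 t 0 i)) ->
  forall j, measurable_fun setT (fun t => bivec (f1 t) (f2 t) 0 j).
Proof.
move=> m1 m2 j; case/mxvec_indexP: j => i j.
rewrite (_ : (fun _ => _) = fun t => (Num.sqrt 2)^-1 * (f1 t 0 i * f2 t 0 j - f1 t 0 j * f2 t 0 i)).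
  by apply: measurable_funM => //; apply: measurable_funB; exact: measurable_funM.
by apply/funext => t; rewrite /bivec mxvecE !mxE.
Qed.

Lemma measurable_cross f g : C1_periodic f -> C1_periodic g ->
  forall j, measurable_fun setT (fun t : T3 => cross f g t.1.1 t.1.2 t.2 0 j).
Proof.
move=> cf cg j; have p1 := @measurable_proj1 R; have p2 := @measurable_proj2 R.
have p3 := @measurable_proj3 R.
have -> : (fun t : T3 => cross f g t.1.1 t.1.2 t.2 0 j) = (fun t =>
    bivec (f t.1.2 - f t.1.1) (g t.2 - g t.1.1) 0 j +
    bivec (g t.1.2 - g t.1.1) (f t.2 - f t.1.1) 0 j).
  by apply/funext => t; rewrite !mxE.
by apply: measurable_funD; apply: measurable_bivec => i; exact: measurable_increment.
Qed.

Lemma measurable_menger_den k : C1_periodic k ->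
  measurable_fun setT (fun t : T3 => menger_den k t.1.1 t.1.2 t.2).
Proof.
move=> ck; have p1 := @measurable_proj1 R; have p2 := @measurable_proj2 R.
have p3 := @measurable_proj3 R.
by do 2?apply: measurable_funM; apply: measurable_enorm => i; exact: measurable_increment.
Qed.

Lemma measurable_cross_density f g k : C1_periodic f -> C1_periodic g -> C1_periodic k ->
  measurable_fun setT (fun t : T3 => (cross_density f g k t)%:E).
Proof.
move=> cf cg ck; apply/measurable_EFinP/measurable_funM.
  by apply: measurable_powR_comp; apply: measurable_enorm => j; exact: measurable_cross.
by apply: measurable_powR_comp; exact: measurable_menger_den.
Qed.

Definition pointwise_const (c : R) : R := (c ^+ 3) `^ (- p) * 2 `^ q * (2 `^ q * n%:R `^ q).

Lemma pointwise_const_ge0 c : 0 <= pointwise_const c.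
Proof. by rewrite !mulr_ge0 ?powR_ge0. Qed.

Lemma cross_density_le f g k rf rg c a v w : W1s_ball q al f rf -> W1s_ball q al g rg ->
  0 < c -> bilip c k -> 0 < v -> 0 < w -> short_arcs v w ->
  cross_density f g k (a, a + v, a - w) <=
    pointwise_const c * (rg `^ q * error_term p q f (a, v, w) +
                         rf `^ q * error_term p q g (a, v, w)).
Proof.
move=> [cf hf _] [cg hg _] c0 bk v0 w0 /and5P[_ v1 _ w1 vw].
have q0 : 0 < q by move: (q1) => q1'; lra.
have rf0 : 0 <= rf := le_trans (enorm_ge0 _) (hf 0).
have rg0 : 0 <= rg := le_trans (enorm_ge0 _) (hg 0).
have D := menger_den_ge a c0 bk (ltW v0) v1 (ltW w0) w1 vw.
have vw0 : 0 < v + w by rewrite addr_gt0.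
have D0 : 0 < c ^+ 3 * (v * w * (v + w)) by rewrite !mulr_gt0// exprn_gt0.
have C := cross_le a cf cg hf hg v0 w0.
have s0 h : 0 <= error_slopes h a v w.
  by rewrite addr_ge0// divr_ge0 ?enorm_ge0 ?(ltW v0) ?(ltW w0).
rewrite /cross_density /=.
have h1 := powRN_le p0 D0 D.
have h2 := powR_le_mono (ltW q0) (enorm_ge0 _) C.
apply: le_trans (ler_pM (powR_ge0 _ _) (powR_ge0 _ _) h2 h1) _.
have vw00 := mulr_gt0 v0 w0.
rewrite (powRM q (ltW vw00)); last by rewrite addr_ge0 ?mulr_ge0.
rewrite (powRM _ (exprn_ge0 _ (ltW c0))); last by rewrite mulr_ge0 ?(ltW vw0) ?(ltW vw00).
have W : (v * w) `^ q * (v * w * (v + w)) `^ (- p) = hardy_weight p q v w.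
  rewrite (powRM (- p) (ltW vw00) (ltW vw0)) mulrA -powRD_pos//.
  by rewrite (powRM (q - p) (ltW v0) (ltW w0)) -mulrA.
have -> (A B C' D' : R) : A * B * (C' * D') = C' * B * (A * D') by ring.
rewrite W; have W0 : 0 <= hardy_weight p q v w by rewrite -W mulr_ge0 ?powR_ge0.
have S := powR_lin_le q0 rg0 (s0 f) rf0 (s0 g).
have Ef := error_slopes_powR p q1 a cf v0 w0.
have Eg := error_slopes_powR p q1 a cg v0 w0.
rewrite /pointwise_const -!mulrA.
have cp := powR_ge0 (c ^+ 3) (- p).
rewrite ler_wpM2l//; apply: le_trans (ler_wpM2r W0 S) _.
rewrite -mulrA ler_wpM2l ?powR_ge0// mulrDl.
have k1 := ler_wpM2l (powR_ge0 rg q) Ef; have k2 := ler_wpM2l (powR_ge0 rf q) Eg.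
apply: le_trans (lerD _ _) _; [by rewrite -mulrA; exact: k1|by rewrite -mulrA; exact: k2|].
move: (error_term p q f (a, v, w)) (error_term p q g (a, v, w)) => X Y.
move: (rf `^ q) (rg `^ q) (2 `^ q) (n%:R `^ q) => x y z u.
by rewrite le_eqVlt; apply/orP; left; apply/eqP; ring.
Qed.

Definition key_const (c : R) : R :=
  18 * (pointwise_const c * (2 * (n%:R * (2 * hardy_const p q al)))).

Lemma key_const_ge0 c : 0 <= key_const c.
Proof.
have W0 := weight_const_ge0 pq qp.
have H0 : 0 <= hardy_const p q al.
  by rewrite /hardy_const mulr_ge0// divr_ge0 ?powR_ge0// ?(ltW al0).
do 2![apply: mulr_ge0 => //]; first exact: pointwise_const_ge0.
by do 2![apply: mulr_ge0 => //]; exact: mulr_ge0.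
Qed.

Lemma key_estimate f g k rf rg c : W1s_ball q al f rf -> W1s_ball q al g rg ->
  C1_periodic k -> 0 < c -> bilip c k ->
  (\int[mu3]_(t in torus3) (cross_density f g k t)%:E
   <= (key_const c * (rf * rg) `^ q)%:E)%E.
Proof.
move=> bf bg ck c0 bk.
have [cf hf _] := bf; have [cg hg _] := bg; have [pk _ _] := ck.
have [pf _ _] := cf; have [pg _ _] := cg.
have rf0 : 0 <= rf := le_trans (enorm_ge0 _) (hf 0).
have rg0 : 0 <= rg := le_trans (enorm_ge0 _) (hg 0).
have q0 : 0 < q by move: (q1) => q1'; lra.
pose F t := (cross_density f g k t)%:E.
have mF : measurable_fun [set: T3] F by exact: measurable_cross_density.
have F0 t : (0 <= F t)%E by rewrite lee_fin cross_density_ge0.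
have F12 a b c' : F (b, a, c') = F (a, b, c').
  by rewrite /F /cross_density /= cross12 enormN menger_den12.
have F23 a b c' : F (a, c', b) = F (a, b, c').
  by rewrite /F /cross_density /= cross23 enormN menger_den23.
have Fper a b c' : F (a, b + 1, c') = F (a, b, c').
  by rewrite /F /cross_density /= (cross_periodic a b c' pf pg) /menger_den (pk b).
apply: le_trans (integral_cover mF F0 F12 F23 Fper) _.
pose C := pointwise_const c; have C0 : 0 <= C := pointwise_const_ge0 c.
have mEf := measurable_error_term p q1 bf.
have mEg := measurable_error_term p q1 bg.
have eE0 h t : (0 <= (error_term p q h t)%:E)%E by rewrite lee_fin error_term_ge0.
pose Ef t := ((rg `^ q)%:E * (error_term p q f t)%:E)%E.
pose Eg t := ((rf `^ q)%:E * (error_term p q g t)%:E)%E.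
have mEf' : measurable_fun [set: T3] Ef := measurable_funeM (rg `^ q)%:E mEf.
have mEg' : measurable_fun [set: T3] Eg := measurable_funeM (rf `^ q)%:E mEg.
have Ef0 t : (0 <= Ef t)%E by rewrite mule_ge0// lee_fin powR_ge0.
have Eg0 t : (0 <= Eg t)%E by rewrite mule_ge0// lee_fin powR_ge0.
pose G t := (C%:E * (Ef t + Eg t))%E.
have mS : measurable_fun [set: T3] (fun t => Ef t + Eg t)%E
  := emeasurable_funD mEf' mEg'.
have S0 t : (0 <= Ef t + Eg t)%E := adde_ge0 (Ef0 t) (Eg0 t).
have C0' : (0 <= C%:E)%E by rewrite lee_fin.
have mG : measurable_fun [set: T3] G := measurable_funeM C%:E mS.
have G0 t : (0 <= G t)%E := mule_ge0 C0' (S0 t).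
have mb := @measurable_box R.
have FG : (middle_integral F <= \int[mu3]_(t in box) G t)%E.
  rewrite (integral_box mG G0) /middle_integral.
  have mp0 a v w : (0 <= middle_part F a v w)%E by rewrite /middle_part; case: ifP.
  apply: integral_mono => a _.
    by apply: integral_ge0 => v _; exact: integral_ge0.
  (* [short_arcs] admits v = 0 and w = 0 while [box] does not; in these cases two of the points
     coincide and the bivector vanishes. *)
  have zero a' v w : ~~ ((0 < v) && (0 < w)) -> middle_part F a' v w = 0%E.
    move=> vw; rewrite /middle_part; case: ifP => // /and5P[v0 _ w0 _ _].
    have : v = 0 \/ w = 0.
      move: vw; rewrite negb_and -!leNgt => /orP[h|h]; [left|right]; apply/eqP.
        by rewrite eq_le h.
      by rewrite eq_le h.
    rewrite /F /cross_density /= /cross => -[->|->].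
      by rewrite addr0 !subrr !bivec0l addr0 enorm0 powR0 ?mul0r ?gt_eqF.
    by rewrite subr0 !subrr !bivec0r addr0 enorm0 powR0 ?mul0r ?gt_eqF.
  rewrite [leRHS]integral_mkcond; apply: integral_mono => v _.
    exact: integral_ge0.
  rewrite patchE; case: ifPn => [|vV].
    rewrite inE /= in_itv /= => /andP[v0 v1].
    rewrite [leRHS]integral_mkcond; apply: integral_mono => w _; first exact: mp0.
    rewrite patchE; case: ifPn => [|wV].
      rewrite inE /= in_itv /= => /andP[w0 w1].
      rewrite /middle_part; case: ifPn => [sa|_]; last exact: G0.
      have -> : G (a, v, w) = (C * (rg `^ q * error_term p q f (a, v, w) +
          rf `^ q * error_term p q g (a, v, w)))%:E.
        by [].
      rewrite /F lee_fin.
      exact: (cross_density_le a bf bg c0 bk v0 w0 sa).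
    rewrite /middle_part; case: ifPn => // sa.
    have := zero a v w; rewrite /middle_part sa => -> //.
    move: wV; rewrite notin_setE /= in_itv /= => /negP; apply: contra => /andP[_ ->].
    by case/and5P: sa => _ _ _ -> _.
  rewrite integral0_eq// => w _.
  case sa : (short_arcs v w); last by rewrite /middle_part sa.
  apply: zero; move: vV; rewrite notin_setE /= in_itv /= => /negP; apply: contra => /andP[-> _].
  by case/and5P: sa => _ -> _ _ _.
have If := integral_escale_le mb mEf (powR_ge0 rg q) (eE0 f)
  (integral_error_term q1 p0 pq qp alE al0 bf).
have Ig := integral_escale_le mb mEg (powR_ge0 rf q) (eE0 g)
  (integral_error_term q1 p0 pq qp alE al0 bg).
have GI := integral_escale_le mb mS C0 S0 (integral_plus_le mb mEf' mEg' Ef0 Eg0 If Ig).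
have c18 : (0 <= 18%:E :> \bar R)%E by rewrite lee_fin.
apply: le_trans (lee_wpmul2l c18 (le_trans FG GI)) _.
rewrite -EFinM lee_fin /key_const -/C (powRM q rf0 rg0).
move: (hardy_const p q al) (C) (rf `^ q) (rg `^ q) => H C' x y.
rewrite le_eqVlt; apply/orP; left; apply/eqP; ring.
Qed.

End CrossDensity.

(** * Regular embedded curves *)

(** A nonempty open set contains an interval, hence is not null. *)
Lemma ae_everywhere (R : realType) (P : set R) : open (~` P) ->
  {ae @lebesgue_measure R, forall x, P x} -> forall x, P x.
Proof.
move=> oP [A [mA A0 PA]] x; apply: contrapT => nPx.
have /nbhs_ballP[d /= d0 dP] : nbhs x (~` P) by exact: open_nbhs_nbhs.
have sub : (`[x - d / 2, x + d / 2]%classic : set R) `<=` A.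
  move=> y; rewrite /= in_itv /= => /andP[y1 y2]; apply: PA; apply: dP.
  rewrite /ball /= ltr_distlC; apply/andP; split; lra.
have : (@lebesgue_measure R `[(x - d / 2)%R, (x + d / 2)%R]%classic <= lebesgue_measure A)%E.
  by apply: le_measure => //; rewrite inE//; exact: measurable_itv.
rewrite A0 lebesgue_measure_itv /= lte_fin ifT; last by lra.
by rewrite -EFinD lee_fin; lra.
Qed.

Lemma continuous_enorm (R : realType) (T : topologicalType) m (F : T -> 'rV[R]_m) :
  (forall i, continuous (fun t => F t 0 i)) -> continuous (fun t => enorm (F t)).
Proof.
move=> cF x; rewrite /enorm.
apply: (@continuous_comp _ _ _ (fun t => edot (F t) (F t)) Num.sqrt); last first.
  exact: sqrt_continuous.
rewrite /edot.
have -> : (fun t => \sum_(i < m) F t 0 i * F t 0 i) =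
    \sum_(i < m) ((fun t => F t 0 i) * (fun t => F t 0 i)).
  by apply/funext => t; rewrite fct_sumE.
elim/big_ind : _ => [|f1 f2 h1 h2|i _]; first exact: cvg_cst.
  exact: cvgD.
by apply: cvgM; exact: cF.
Qed.

Lemma periodic_intr (R : realType) (V : Type) (h : R -> V) : (forall x, h (x + 1) = h x) ->
  forall (k : int) (x : R), h (x + k%:~R) = h x.
Proof.
move=> ph; have pn (m : nat) x : h (x + m%:R) = h x.
  by elim: m x => [|m IH] x; rewrite ?addr0// -natr1 addrA ph.
case=> m x; first exact: pn.
by rewrite NegzE rmorphN /= -(pn m.+1) subrK.
Qed.

Section Geometry.
Context {R : realType} {n : nat}.
Implicit Types (f g h k : R -> 'rV[R]_n) (c r x y : R).

Lemma continuous_coord h i : C1_periodic h -> continuous (fun x => h x 0 i).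
Proof.
move=> [_ dh _] x; apply/differentiable_continuous/derivable1_diffP.
exact: (@ex_derive _ _ _ _ _ _ _ (dh i x)).
Qed.

Lemma continuous_derive1_dist h (v : 'rV[R]_n) : C1_periodic h ->
  continuous (fun x => enorm (derive1 h x - v)).
Proof.
move=> [_ _ ch]; apply: continuous_enorm => i.
have -> : (fun t => (derive1 h t - v) 0 i) = (fun t => derive1 h t 0 i - v 0 i).
  by apply/funext => t; rewrite !mxE.
by move=> x; apply: cvgB; [exact: ch|exact: cvg_cst].
Qed.

Lemma derive1_ge_everywhere g c : C1_periodic g ->
  {ae @lebesgue_measure R, forall u, c <= enorm (derive1 g u)} ->
  forall u, c <= enorm (derive1 g u).
Proof.
move=> cg; apply: (@ae_everywhere _ (fun u => c <= enorm (derive1 g u))).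
have -> : ~` (fun u => c <= enorm (derive1 g u)) =
    (fun u => enorm (derive1 g u - 0)) @^-1` [set y | y < c].
  by apply/seteqP; split => u /=; rewrite subr0 ltNge => /negP.
by apply: open_comp; [move=> u _; exact: continuous_derive1_dist|exact: open_lt].
Qed.

(** Compactness is used for y in one period only; x ranges over the whole line, so that nothing
    special happens at the ends of the period. *)
Lemma derive1_uniform g e : C1_periodic g -> 0 < e -> exists2 d, 0 < d &
  forall x y, `|x - y| <= d -> enorm (derive1 g x - derive1 g y) <= e.
Proof.
move=> cg e0.
pose P (d y : R) := forall x : R, `|x - y| <= d -> enorm (derive1 g x - derive1 g y) <= e.
have : \forall d \near (0 : R)^'+, (`[0, 1]%classic : set R) `<=` P d.
  apply: (compact_near_coveringP _).1; first exact: segment_compact.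
  move=> y _.
  have /cvgrPdist_lt C := @continuous_derive1_dist g (derive1 g y) cg y.
  have e2 : 0 < e / 2 by rewrite divr_gt0.
  have /nbhs_ballP[d /= d0 dP] := C _ e2.
  have dP' (x : R) : `|y - x| < d -> enorm (derive1 g x - derive1 g y) <= e / 2.
    move=> xd; have := dP x xd.
    rewrite (subrr (derive1 g y)) enorm0 sub0r normrN ger0_norm ?enorm_ge0//.
    exact: ltW.
  exists (ball y (d / 2), [set t | t < d / 2]) => /=.
    split; first by apply: nbhsx_ballx; rewrite divr_gt0.
    by apply: nbhs_right_lt; rewrite divr_gt0.
  move=> [x' t] [/= x'1 td] x xx'.
  rewrite -(subrKA (derive1 g y)); apply: le_trans (enormD _ _) _.
  rewrite (splitr e); apply: lerD.
    apply: dP'; rewrite -(subrKA x'); apply: le_lt_trans (ler_normD _ _) _.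
    by rewrite (splitr d) ltrD// distrC (le_lt_trans xx').
  by rewrite enormBC; apply: dP'; apply: lt_le_trans x'1 _; lra.
move=> near01.
have : \forall d \near (0 : R)^'+, 0 < d /\ (`[0, 1]%classic : set R) `<=` P d.
  by near=> d; split => //; near: d.
move=> /(@filter_ex _ _ _)[d [d0 dP]]; exists d => // x y xy.
have [pg0 _ _] := cg.
have pg := periodic_intr (derive1_periodic pg0) (- Num.floor y).
have /andP[f1 f2] := floor_itv y.
rewrite -(pg x) -(pg y); apply: dP.
  rewrite /= in_itv /= rmorphN /=; apply/andP; split; first by rewrite subr_ge0.
  by rewrite intrD in f2; rewrite lerBlDl ltW.
by rewrite (_ : _ - _ = x - y)//; ring.
Unshelve. all: by end_near.
Qed.

(** Minimum of a continuous function on a compact set of pairs (y, x - y). A difference in [d, 2/3]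
    is never an integer, so embeddedness makes the minimum positive. *)
Lemma far_apart g d : C1_periodic g -> embedded g -> 0 < d -> d <= 2 / 3 ->
  exists2 m, 0 < m & forall x y, d <= `|x - y| -> `|x - y| <= 2 / 3 -> m <= enorm (g x - g y).
Proof.
move=> cg eg d0 d1.
pose A : set (R * R) := `[0, 1]%classic `*` `[d, 2 / 3]%classic.
pose F (z : R * R) := enorm (g (z.1 + z.2) - g z.1).
have cA : compact A by apply: compact_setX; exact: segment_compact.
have cF : continuous F.
  apply: continuous_enorm => i.
  have -> : (fun t : R * R => (g (t.1 + t.2) - g t.1) 0 i) =
      (fun t => g (t.1 + t.2) 0 i - g t.1 0 i).
    by apply/funext => t; rewrite !mxE.
  move=> z; apply: cvgB.
    apply: (@continuous_comp _ _ _ (fun t : R * R => t.1 + t.2) (fun x => g x 0 i)).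
      by apply: cvgD; [exact: cvg_fst|exact: cvg_snd].
    exact: continuous_coord.
  apply: (@continuous_comp _ _ _ (fun t : R * R => t.1) (fun x => g x 0 i)).
    exact: cvg_fst.
  exact: continuous_coord.
have A0 : A !=set0.
  exists (0, d); split => /=; rewrite in_itv /= ?lexx ?ler01//.
have [z zA zmin] := compact_EVT_min A0 cA (continuous_subspaceT cF).
exists (F z).
  rewrite enorm_gt0 subr_eq0; apply/eqP => /eg[k].
  move: zA; rewrite inE => -[_]; rewrite /= in_itv /= => /andP[z1 z2].
  rewrite (_ : z.1 + z.2 - z.1 = z.2); last by ring.
  move=> zk; have : 0 < k%:~R :> R by rewrite -zk; lra.
  rewrite ltr0z gtz0_ge1 -(ler1z R) -zk leNgt; case/negP; lra.
have step x y : y <= x -> d <= x - y -> x - y <= 2 / 3 -> F z <= enorm (g x - g y).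
  move=> yx h1 h2; have [pg0 _ _] := cg.
  have pg := periodic_intr pg0 (- Num.floor y).
  have /andP[f1 f2] := floor_itv y.
  have := zmin (y + (- Num.floor y)%:~R, x - y).
  rewrite /F /= (_ : y + _ + (x - y) = x + (- Num.floor y)%:~R); last by ring.
  rewrite !pg; apply; rewrite inE; split; rewrite /= in_itv /= ?h1 ?h2//.
  rewrite rmorphN /=; apply/andP; split; first by rewrite subr_ge0.
  by rewrite intrD in f2; rewrite lerBlDl ltW.
move=> x y; have [yx|/ltW xy] := leP y x.
  by rewrite ger0_norm ?subr_ge0//; exact: step.
by rewrite distrC enormBC ger0_norm ?subr_ge0//; exact: step.
Qed.

(** For close points the chord differs from (x - y) g' by at most c / 2 times |x - y|, as g'
    oscillates by at most c / 2; the other points are separated by compactness. *)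
Lemma regular_embedded_bilip g : C1_periodic g -> regular g -> embedded g ->
  exists c, [/\ 0 < c, bilip c g & forall x, c <= enorm (derive1 g x)].
Proof.
move=> cg [c c0 /(derive1_ge_everywhere cg) gc] eg.
have c2 : 0 < c / 2 by rewrite divr_gt0.
have [d d0 dP] := derive1_uniform cg c2.
pose d' := Num.min d (2 / 3).
have d'0 : 0 < d' by rewrite lt_min d0 divr_gt0.
have d'1 : d' <= 2 / 3 by rewrite ge_min lexx orbT.
have [m m0 mP] := far_apart cg eg d'0 d'1.
exists (Num.min (c / 2) m); split.
- by rewrite lt_min c2.
- move=> x y xy; have [far|near] := leP d' `|x - y|.
    apply: le_trans (mP _ _ far xy).
    have h : Num.min (c / 2) m <= m by rewrite ge_min lexx orbT.
    apply: le_trans (ler_wpM2r (normr_ge0 _) h) _.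
    by rewrite ler_piMr ?ltW//; lra.
  have xd : `|x - y| <= d by apply: ltW; apply: lt_le_trans near _; rewrite ge_min lexx.
  have h : Num.min (c / 2) m <= c / 2 by rewrite ge_min lexx.
  apply: le_trans (ler_wpM2r (normr_ge0 _) h) _.
  have M := @mean_value_le R n g (c / 2) (derive1 g y) x y cg
    (fun t ty => dP t y (le_trans ty xd)).
  have S := enorm_subr_le ((x - y) *: derive1 g y) (g x - g y - (x - y) *: derive1 g y).
  rewrite (addrC (_ *: _)) subrK enormZ in S.
  have G := ler_wpM2l (normr_ge0 (x - y)) (gc y).
  lra.
- by move=> x; apply: le_trans (gc x); rewrite ge_min; apply/orP; left; lra.
Qed.

(** Both curves are periodic, so x may be replaced by its translate closest to y, to which [bilip]
    applies. *)
Lemma increment_le g h c r x y : 0 < c -> bilip c g -> C1_periodic g -> C1_periodic h ->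
  (forall x, enorm (derive1 h x) <= r) ->
  enorm (h x - h y) <= r / c * enorm (g x - g y).
Proof.
move=> c0 bg [pg _ _] ch hr; have [ph _ _] := ch.
pose k := - Num.floor (x - y + 2^-1).
have /andP[f1 f2] := floor_itv (x - y + 2^-1).
rewrite -(periodic_intr pg k x) -(periodic_intr ph k x).
set z := x + k%:~R.
have zy : `|z - y| <= 2 / 3.
  rewrite /z /k rmorphN /= ler_norml; rewrite intrD in f2; apply/andP; split; lra.
have r0 : 0 <= r := le_trans (enorm_ge0 _) (hr 0).
apply: le_trans (lipschitz_le z y ch hr) _.
rewrite mulrAC -mulrA ler_wpM2l// ler_pdivlMr// mulrC.
exact: bg.
Qed.

End Geometry.

(** * Frechet differentiability *)

Section FineIntegrals.
Context d (T : measurableType d) (R : realType) (m : {measure set T -> \bar R}).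
Variables (D : set T) (mD : measurable D).
Implicit Types F G : T -> R.

Lemma integrable_dominated F G (C M : R) : measurable_fun setT F -> measurable_fun setT G ->
  0 <= C -> (forall t, `|F t| <= C * G t) -> (forall t, 0 <= G t) ->
  (\int[m]_(t in D) (G t)%:E <= M%:E)%E ->
  m.-integrable D (fun t => (F t)%:E) /\ `|fine (\int[m]_(t in D) (F t)%:E)| <= C * M.
Proof.
move=> mF mG C0 FG G0 GM.
have I1 : (\int[m]_(t in D) `|(F t)%:E| <= (C * M)%:E)%E.
  apply: le_trans (_ : \int[m]_(t in D) (C%:E * (G t)%:E) <= _)%E.
    by apply: integral_mono => t _; rewrite -?EFinM lee_fin// FG.
  by apply: integral_escale_le => //; exact/measurable_EFinP.
have iF : m.-integrable D (fun t => (F t)%:E).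
  apply/integrableP; split; first exact/measurable_funTS/measurable_EFinP.
  by apply: le_lt_trans I1 _; exact: ltry.
split => //; rewrite -lee_fin -abse_EFin fineK; last exact: integrable_fin_num.
apply: le_trans (le_abse_integral m mD _) I1.
exact/measurable_funTS/measurable_EFinP.
Qed.

Lemma fine_integral_lin F G (a : R) : m.-integrable D (fun t => (F t)%:E) ->
  m.-integrable D (fun t => (G t)%:E) ->
  m.-integrable D (fun t => (a * F t + G t)%:E) /\
  fine (\int[m]_(t in D) (a * F t + G t)%:E) =
    a * fine (\int[m]_(t in D) (F t)%:E) + fine (\int[m]_(t in D) (G t)%:E).
Proof.
move=> iF iG; have iaF : m.-integrable D (fun t => (a%:E * (F t)%:E)%E).
  exact: integrableZl.
have E : (fun t => (a * F t + G t)%:E) = (fun t => a%:E * (F t)%:E + (G t)%:E)%E.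
  by [].
split; first by rewrite E; exact: integrableD.
have fF := integrable_fin_num mD iF; have fG := integrable_fin_num mD iG.
by rewrite E integralD// integralZl// fineD ?fin_numM// fineM.
Qed.

End FineIntegrals.

Section MeasurableDensity.
Context d (T : measurableType d) (R : realType).
Local Notation mv F := (forall i, measurable_fun setT (fun t : T => F t 0 i)).

Lemma measurable_edot m (F G : T -> 'rV[R]_m) : mv F -> mv G ->
  measurable_fun setT (fun t => edot (F t) (G t)).
Proof. by move=> mF mG; apply: measurable_sum => i; exact: measurable_funM. Qed.

Lemma measurable_psi m (a : R) (F G : T -> 'rV[R]_m) : mv F -> mv G ->
  measurable_fun setT (fun t => psi a (F t) (G t)).
Proof.
move=> mF mG; apply: measurable_funM; last exact: measurable_edot.
by apply: measurable_powR_comp; exact: measurable_enorm.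
Qed.

Lemma measurable_Phi n (J : Type) (s : seq J) (a : J -> R) (y : T -> J -> 'rV[R]_n) :
  (forall j, mv (fun t => y t j)) -> measurable_fun setT (fun t => Phi s a (y t)).
Proof.
move=> my; rewrite /Phi; elim: s => [|j s IH].
  by under eq_fun do rewrite big_nil; exact: measurable_cst.
under eq_fun do rewrite big_cons; apply: measurable_funM => //.
by apply: measurable_powR_comp; exact: measurable_enorm.
Qed.

Lemma measurable_Lam n (J : Type) (s : seq J) (a : J -> R) (y h : T -> J -> 'rV[R]_n) :
  (forall j, mv (fun t => y t j)) -> (forall j, mv (fun t => h t j)) ->
  measurable_fun setT (fun t => Lam s a (y t) (h t)).
Proof.
move=> my mh; rewrite /Lam; apply: measurable_sum => j.
by apply: measurable_funM => //; exact: measurable_psi.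
Qed.

End MeasurableDensity.

(** * The integrand of the Menger energy and its formal derivative *)

Section CurveDensity.
Context {R : realType} {n : nat}.
Local Notation T := (measurableTypeR R).
Local Notation T3 := (T * T * T)%type.
Implicit Types (f g h k : R -> 'rV[R]_n) (t : R * R * R).
Variables (p q : R).
Hypotheses (p0 : 0 < p) (q1 : 1 < q).

Definition wedge3 k t : 'rV[R]_(n * n) :=
  bivec (k t.1.2 - k t.1.1) (k t.2 - k t.1.1).

Definition cross3 f g t : 'rV[R]_(n * n) := cross f g t.1.1 t.1.2 t.2.

(** The last case repeats for all larger indices, so that hypotheses on the six vectors can be
    stated for every natural number j while [Phi] and [Lam] run over [iota 0 6]. *)
Definition lengths k t (j : nat) : 'rV[R]_n :=
  match j with
  | 0 => k t.1.2 - k t.2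
  | 1 => k t.1.2 - k t.1.1
  | 2 => k t.2 - k t.1.1
  | 3 => derive1 k t.1.1
  | 4 => derive1 k t.1.2
  | _ => derive1 k t.2
  end.

Definition exponents (j : nat) : R := if (j < 3)%N then - p else 1.

Definition menger_dens k t : R :=
  dens q (iota 0 6) exponents (wedge3 k t) (lengths k t).

Definition menger_Phi k t : R := Phi (iota 0 6) exponents (lengths k t).

Definition menger_ddens k h t : R :=
  ddens q (iota 0 6) exponents (wedge3 k t) (lengths k t) (cross3 k h t) (lengths h t).

Lemma menger_PhiE k t : menger_Phi k t =
  menger_den k t.1.1 t.1.2 t.2 `^ (- p) * (enorm (derive1 k t.1.1) *
    enorm (derive1 k t.1.2) * enorm (derive1 k t.2)).
Proof.
have H (A B C D E F : R) : 0 <= A -> 0 <= B -> 0 <= C -> 0 <= D -> 0 <= E -> 0 <= F ->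
    A `^ (- p) * (B `^ (- p) * (C `^ (- p) * (D `^ 1 * (E `^ 1 * (F `^ 1 * 1))))) =
    (A * B * C) `^ (- p) * (D * E * F).
  by move=> *; rewrite !powRr1// !powRM ?mulr_ge0// mulr1 !mulrA.
rewrite /menger_Phi /Phi !big_cons big_nil /exponents /=.
by apply: H; exact: enorm_ge0.
Qed.

Lemma intM_densityE k a b c : intM_density p q k a b c = menger_dens k (a, b, c).
Proof.
rewrite /menger_dens /dens -/(menger_Phi k (a, b, c)) menger_PhiE /= powRN.
rewrite /wedge3 enorm_bivec.
have H (w d A B C : R) : w / d * A * B * C = w * (d^-1 * (A * B * C)) by rewrite !mulrA.
exact: H.
Qed.

Lemma lengthsD g h t : C1_periodic g -> C1_periodic h ->
  lengths (g + h) t = lengths g t \+ lengths h t.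
Proof.
move=> cg ch; have D x : derive1 (g + h) x = derive1 g x + derive1 h x.
  by have := derive1_lin 1 x cg ch; rewrite !scale1r.
by apply/funext => -[|[|[|[|[|j]]]]] /=; rewrite ?D// !fctE opprD addrACA.
Qed.

Lemma lengthsZ (a : R) h t : C1_periodic h ->
  lengths (a *: h) t = (fun j => a *: lengths h t j).
Proof.
move=> ch; have D x : derive1 (a *: h) x = a *: derive1 h x by exact: derive1Z.
by apply/funext => -[|[|[|[|[|j]]]]] /=; rewrite ?D// !fctE scalerBr.
Qed.

Lemma incrementD g h x y : (g + h) x - (g + h) y = (g x - g y) + (h x - h y).
Proof. by rewrite !fctE opprD addrACA. Qed.

Lemma incrementZ a h x y : (a *: h) x - (a *: h) y = a *: (h x - h y).
Proof. by rewrite !fctE scalerBr. Qed.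

Lemma wedge3D g h t : wedge3 (g + h) t = wedge3 g t + cross3 g h t + wedge3 h t.
Proof.
have H (a b c d : 'rV[R]_n) : bivec (a + b) (c + d) =
    bivec a c + (bivec a d + bivec b c) + bivec b d.
  by rewrite bivecDl !bivecDr !addrA.
rewrite /wedge3 (incrementD g h t.1.2) (incrementD g h t.2); exact: H.
Qed.

Lemma cross3gg g t : cross3 g g t = 2 *: wedge3 g t.
Proof. by rewrite /cross3 /cross scaler_nat mulr2n. Qed.

Lemma cross3C f g t : cross3 f g t = cross3 g f t.
Proof. by rewrite /cross3 /cross addrC. Qed.

Lemma cross3Zr (a : R) f g t : cross3 f (a *: g) t = a *: cross3 f g t.
Proof.
rewrite /cross3 /cross (incrementZ a g t.1.2) (incrementZ a g t.2) bivecZl bivecZr.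
by rewrite scalerDr.
Qed.

Lemma cross3Zl (a : R) f g t : cross3 (a *: f) g t = a *: cross3 f g t.
Proof. by rewrite cross3C cross3Zr cross3C. Qed.

Lemma cross3Dr f g h t : cross3 f (g + h) t = cross3 f g t + cross3 f h t.
Proof.
have H (a b c d e k : 'rV[R]_n) : bivec a (c + d) + bivec (e + k) b =
    bivec a c + bivec e b + (bivec a d + bivec k b).
  by rewrite bivecDl bivecDr addrACA.
rewrite /cross3 /cross (incrementD g h t.1.2) (incrementD g h t.2); exact: H.
Qed.

Lemma cross3Dl f g h t : cross3 (f + g) h t = cross3 f h t + cross3 g h t.
Proof. by rewrite cross3C cross3Dr -!(cross3C h). Qed.

Lemma menger_ddens_lin k h1 h2 (a : R) t : C1_periodic h1 -> C1_periodic h2 ->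
  menger_ddens k (a *: h1 + h2) t = a * menger_ddens k h1 t + menger_ddens k h2 t.
Proof.
move=> c1 c2; have c1' := C1_periodicZ a c1.
rewrite /menger_ddens /ddens -/(menger_Phi k t) cross3Dr cross3Zr psiD psiZ.
rewrite lengthsD// lengthsZ//.
have -> : Lam (iota 0 6) exponents (lengths k t)
    ((fun j => a *: lengths h1 t j) \+ lengths h2 t) =
    a * Lam (iota 0 6) exponents (lengths k t) (lengths h1 t) +
    Lam (iota 0 6) exponents (lengths k t) (lengths h2 t).
  rewrite /Lam mulr_sumr -big_split/=; apply: eq_bigr => j _.
  rewrite psiD psiZ; move: (psi _ _ _) (psi _ _ _) => x y; ring.
by move: (menger_Phi k t) (Lam _ _ _ _) (Lam _ _ _ _) (psi _ _ _) (psi _ _ _) => *; ring.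
Qed.

Lemma measurable_lengths k : C1_periodic k ->
  forall j i, measurable_fun setT (fun t : T3 => lengths k t j 0 i).
Proof.
move=> ck; have p1 := @measurable_proj1 R; have p2 := @measurable_proj2 R.
have p3 := @measurable_proj3 R.
move=> [|[|[|[|[|j]]]]] i /=; do [exact: measurable_increment | exact: measurable_derive1].
Qed.

Lemma measurable_wedge3 k : C1_periodic k ->
  forall i, measurable_fun setT (fun t : T3 => wedge3 k t 0 i).
Proof.
move=> ck; have p1 := @measurable_proj1 R; have p2 := @measurable_proj2 R.
have p3 := @measurable_proj3 R.
by apply: measurable_bivec => i; exact: measurable_increment.
Qed.

Lemma measurable_menger_Phi k : C1_periodic k ->
  measurable_fun setT (menger_Phi k : T3 -> R).
Proof. by move=> ck; apply: measurable_Phi; exact: measurable_lengths. Qed.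

Lemma measurable_menger_dens k : C1_periodic k ->
  measurable_fun setT (menger_dens k : T3 -> R).
Proof.
move=> ck; apply: measurable_funM; last exact: measurable_menger_Phi.
by apply: measurable_powR_comp; apply: measurable_enorm; exact: measurable_wedge3.
Qed.

Lemma measurable_menger_ddens k h : C1_periodic k -> C1_periodic h ->
  measurable_fun setT (menger_ddens k h : T3 -> R).
Proof.
move=> ck ch; apply: measurable_funM; last exact: measurable_menger_Phi.
have mW := measurable_wedge3 ck.
apply: measurable_funD; apply: measurable_funM => //.
- by apply: measurable_psi => //; exact: measurable_cross.
- by apply: measurable_powR_comp; exact: measurable_enorm.
- by apply: measurable_Lam; exact: measurable_lengths.
Qed.

End CurveDensity.

Lemma powR_sum5_le (R : realType) (q a b c d e : R) : 0 < q ->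
  0 <= a -> 0 <= b -> 0 <= c -> 0 <= d -> 0 <= e ->
  (a + b + c + d + e) `^ q <=
    5 `^ q * (a `^ q + b `^ q + c `^ q + d `^ q + e `^ q).
Proof.
move=> q0 a0 b0 c0 d0 e0.
have := @powR_sum_le R _ (iota 0 5) q (nth 0 [:: a; b; c; d; e]) q0.
rewrite !big_cons !big_nil /= !addr0 !addrA; apply.
by move=> [|[|[|[|[|j]]]]] //=; rewrite nth_nil.
Qed.

(** * Integrable bounds for the increments of the integrand *)

Section FrechetEstimates.
Context {R : realType} {n : nat}.
Local Notation mu := (@lebesgue_measure R).
Local Notation T := (measurableTypeR R).
Local Notation T3 := (T * T * T)%type.
Local Notation mu3 := (mu \x mu \x mu)%E.
Implicit Types (f g h k u v w : R -> 'rV[R]_n) (t : R * R * R).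
Variables (p q al : R).
Hypotheses (q1 : 1 < q) (p0 : 0 < p) (pq : p < q + 1) (qp : q + 1 < 2 * p).
Hypotheses (alE : al = 3 * p - 2 * q - 1) (al0 : 0 < al).

Let q0 : 0 < q. Proof. by move: (q1) => q1'; lra. Qed.

Lemma W1s_ball_le h r r' : r <= r' -> W1s_ball q al h r -> W1s_ball q al h r'.
Proof.
move=> rr [ch hr hg]; have r0 : 0 <= r := le_trans (enorm_ge0 _) (hr 0).
split=> // [x|]; first exact: le_trans (hr x) rr.
by apply: le_trans hg _; rewrite lee_fin powR_le_mono ?(ltW q0).
Qed.

Lemma C1_periodicD g h : C1_periodic g -> C1_periodic h -> C1_periodic (g + h).
Proof. by move=> cg ch; have := C1_periodic_lin 1 cg ch; rewrite scale1r. Qed.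

(** u is the base curve, v its normalized perturbation and w the normalized direction. The five
    terms bound the bivector of u, its first and second variation along v, the polarization of u
    with w, and the change of that polarization when u moves along v. *)
Definition cross_sum u v w t : R :=
  enorm (cross3 u u t) + enorm (cross3 u v t) + enorm (cross3 v v t) +
  enorm (cross3 u w t) + enorm (cross3 v w t).

Lemma cross_sum_ge0 u v w t : 0 <= cross_sum u v w t.
Proof. by rewrite !addr_ge0 ?enorm_ge0. Qed.

Lemma cross_sum_ge u v w t (S := cross_sum u v w t) :
  [/\ enorm (cross3 u u t) <= S, enorm (cross3 v v t) <= S,
      enorm (cross3 u w t) <= S, enorm (cross3 v w t) <= S
    & enorm (cross3 u v t) + enorm (cross3 v v t) <= S].
Proof.
have H (a b c d e : R) : 0 <= a -> 0 <= b -> 0 <= c -> 0 <= d -> 0 <= e ->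
    [/\ a <= a + b + c + d + e, c <= a + b + c + d + e, d <= a + b + c + d + e,
        e <= a + b + c + d + e & b + c <= a + b + c + d + e].
  by move=> *; split; lra.
by apply: H; exact: enorm_ge0.
Qed.

Lemma measurable_cross_sum u v w : C1_periodic u -> C1_periodic v -> C1_periodic w ->
  measurable_fun setT (cross_sum u v w : T3 -> R).
Proof.
move=> cu cv cw.
have m f g : C1_periodic f -> C1_periodic g ->
    measurable_fun setT (fun t : T3 => enorm (cross3 f g t)).
  by move=> cf cg; apply: measurable_enorm; exact: measurable_cross.
apply: measurable_funD; last exact: m.
apply: measurable_funD; last exact: m.
apply: measurable_funD; last exact: m.
by apply: measurable_funD; exact: m.
Qed.

Definition cross_weight u v w g t : R := cross_sum u v w t `^ q * menger_Phi p g t.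

Lemma menger_Phi_ge0 g t : 0 <= menger_Phi p g t.
Proof. exact: Phi_ge0. Qed.

Lemma cross_weight_ge0 u v w g t : 0 <= cross_weight u v w g t.
Proof. by rewrite mulr_ge0 ?powR_ge0 ?menger_Phi_ge0. Qed.

Lemma measurable_cross_weight u v w g : C1_periodic u -> C1_periodic v ->
  C1_periodic w -> C1_periodic g -> measurable_fun setT (cross_weight u v w g : T3 -> R).
Proof.
move=> cu cv cw cg; apply: measurable_funM; last exact: measurable_menger_Phi.
by apply: measurable_powR_comp; exact: measurable_cross_sum.
Qed.

(** 5^q comes from the sum inside the power, rho^3 from the three velocities, and 5 from as many
    uses of the key estimate. *)
Definition weight_bound (c rho : R) : R :=
  5 `^ q * (rho ^+ 3 * (5 * (@key_const R n p q al c * (rho * rho) `^ q))).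

Lemma weight_bound_ge0 c rho : 0 <= rho -> 0 <= weight_bound c rho.
Proof.
move=> r0; have K0 := @key_const_ge0 R n p q al pq qp al0 c.
apply: mulr_ge0; first exact: powR_ge0.
apply: mulr_ge0; first exact: exprn_ge0.
by apply: mulr_ge0 => //; apply: mulr_ge0 => //; exact: powR_ge0.
Qed.

Lemma integral_cross_weight u v w g c rho : W1s_ball q al u rho ->
  W1s_ball q al v rho -> W1s_ball q al w rho -> W1s_ball q al g rho ->
  0 < c -> bilip c g ->
  (\int[mu3]_(t in torus3) (cross_weight u v w g t)%:E <= (weight_bound c rho)%:E)%E.
Proof.
move=> bu bv bw bg c0 big.
have [cu _ _] := bu; have [cv _ _] := bv; have [cw _ _] := bw; have [cg hg _] := bg.
have rho0 : 0 <= rho := le_trans (enorm_ge0 _) (hg 0).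
pose d f h t := (cross_density p q f h g t)%:E.
have d0 f h t : (0 <= d f h t)%E by rewrite lee_fin cross_density_ge0.
have key f h : W1s_ball q al f rho -> W1s_ball q al h rho ->
    (\int[mu3]_(t in torus3) d f h t <= (@key_const R n p q al c * (rho * rho) `^ q)%:E)%E.
  by move=> bf bh; exact: (key_estimate q1 (ltW p0) pq qp alE al0 bf bh cg c0 big).
have m f h : C1_periodic f -> C1_periodic h -> measurable_fun [set: T3] (d f h).
  by move=> cf ch; exact: measurable_cross_density.
have mt := @measurable_torus3 R.
have s1 := integral_plus_le mt (m u u cu cu) (m u v cu cv) (d0 _ _) (d0 _ _)
  (key u u bu bu) (key u v bu bv).
have m1 := emeasurable_funD (m u u cu cu) (m u v cu cv).
have n1 t := adde_ge0 (d0 u u t) (d0 u v t).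
have s2 := integral_plus_le mt m1 (m v v cv cv) n1 (d0 _ _) s1 (key v v bv bv).
have m2 := emeasurable_funD m1 (m v v cv cv).
have n2 t := adde_ge0 (n1 t) (d0 v v t).
have s3 := integral_plus_le mt m2 (m u w cu cw) n2 (d0 _ _) s2 (key u w bu bw).
have m3 := emeasurable_funD m2 (m u w cu cw).
have n3 t := adde_ge0 (n2 t) (d0 u w t).
have s4 := integral_plus_le mt m3 (m v w cv cw) n3 (d0 _ _) s3 (key v w bv bw).
have m4 := emeasurable_funD m3 (m v w cv cw).
have n4 t := adde_ge0 (n3 t) (d0 v w t).
have A0 : 0 <= 5 `^ q * rho ^+ 3 by rewrite mulr_ge0 ?powR_ge0 ?exprn_ge0.
have s5 := integral_escale_le mt m4 A0 n4 s4.
apply: le_trans (le_trans s5 _); last first.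
  rewrite lee_fin /weight_bound; move: (_ * (rho * rho) `^ q) (5 `^ q) (rho ^+ 3) => x y z.
  by rewrite le_eqVlt; apply/orP; left; apply/eqP; ring.
apply: integral_mono => t _; first by rewrite lee_fin cross_weight_ge0.
rewrite /d -!EFinD -EFinM lee_fin /cross_weight /cross_sum menger_PhiE /cross_density.
move: (menger_den_ge0 g t.1.1 t.1.2 t.2) => den0.
move: (powR_ge0 (menger_den g t.1.1 t.1.2 t.2) (- p)).
have D3 : enorm (derive1 g t.1.1) * enorm (derive1 g t.1.2) * enorm (derive1 g t.2) <= rho ^+ 3.
  by rewrite exprS expr2 mulrA !ler_pM ?mulr_ge0 ?enorm_ge0.
have D30 : 0 <= enorm (derive1 g t.1.1) * enorm (derive1 g t.1.2) * enorm (derive1 g t.2).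
  by rewrite !mulr_ge0 ?enorm_ge0.
move: D3 D30; move: (_ * enorm (derive1 g t.2)) (_ `^ (- p)) (rho ^+ 3) => x y z xz x0 y0.
have P := powR_sum5_le q0 (enorm_ge0 (cross3 u u t)) (enorm_ge0 (cross3 u v t))
  (enorm_ge0 (cross3 v v t)) (enorm_ge0 (cross3 u w t)) (enorm_ge0 (cross3 v w t)).
apply: le_trans (ler_pM (powR_ge0 _ _) (mulr_ge0 y0 x0) P (ler_wpM2l y0 xz)) _.
rewrite -!/(cross3 _ _ t).
move: (enorm (cross3 u u t) `^ q) (enorm (cross3 u v t) `^ q) (enorm (cross3 v v t) `^ q)
  (enorm (cross3 u w t) `^ q) (enorm (cross3 v w t) `^ q) (5 `^ q) => x1 x2 x3 x4 x5 x6.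
by rewrite le_eqVlt; apply/orP; left; apply/eqP; ring.
Qed.

Section BaseCurve.
Variables (g : R -> 'rV[R]_n) (c rho : R).
Hypotheses (c0 : 0 < c) (big : bilip c g) (gc : forall x, c <= enorm (derive1 g x)).
Hypotheses (bg : W1s_ball q al g rho) (crho : c <= rho).

Let cg : C1_periodic g. Proof. by case: bg. Qed.

(** The radius is written c r so that r is the relative size of the perturbation of every length:
    [increment_le] gives it for the sides, and |g'| >= c for the velocities. *)
Lemma lengths_le h r t j : W1s_ball q al h (c * r) ->
  enorm (lengths h t j) <= r * enorm (lengths g t j).
Proof.
move=> [ch hr _].
have I x y : enorm (h x - h y) <= r * enorm (g x - g y).
  have := increment_le x y c0 big cg ch hr.
  by rewrite (mulrC c) mulfK ?gt_eqF.
have D x : enorm (derive1 h x) <= r * enorm (derive1 g x).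
  apply: le_trans (hr x) _; rewrite mulrC ler_wpM2l//.
  have := le_trans (enorm_ge0 _) (hr 0); rewrite pmulr_rge0//.
by case: j => [|[|[|[|[|j]]]]] /=.
Qed.

(** [dens_frechet] does not apply where two points coincide on the circle, but the convention 0^(-
    p) = 0 makes all densities vanish there. *)
Lemma menger_Phi_eq0 h r t : W1s_ball q al h (c * r) ->
  (exists j, lengths g t j = 0) ->
  menger_Phi p g t = 0 /\ menger_Phi p (g + h) t = 0.
Proof.
move=> bh [j gj0]; have [ch _ _] := bh.
have hj0 : lengths h t j = 0.
  apply/eqP; rewrite -enorm_eq0 eq_le enorm_ge0 andbT.
  by apply: le_trans (lengths_le t j bh) _; rewrite gj0 enorm0 mulr0.
have ghj0 : lengths (g + h) t j = 0 by rewrite lengthsD//= gj0 hj0 addr0.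
have np : - p != 0 by rewrite oppr_eq0 gt_eqF.
have d0 x : derive1 g x <> 0.
  by move=> E; have := gc x; rewrite E enorm0 leNgt c0.
have E k : lengths k t j = 0 -> (j < 3)%N -> menger_Phi p k t = 0.
  rewrite menger_PhiE /menger_den; case: j {gj0 hj0 ghj0} => [|[|[|//]]] /= -> _;
    by rewrite enorm0 ?(mul0r, mulr0) powR0// mul0r.
have j3 : (j < 3)%N.
  by move: gj0; case: (j) => [|[|[|[|[|i]]]]] //= /d0.
by rewrite !E.
Qed.

(** By c <= rho the normalized direction lies in the ball of the base curve, so a single radius
    serves all curves in [integral_cross_weight]. *)
Lemma rescale h r : 0 < r -> W1s_ball q al h (c * r) ->
  exists h1, h = r *: h1 /\ W1s_ball q al h1 rho.
Proof.
move=> r0 bh; exists (r^-1 *: h); split.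
  by rewrite scalerA mulfV ?gt_eqF// scale1r.
have cr0 : 0 <= c * r by rewrite mulr_ge0 ?(ltW c0) ?(ltW r0).
have E : `|r^-1| * (c * r) = c.
  by rewrite gtr0_norm ?invr_gt0// mulrCA mulVf ?gt_eqF// mulr1.
by apply: W1s_ball_le (W1s_ballZ r^-1 cr0 bh); rewrite E.
Qed.

Let wedge_le v w t : enorm (wedge3 g t) <= cross_sum g v w t.
Proof.
have [+ _ _ _ _] := cross_sum_ge g v w t.
rewrite cross3gg enormZ (ger0_norm (ler0n R 2)); apply: le_trans.
by rewrite ler_peMl ?enorm_ge0// ler1n.
Qed.

Lemma menger_dens_le t : menger_dens p q g t <= cross_weight g g g g t.
Proof.
by rewrite ler_wpM2r ?menger_Phi_ge0// powR_le_mono ?enorm_ge0 ?(ltW q0).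
Qed.

Lemma menger_dens_eq0 k t : menger_Phi p k t = 0 -> menger_dens p q k t = 0.
Proof. by rewrite /menger_Phi /menger_dens /dens => ->; rewrite mulr0. Qed.

Lemma menger_ddens_eq0 k h t : menger_Phi p k t = 0 -> menger_ddens p q k h t = 0.
Proof. by rewrite /menger_Phi /menger_ddens /ddens => ->; rewrite mulr0. Qed.

Definition asum6 : R := asum (iota 0 6) (exponents p).

Lemma menger_ddens_le h h1 r t : 0 < r -> h = r *: h1 -> W1s_ball q al h (c * r) ->
  `|menger_ddens p q g h t| <= (q + asum6) * r * cross_weight g h1 h1 g t.
Proof.
move=> r0 hE bh; rewrite /cross_weight mulrA.
apply: ddens_le.
- exact: q1.
- exact: ltW.
- exact: cross_sum_ge0.
- exact: wedge_le.
- rewrite hE cross3Zr enormZ gtr0_norm// ler_wpM2l ?(ltW r0)//.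
  by case: (cross_sum_ge g h1 h1 t).
- by move=> j; exact: lengths_le.
Qed.

Lemma menger_dens_frechet e : 0 < e -> exists2 d, 0 < d & forall h h1 r t,
  0 < r -> r <= d -> h = r *: h1 -> W1s_ball q al h (c * r) ->
  `|menger_dens p q (g + h) t - menger_dens p q g t - menger_ddens p q g h t|
    <= e * r * cross_weight g h1 h1 g t.
Proof.
move=> e0; have [d d0 H] := @dens_frechet R (n * n) n nat q (iota 0 6) (exponents p) e q1 e0.
exists d => // h h1 r t r0 rd hE bh; have [ch _ _] := bh.
have [[j j0]|/forallNP nz] := pselect (exists j, lengths g t j = 0).
  have [P1 P2] := menger_Phi_eq0 bh (ex_intro _ j j0).
  rewrite (menger_dens_eq0 P1) (menger_dens_eq0 P2) (menger_ddens_eq0 h P1).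
  rewrite !subr0 normr0; apply: mulr_ge0; last exact: cross_weight_ge0.
  exact: mulr_ge0 (ltW e0) (ltW r0).
rewrite /cross_weight mulrA /menger_dens wedge3D lengthsD//.
apply: H.
- by rewrite (ltW r0) rd.
- exact: cross_sum_ge0.
- exact: wedge_le.
- rewrite hE cross3Zr enormZ gtr0_norm// ler_wpM2l ?(ltW r0)//.
  by case: (cross_sum_ge g h1 h1 t).
- have E : 2 *: wedge3 h t = r ^+ 2 *: cross3 h1 h1 t.
    by rewrite -cross3gg hE cross3Zl cross3Zr scalerA expr2.
  have : 2 * enorm (wedge3 h t) = r ^+ 2 * enorm (cross3 h1 h1 t).
    by have := congr1 enorm E; rewrite !enormZ !ger0_norm ?sqr_ge0.
  have [_ L _ _ _] := cross_sum_ge g h1 h1 t.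
  move=> E2; apply: le_trans (ler_wpM2l (sqr_ge0 r) L); rewrite -E2.
  by rewrite ler_peMl ?enorm_ge0// ler1n.
- by move=> j; apply/eqP; exact: nz.
- by move=> j; exact: lengths_le.
Qed.

Lemma menger_ddens_diff e : 0 < e -> exists2 d, 0 < d <= 1 & forall f f1 h h1 d' r t,
  0 < d' -> d' <= d -> f = d' *: f1 -> W1s_ball q al f (c * d') ->
  0 < r -> h = r *: h1 -> W1s_ball q al h (c * r) ->
  `|menger_ddens p q (g + f) h t - menger_ddens p q g h t|
    <= e * r * cross_weight g f1 h1 g t.
Proof.
move=> e0.
have [d d01 H] := @ddens_diff R (n * n) n nat q (iota 0 6) (exponents p) e q1 e0.
have /andP[d0 d1] := d01.
exists d => // f f1 h h1 d' r t d'0 d'd fE bf r0 hE bh; have [cf _ _] := bf.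
have d'1 := le_trans d'd d1.
rewrite /cross_weight mulrA /menger_ddens wedge3D lengthsD// cross3Dl -addrA.
have [_ _ L4 L5 L] := cross_sum_ge g f1 h1 t.
apply: (H d').
- by rewrite (ltW d'0) d'd.
- exact: ltW.
- exact: cross_sum_ge0.
- exact: wedge_le.
- have E : 2 *: wedge3 f t = d' ^+ 2 *: cross3 f1 f1 t.
    by rewrite -cross3gg fE cross3Zl cross3Zr scalerA expr2.
  have E2 : 2 * enorm (wedge3 f t) = d' ^+ 2 * enorm (cross3 f1 f1 t).
    by have := congr1 enorm E; rewrite !enormZ !ger0_norm ?sqr_ge0.
  apply: le_trans (enormD _ _) _.
  have -> : enorm (cross3 g f t) = d' * enorm (cross3 g f1 t).
    by rewrite fE cross3Zr enormZ gtr0_norm.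
  have E3 : d' ^+ 2 * enorm (cross3 f1 f1 t) <= d' * enorm (cross3 f1 f1 t).
    by rewrite ler_wpM2r ?enorm_ge0// expr2 ler_piMr// (ltW d'0).
  have E4 : enorm (wedge3 f t) <= d' * enorm (cross3 f1 f1 t).
    by apply: le_trans E3; rewrite -E2 ler_peMl ?enorm_ge0// ler1n.
  by apply: le_trans (ler_wpM2l (ltW d'0) L); rewrite mulrDr lerD.
- by rewrite hE cross3Zr enormZ gtr0_norm// ler_wpM2l ?(ltW r0).
- rewrite hE fE cross3Zl cross3Zr !enormZ !gtr0_norm// mulrA.
  by rewrite ler_wpM2l ?mulr_ge0 ?(ltW d'0) ?(ltW r0).
- by move=> j; exact: lengths_le.
- by move=> j; exact: lengths_le.
Qed.

End BaseCurve.
End FrechetEstimates.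

Lemma fine_integralB d (T : measurableType d) (R : realType) (m : {measure set T -> \bar R})
    (D : set T) (F G : T -> R) : measurable D ->
  m.-integrable D (fun t => (F t)%:E) -> m.-integrable D (fun t => (G t)%:E) ->
  m.-integrable D (fun t => (F t - G t)%:E) /\
  fine (\int[m]_(t in D) (F t - G t)%:E) =
    fine (\int[m]_(t in D) (F t)%:E) - fine (\int[m]_(t in D) (G t)%:E).
Proof.
move=> mD iF iG; have := fine_integral_lin mD (-1) iG iF.
have -> : (fun t => (-1 * G t + F t)%:E) = (fun t => (F t - G t)%:E).
  by apply/funext => t; rewrite mulN1r addrC.
by rewrite mulN1r [in X in _ = X]addrC.
Qed.

(** The integrability of F is recovered from that of the remainder. It is applied with F the density
    of the perturbed curve, whose chord-arc constant thus never has to be estimated. *)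
Lemma fine_integral_remainder d (T : measurableType d) (R : realType)
    (m : {measure set T -> \bar R}) (D : set T) (F G H : T -> R) : measurable D ->
  m.-integrable D (fun t => (F t - G t - H t)%:E) ->
  m.-integrable D (fun t => (G t)%:E) -> m.-integrable D (fun t => (H t)%:E) ->
  fine (\int[m]_(t in D) (F t)%:E) - fine (\int[m]_(t in D) (G t)%:E) -
  fine (\int[m]_(t in D) (H t)%:E) = fine (\int[m]_(t in D) (F t - G t - H t)%:E).
Proof.
move=> mD iR iG iH; have [igh Egh] := fine_integral_lin mD 1 iG iH.
have [_ Er] := fine_integral_lin mD 1 iR igh.
have E : (fun t => (1 * (F t - G t - H t) + (1 * G t + H t))%:E) = (fun t => (F t)%:E).
  by apply/funext => t; congr _%:E; ring.
rewrite E in Er; rewrite Er Egh; ring.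
Qed.

(** The estimates are available for balls of positive radius; a direction of norm nu = 0 is reached
    by shrinking the radius. *)
Lemma le_of_le_near (R : realType) (K x nu d : R) : 0 <= nu -> nu <= d -> 0 < d -> 0 <= K ->
  (forall rho, 0 < rho -> nu <= rho -> rho <= d -> x <= K * rho) -> x <= K * nu.
Proof.
move=> nu0 nud d0 K0 H; have [nu1|nu1] := ltP 0 nu; first exact: H.
have {nu0 nu1} nu00 : nu = 0 by apply/eqP; rewrite eq_le nu0 nu1.
rewrite nu00 mulr0 leNgt; apply/negP => x0.
have K1 : 0 < K + 1 by rewrite ltr_wpDl.
(* Small enough that K rho < x. *)
pose rho := Num.min d (x / (2 * (K + 1))).
have r0 : 0 < rho by rewrite lt_min d0 divr_gt0// mulr_gt0.
have := H rho r0; rewrite nu00 (ltW r0) ge_min lexx => /(_ isT isT).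
have : rho <= x / (2 * (K + 1)) by rewrite ge_min lexx orbT.
rewrite ler_pdivlMr ?mulr_gt0// => h1 h2.
have := mulr_ge0 K0 (ltW r0); move: h1 h2 r0; move: (K * rho) (rho) => a b.
by move=> *; nra.
Qed.

Section MengerVariation.
Context {R : realType} {n : nat}.
Local Notation mu := (@lebesgue_measure R).
Local Notation T := (measurableTypeR R).
Local Notation T3 := (T * T * T)%type.
Local Notation mu3 := (mu \x mu \x mu)%E.
Implicit Types (f g h k u v w : R -> 'rV[R]_n) (t : R * R * R).
Variables (p q al : R).
Hypotheses (q1 : 1 < q) (p0 : 0 < p) (pq : p < q + 1) (qp : q + 1 < 2 * p).
Hypotheses (alE : al = 3 * p - 2 * q - 1) (al0 : 0 < al).

Definition menger_variation k h : R := fine (\int[mu3]_(t in torus3) (menger_ddens p q k h t)%:E).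

Lemma intME k : intM p q k = (\int[mu3]_(t in torus3) (menger_dens p q k t)%:E)%E.
Proof.
rewrite /intM /integral3; apply: eq_integral => -[[a b] c] _ /=.
by rewrite intM_densityE.
Qed.

Let mt : measurable (torus3 : set T3). Proof. exact: measurable_torus3. Qed.

Section BaseCurve.
Variables (g : R -> 'rV[R]_n) (c rho : R).
Hypotheses (c0 : 0 < c) (big : bilip c g) (gc : forall x, c <= enorm (derive1 g x)).
Hypotheses (bg : W1s_ball q al g rho) (crho : c <= rho).

Let cg : C1_periodic g. Proof. by case: bg. Qed.
Let rho0 : 0 <= rho. Proof. exact: le_trans (ltW c0) crho. Qed.
Local Notation M := (@weight_bound R n p q al c rho).

Let cw u v w t := @cross_weight_ge0 R n p q u v w g t.

Lemma menger_dens_integrable : mu3.-integrable torus3 (fun t => (menger_dens p q g t)%:E).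
Proof.
have mW := measurable_cross_weight p q cg cg cg cg.
have IW := integral_cross_weight q1 p0 pq qp alE al0 bg bg bg bg c0 big.
have D t : `|menger_dens p q g t| <= 1 * cross_weight p q g g g g t.
  rewrite mul1r ger0_norm; first exact: menger_dens_le.
  by rewrite mulr_ge0 ?powR_ge0 ?menger_Phi_ge0.
by have [] := integrable_dominated mt (measurable_menger_dens p q cg) mW ler01 D (cw _ _ _) IW.
Qed.

Lemma menger_variation_le h r : 0 < r -> W1s_ball q al h (c * r) ->
  mu3.-integrable torus3 (fun t => (menger_ddens p q g h t)%:E) /\
  `|menger_variation g h| <= (q + asum6 p) * r * M.
Proof.
move=> r0 bh; have [ch _ _] := bh; have [h1 [hE b1]] := rescale q1 c0 crho r0 bh.
have [c1 _ _] := b1.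
have mW := measurable_cross_weight p q cg c1 c1 cg.
have IW := integral_cross_weight q1 p0 pq qp alE al0 bg b1 b1 bg c0 big.
have A0 : 0 <= (q + asum6 p) * r.
  by rewrite mulr_ge0 ?(ltW r0)// addr_ge0 ?asum_ge0// ltW// (lt_trans ltr01 q1).
have D t := menger_ddens_le p q1 c0 big gc bg t r0 hE bh.
exact: (integrable_dominated mt (measurable_menger_ddens p q cg ch) mW A0 D (cw _ _ _) IW).
Qed.

Lemma intM_frechet e : 0 < e -> exists2 d, 0 < d & forall h r,
  0 < r -> r <= d -> W1s_ball q al h (c * r) ->
  `|intMr p q (g + h) - intMr p q g - menger_variation g h| <= e * r * M.
Proof.
move=> e0; have [d d0 H] := menger_dens_frechet q1 p0 c0 big gc bg e0.
exists d => // h r r0 rd bh; have [ch _ _] := bh.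
have [h1 [hE b1]] := rescale q1 c0 crho r0 bh; have [c1 _ _] := b1.
have mW := measurable_cross_weight p q cg c1 c1 cg.
have IW := integral_cross_weight q1 p0 pq qp alE al0 bg b1 b1 bg c0 big.
have cgh := C1_periodicD cg ch.
have mD : measurable_fun setT (fun t : T3 =>
    menger_dens p q (g + h) t - menger_dens p q g t - menger_ddens p q g h t).
  apply: measurable_funB; last exact: measurable_menger_ddens.
  by apply: measurable_funB; exact: measurable_menger_dens.
have A0 : 0 <= e * r by rewrite mulr_ge0 ?(ltW e0) ?(ltW r0).
have D t := H h h1 r t r0 rd hE bh.
have [iD +] := integrable_dominated mt mD mW A0 D (cw _ _ _) IW.
have ig := menger_dens_integrable; have [iv _] := menger_variation_le r0 bh.
have E := fine_integral_remainder mt iD ig iv.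
by rewrite /intMr !intME -E.
Qed.

Lemma menger_variation_continuous e : 0 < e -> exists2 d, 0 < d & forall f h r,
  W1s_ball q al f (c * d) -> 0 < r -> W1s_ball q al h (c * r) ->
  mu3.-integrable torus3 (fun t => (menger_ddens p q (g + f) h t)%:E) ->
  `|menger_variation (g + f) h - menger_variation g h| <= e * r * M.
Proof.
move=> e0; have [d /andP[d0 d1] H] := menger_ddens_diff p q1 c0 big gc bg e0.
exists d => // f h r bf r0 bh ik; have [ch _ _] := bh; have [cf _ _] := bf.
have [h1 [hE b1]] := rescale q1 c0 crho r0 bh; have [c1 _ _] := b1.
have [f1 [fE b2]] := rescale q1 c0 crho d0 bf; have [c2 _ _] := b2.
have mW := measurable_cross_weight p q cg c2 c1 cg.
have IW := integral_cross_weight q1 p0 pq qp alE al0 bg b2 b1 bg c0 big.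
have cgf := C1_periodicD cg cf.
have mD : measurable_fun setT (fun t : T3 =>
    menger_ddens p q (g + f) h t - menger_ddens p q g h t).
  by apply: measurable_funB; exact: measurable_menger_ddens.
have A0 : 0 <= e * r by rewrite mulr_ge0 ?(ltW e0) ?(ltW r0).
have D t := H f f1 h h1 d r t d0 (lexx d) fE bf r0 hE bh.
have [iD +] := integrable_dominated mt mD mW A0 D (cw _ _ _) IW.
have [iv _] := menger_variation_le r0 bh.
by have [_ ->] := fine_integralB mt ik iv.
Qed.

End BaseCurve.

Lemma menger_variation_lin k h1 h2 (a : R) : C1_periodic h1 -> C1_periodic h2 ->
  mu3.-integrable torus3 (fun t => (menger_ddens p q k h1 t)%:E) ->
  mu3.-integrable torus3 (fun t => (menger_ddens p q k h2 t)%:E) ->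
  menger_variation k (a *: h1 + h2) = a * menger_variation k h1 + menger_variation k h2.
Proof.
move=> c1 c2 i1 i2; rewrite /menger_variation -(fine_integral_lin mt a i1 i2).2.
by congr fine; apply: eq_integral => t _; rewrite menger_ddens_lin.
Qed.

End MengerVariation.

Lemma quotient_le (R : realType) (e r m tau x y v : R) :
  0 <= e -> 0 < r * m + 1 -> tau != 0 ->
  `|x - y - tau * v| <= e / (r * m + 1) * (`|tau| * r) * m -> `|v - tau^-1 * (x - y)| <= e.
Proof.
move=> e0 M1 t0 K; have t0' : 0 < `|tau| by rewrite normr_gt0.
rewrite -(ler_pM2l t0') -normrM mulrBr mulrA mulfV// mul1r distrC.
apply: le_trans K _.
have -> : e / (r * m + 1) * (`|tau| * r) * m = `|tau| * (e / (r * m + 1) * (r * m)) by ring.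
rewrite ler_wpM2l//; move: (r * m) M1 => z z1.
by rewrite -mulrA ler_piMr// mulrC ler_pdivrMr// mul1r lerDl.
Qed.

(** * Continuous differentiability in the Sobolev norm *)

Section ContinuousDifferentiability.
Context {R : realType} {n : nat}.
Local Notation mu := (@lebesgue_measure R).
Local Notation mu3 := (mu \x mu \x mu)%E.
Implicit Types (f g h k : R -> 'rV[R]_n).
Variables (p q : R).
Hypotheses (q_gt1 : 1 < q) (p_gt : 2 / 3 * q + 1 < p) (p_lt : p < q + 2 / 3).

Definition sobolev_order : R := (3 * p - 2) / q - 2.
Local Notation s := sobolev_order.
Local Notation al := (1 + q * s).
Local Notation N := (W1s_norm s q).

Let q0 : 0 < q. Proof. by move: (q_gt1) => q1'; lra. Qed.
Let p0 : 0 < p. Proof. by move: (q_gt1) (p_gt) => q1' p1'; lra. Qed.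
Let pq : p < q + 1. Proof. by move: (p_lt) => h; lra. Qed.
Let qp : q + 1 < 2 * p. Proof. by move: (q_gt1) (p_gt) => q1' p1'; lra. Qed.
Let alE : al = 3 * p - 2 * q - 1.
Proof.
have -> : q * s = 3 * p - 2 - 2 * q by rewrite /sobolev_order mulrBr mulrCA mulfV ?gt_eqF//; ring.
by ring.
Qed.
Let qs : 1 < q * s.
Proof. have := alE; move: (q_gt1) (p_gt) => q1' p1'; lra. Qed.
Let al0 : 0 < al. Proof. by move: (qs) => h; lra. Qed.

Local Notation kappa := (@embedding_const R n q s).
Let kappa0 : 0 < kappa. Proof. exact: embedding_const_gt0. Qed.

Lemma W1s_C1_periodic h : W1s s q h -> C1_periodic h.
Proof. exact: C1_periodic_of_W1s. Qed.

Lemma W1s_norm_ge0 h : (0 <= N h)%E.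
Proof. by rewrite !adde_ge0// poweR_ge0. Qed.

Lemma seminorm_le_norm h : (slobodeckij_seminorm s q h <= N h)%E.
Proof. by rewrite leeDr// adde_ge0// poweR_ge0. Qed.

Lemma W1s_ball_of_norm h r : C1_periodic h -> 0 <= r -> (N h <= r%:E)%E ->
  W1s_ball q al h (kappa * r).
Proof.
move=> ch r0 hr; apply: W1s_ball_of_seminorm => //.
exact: le_trans (seminorm_le_norm h) hr.
Qed.

Lemma W1s_norm_fin h : W1s s q h -> exists2 nu, 0 <= nu & N h = nu%:E.
Proof.
move=> [_ hoo]; have h0 := W1s_norm_ge0 h.
by exists (fine (N h)); [exact: fine_ge0|rewrite fineK// ge0_fin_numE].
Qed.

Lemma base_curve g : W1s s q g -> regular g -> embedded g -> exists c rho,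
  [/\ 0 < c, bilip c g, forall x, c <= enorm (derive1 g x), W1s_ball q al g rho & c <= rho].
Proof.
move=> Xg rg eg; have cg := W1s_C1_periodic Xg.
have [c [c0 big gc]] := regular_embedded_bilip cg rg eg.
have [nu nu0 NE] := W1s_norm_fin Xg.
have bg : W1s_ball q al g (kappa * nu) by apply: W1s_ball_of_norm => //; rewrite NE.
exists c, (kappa * nu); split => //.
by case: bg => _ hg _; exact: le_trans (gc 0) (hg 0).
Qed.

Lemma intM_fin_num g : W1s s q g -> regular g -> embedded g -> intM p q g \is a fin_num.
Proof.
move=> Xg rg eg; have [c [rho [c0 big gc bg crho]]] := base_curve Xg rg eg.
rewrite intME; apply: integrable_fin_num; first exact: measurable_torus3.
exact: (menger_dens_integrable q_gt1 p0 pq qp alE al0 c0 big bg).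
Qed.

Section BaseCurve.
Variables (g : R -> 'rV[R]_n) (c rho : R).
Hypotheses (c0 : 0 < c) (big : bilip c g) (gc : forall x, c <= enorm (derive1 g x)).
Hypotheses (bg : W1s_ball q al g rho) (crho : c <= rho).
Local Notation M := (@weight_bound R n p q al c rho).

Let M0 : 0 <= M.
Proof. by apply: weight_bound_ge0 => //; exact: le_trans (ltW c0) crho. Qed.

Lemma ball_rescaled h r : C1_periodic h -> 0 <= r -> (N h <= r%:E)%E ->
  W1s_ball q al h (c * (kappa * r / c)).
Proof.
move=> ch r0 hr; rewrite (mulrC c) divfK ?gt_eqF//; exact: W1s_ball_of_norm.
Qed.

Lemma menger_variation_integrable h : W1s s q h ->
  mu3.-integrable torus3 (fun t => (menger_ddens p q g h t)%:E).
Proof.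
move=> Xh; have [nu nu0 NE] := W1s_norm_fin Xh; have ch := W1s_C1_periodic Xh.
have r0 : 0 < kappa * (nu + 1) / c by rewrite divr_gt0// mulr_gt0// ltr_wpDl.
have nu1 : (N h <= (nu + 1)%:E)%E by rewrite NE lee_fin lerDl.
have bh := ball_rescaled ch (addr_ge0 nu0 ler01) nu1.
by have [] := menger_variation_le q_gt1 p0 pq qp alE al0 c0 big gc bg crho r0 bh.
Qed.

Lemma menger_variation_bounded : exists B : R, forall h, W1s s q h ->
  (`|menger_variation p q g h|%:E <= B%:E * N h)%E.
Proof.
have A0 : 0 <= q + asum6 p by rewrite addr_ge0 ?asum_ge0 ?(ltW q0).
pose B := (q + asum6 p) * (kappa / c) * M.
have B0 : 0 <= B := mulr_ge0 (mulr_ge0 A0 (divr_ge0 (ltW kappa0) (ltW c0))) M0.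
exists B => h Xh; have [nu nu0 NE] := W1s_norm_fin Xh; have ch := W1s_C1_periodic Xh.
rewrite NE -EFinM lee_fin; apply: (@le_of_le_near _ _ _ nu (nu + 1)) => //.
- by rewrite lerDl.
- by rewrite ltr_wpDl.
move=> r r0 nur _; have hr : (N h <= r%:E)%E by rewrite NE lee_fin.
have r0' : 0 < kappa * r / c by rewrite divr_gt0// mulr_gt0.
have bh := ball_rescaled ch (ltW r0) hr.
have [_ H] := menger_variation_le q_gt1 p0 pq qp alE al0 c0 big gc bg crho r0' bh.
apply: le_trans H _; rewrite /B le_eqVlt; apply/orP; left; apply/eqP.
by move: M (q + asum6 p) kappa c^-1 => a b x y; ring.
Qed.

Lemma small_factor e : 0 < e -> exists2 e', 0 < e' &
  forall r, 0 <= r -> e' * (kappa * r / c) * M <= e * r.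
Proof.
move=> e0; pose K := kappa / c * M.
have K0 : 0 <= K := mulr_ge0 (divr_ge0 (ltW kappa0) (ltW c0)) M0.
have K1 : 0 < K + 1 by rewrite ltr_wpDl.
exists (e / (K + 1)) => [|r r0]; first by rewrite divr_gt0.
have -> : e / (K + 1) * (kappa * r / c) * M = e / (K + 1) * K * r.
  by rewrite /K; move: M kappa c^-1 (e / (_ + 1)) => a b x y; ring.
by rewrite ler_wpM2r// -mulrA ler_piMr ?(ltW e0)// mulrC ler_pdivrMr// mul1r lerDl.
Qed.

Lemma intMr_frechet e : 0 < e -> exists2 d, 0 < d & forall h, W1s s q h ->
  (N h <= d%:E)%E ->
  (`|intMr p q (g + h)%R - intMr p q g - menger_variation p q g h|%:E <= e%:E * N h)%E.
Proof.
move=> e0; have [e' e'0 E'] := small_factor e0.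
have [d d0 H] := intM_frechet q_gt1 p0 pq qp alE al0 c0 big gc bg crho e'0.
have d'0 : 0 < c * d / kappa by rewrite divr_gt0// mulr_gt0.
exists (c * d / kappa) => // h Xh.
have [nu nu0 NE] := W1s_norm_fin Xh; have ch := W1s_C1_periodic Xh.
rewrite NE -EFinM !lee_fin => nud; apply: (le_of_le_near nu0 nud d'0 (ltW e0)).
move=> r r0 nur rd; have hr : (N h <= r%:E)%E by rewrite NE lee_fin.
have r0' : 0 < kappa * r / c by rewrite divr_gt0// mulr_gt0.
have rd' : kappa * r / c <= d.
  by rewrite ler_pdivrMr// mulrC -ler_pdivlMr// (mulrC d).
exact: le_trans (H h _ r0' rd' (ball_rescaled ch (ltW r0) hr)) (E' r (ltW r0)).
Qed.

Lemma menger_variation_cont e : 0 < e -> exists2 d, 0 < d & forall k, W1s s q k ->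
  regular k -> embedded k -> (N (k - g)%R <= d%:E)%E ->
  (forall h, W1s s q h -> mu3.-integrable torus3 (fun t => (menger_ddens p q k h t)%:E)) ->
  forall h, W1s s q h -> (`|menger_variation p q k h - menger_variation p q g h|%:E <= e%:E * N h)%E.
Proof.
move=> e0; have [e' e'0 E'] := small_factor e0.
have [d d0 H] := menger_variation_continuous q_gt1 p0 pq qp alE al0 c0 big gc bg crho e'0.
have d'0 : 0 < c * d / kappa by rewrite divr_gt0// mulr_gt0.
exists (c * d / kappa) => // k Xk _ _ kd ik h Xh.
have [nu nu0 NE] := W1s_norm_fin Xh; have ch := W1s_C1_periodic Xh.
have ck := W1s_C1_periodic Xk; have [cg _ _] := bg.
have kg : k = g + (k - g) by rewrite addrC subrK.
have ckg : C1_periodic (k - g).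
  by have := C1_periodic_lin (-1) ck cg; rewrite scaleN1r.
have bf := ball_rescaled ckg (ltW d'0) kd.
have dE : kappa * (c * d / kappa) / c = d by field; rewrite !gt_eqF.
rewrite dE in bf.
rewrite NE -EFinM lee_fin; apply: (@le_of_le_near _ _ _ nu (nu + 1)) => //.
- by rewrite lerDl.
- by rewrite ltr_wpDl.
- exact: ltW.
move=> r r0 nur _; have hr : (N h <= r%:E)%E by rewrite NE lee_fin.
have r0' : 0 < kappa * r / c by rewrite divr_gt0// mulr_gt0.
have ikh := ik h Xh; rewrite kg in ikh.
have := H _ h _ bf r0' (ball_rescaled ch (ltW r0) hr) ikh.
by rewrite -kg => /le_trans; apply; apply: E'; exact: ltW.
Qed.

Lemma intMr_derivable h : W1s s q h ->
  is_derive (0 : R) 1 (fun tau : R => intMr p q (g + tau *: h)) (menger_variation p q g h).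
Proof.
move=> Xh; have [nu nu0 NE] := W1s_norm_fin Xh; have ch := W1s_C1_periodic Xh.
pose r := kappa * (nu + 1) / c.
have r0 : 0 < r by rewrite divr_gt0// mulr_gt0// ltr_wpDl.
have nu1 : (N h <= (nu + 1)%:E)%E by rewrite NE lee_fin lerDl.
have bh : W1s_ball q al h (c * r) := ball_rescaled ch (addr_ge0 nu0 ler01) nu1.
clearbody r.
have ih := menger_variation_integrable Xh.
(* [menger_variation_lin] speaks of a h1 + h2; homogeneity is its case h2 = 0, for which
   integrability in the direction 0 is required. *)
have Z : W1s_ball q al (0 : R -> 'rV[R]_n) (c * r).
  have := W1s_ballZ 0 (ltW (mulr_gt0 c0 r0)) bh; rewrite scale0r normr0 mul0r.
  by apply: W1s_ball_le => //; rewrite mulr_ge0 ?(ltW c0) ?(ltW r0).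
have [iz _] := menger_variation_le q_gt1 p0 pq qp alE al0 c0 big gc bg crho r0 Z.
have vz : menger_variation p q g 0 = 0.
  have := menger_variation_lin (-1) C1_periodic0 C1_periodic0 iz iz.
  by rewrite scaler0 addr0 mulN1r addNr.
have vZ a : menger_variation p q g (a *: h) = a * menger_variation p q g h.
  by have := menger_variation_lin a ch C1_periodic0 ih iz; rewrite vz !addr0.
pose F (tau : R) := intMr p q (g + tau *: h).
have F0 : F 0 = intMr p q g by rewrite /F scale0r addr0.
suff cF : (fun tau => tau^-1 *: (F (tau *: 1 + 0) - F 0)) @ 0^' --> menger_variation p q g h.
  by apply: DeriveDef; [apply/cvg_ex; exists (menger_variation p q g h)|exact: cvg_lim].
apply/cvgrPdist_le => e e0.
have M1 : 0 < r * M + 1 := ltr_wpDl (mulr_ge0 (ltW r0) M0) ltr01.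
have e'0 : 0 < e / (r * M + 1) by rewrite divr_gt0.
have [d d0 H] := intM_frechet q_gt1 p0 pq qp alE al0 c0 big gc bg crho e'0.
set m := M in H M1 e'0; clearbody m.
have dr0 : 0 < d / r by rewrite divr_gt0.
near=> tau.
have t0 : tau != 0 by near: tau; exact: nbhs_dnbhs_neq.
have td0 : `|tau| <= d / r by near: tau; exact: dnbhs0_le.
have t0' : 0 < `|tau| by rewrite normr_gt0.
have td : `|tau| * r <= d by rewrite -ler_pdivlMr.
have bth : W1s_ball q al (tau *: h) (c * (`|tau| * r)).
  by rewrite mulrCA; exact: W1s_ballZ (ltW (mulr_gt0 c0 r0)) bh.
have := H _ _ (mulr_gt0 t0' r0) td bth; rewrite vZ.
rewrite F0 /F addr0 /GRing.scale /= mulr1.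
move: (intMr _ _ _) (intMr _ _ _) (menger_variation _ _ _ _) => x y v.
exact: (quotient_le (ltW e0) M1 t0).
Unshelve. all: by end_near.
Qed.

End BaseCurve.

Theorem intMr_C1 : C1_on (W1s s q) N
  [set gamma : R -> 'rV[R]_n | [/\ W1s s q gamma, regular gamma & embedded gamma]]
  (intMr p q).
Proof.
exists (menger_variation p q); split.
- move=> g [Xg rg eg] a h k Xh Xk.
  have [c [rho [c0 big gc bg crho]]] := base_curve Xg rg eg.
  have ih := menger_variation_integrable c0 big gc bg crho Xh.
  have ik := menger_variation_integrable c0 big gc bg crho Xk.
  exact: (menger_variation_lin a (W1s_C1_periodic Xh) (W1s_C1_periodic Xk) ih ik).
- move=> g [Xg rg eg]; have [c [rho [c0 big gc bg crho]]] := base_curve Xg rg eg.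
  exact: (menger_variation_bounded c0 big gc bg crho).
- move=> g [Xg rg eg] e e0; have [c [rho [c0 big gc bg crho]]] := base_curve Xg rg eg.
  exact: (intMr_frechet c0 big gc bg crho e0).
- move=> g [Xg rg eg] e e0; have [c [rho [c0 big gc bg crho]]] := base_curve Xg rg eg.
  have [d d0 H] := menger_variation_cont c0 big gc bg crho e0.
  exists d => // k [Xk rk ek] kd h Xh; apply: H => // h' Xh'.
  have [c' [rho' [c'0 bik gc' bk crho']]] := base_curve Xk rk ek.
  exact: (menger_variation_integrable c'0 bik gc' bk crho' Xh').
Qed.

End ContinuousDifferentiability.

(** * The principal value *)

Section SignedTransfer.
Context {R : realType}.
Local Notation mu := (@lebesgue_measure R).
Local Notation T := (measurableTypeR R).
Local Notation T3 := (T * T * T)%type.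
Local Notation mu3 := (mu \x mu \x mu)%E.
Local Notation I := (`[0%R, 1%R]%classic : set T).
Implicit Types (F : R * R * R -> \bar R) (t : R * R * R).

(** From nonnegative to signed integrands through positive and negative parts; P is a property
    inherited by both parts, such as periodicity. *)
Let signed (P : (T3 -> \bar R) -> Prop) (sigma : T3 -> T3) :
  (forall F, measurable_fun setT F -> (forall t, 0 <= F t)%E -> P F ->
    (\int[mu3]_(t in torus3) F (sigma t) = \int[mu3]_(t in torus3) F t)%E) ->
  (forall F, P F -> P (F^\+)%E /\ P (F^\-)%E) ->
  forall F, measurable_fun setT F -> P F ->
  (\int[mu3]_(t in torus3) F (sigma t) = \int[mu3]_(t in torus3) F t)%E.
Proof.
move=> H HP F mF PF; have [Pp Pn] := HP F PF.
rewrite [LHS]integralE [RHS]integralE; congr (_ - _)%E.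
  rewrite -(H _ (measurable_funepos mF) (funepos_ge0 F) Pp).
  by apply: eq_integral => t _; rewrite !funeposE.
rewrite -(H _ (measurable_funeneg mF) (funeneg_ge0 F) Pn).
by apply: eq_integral => t _; rewrite !funenegE.
Qed.

Lemma integral_torus3_swap23 F : measurable_fun [set: T3] F ->
  (\int[mu3]_(t in torus3) F (t.1.1, t.2, t.1.2) = \int[mu3]_(t in torus3) F t)%E.
Proof.
move=> mF; apply: (@signed (fun=> True) (fun t => (t.1.1, t.2, t.1.2))) => //.
by move=> G mG G0 _; exact: integral_cube23.
Qed.

Lemma integral_torus3_swap12 F : measurable_fun [set: T3] F ->
  (\int[mu3]_(t in torus3) F (t.1.2, t.1.1, t.2) = \int[mu3]_(t in torus3) F t)%E.
Proof.
move=> mF; apply: (@signed (fun=> True) (fun t => (t.1.2, t.1.1, t.2))) => //.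
by move=> G mG G0 _; exact: integral_cube12.
Qed.

Lemma integral_torus3_rotate F : measurable_fun [set: T3] F ->
  (\int[mu3]_(t in torus3) F (t.2, t.1.1, t.1.2) = \int[mu3]_(t in torus3) F t)%E.
Proof.
move=> mF; rewrite -[RHS](integral_torus3_swap12 mF).
have mG : measurable_fun [set: T3] (fun t => F (t.1.2, t.1.1, t.2)).
  apply: (measurableT_comp mF); apply: measurable_triple.
  - exact: measurable_proj2.
  - exact: measurable_proj1.
  - exact: measurable_proj3.
exact: (integral_torus3_swap23 mG).
Qed.

(** For a fixed first coordinate the shear is a translation of each of the other two, which
    periodicity absorbs. *)
Lemma integral_torus3_shift F : measurable_fun [set: T3] F ->
  (forall a b c, F (a, b + 1, c) = F (a, b, c)) ->
  (forall a b c, F (a, b, c + 1) = F (a, b, c)) ->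
  (\int[mu3]_(t in torus3) F (t.1.1, (t.1.1 + t.1.2)%R, (t.1.1 + t.2)%R) =
   \int[mu3]_(t in torus3) F t)%E.
Proof.
move=> mF p1 p2.
pose P (G : T3 -> \bar R) := (forall a b c, G (a, b + 1, c) = G (a, b, c)) /\
  (forall a b c, G (a, b, c + 1) = G (a, b, c)).
apply: (@signed P (fun t => (t.1.1, t.1.1 + t.1.2, t.1.1 + t.2))) => //; last first.
  by move=> G [g1 g2]; split; split=> a b c; rewrite ?funeposE ?funenegE ?g1 ?g2.
move=> G mG G0 [g1 g2].
have mG' : measurable_fun [set: T3] (fun t => G (t.1.1, t.1.1 + t.1.2, t.1.1 + t.2)).
  have m1 := @measurable_proj1 R; have m2 := @measurable_proj2 R.
  have m3 := @measurable_proj3 R.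
  by apply: (measurableT_comp mG); apply: measurable_triple => //; exact: measurable_funD.
apply: etrans (integral_cube mG' (fun t => G0 _)) _.
apply: etrans _ (esym (integral_cube mG G0)).
apply: eq_integral => a _ /=.
have ms (b : R) : measurable_fun [set: R] (fun c => G (a, b, c)).
  exact: (measurableT_comp (measurable_section a mG) (measurable_pair1 b)).
pose K (b : R) := (\int[mu]_(c in I) G (a, b, c))%E.
have mK : measurable_fun [set: R] K.
  apply: (measurable_partial_integral mu (measurable_section a mG)) => //.
have K0 b : (0 <= K b)%E by exact: integral_ge0.
have K1 b : K (b + 1) = K b by apply: eq_integral => c _; exact: g1.
rewrite -[RHS](integral_period_shift a mK K0 K1).
apply: eq_integral => b _.
exact: (integral_period_shift a (ms (a + b)) (fun c => G0 _) (fun c => g2 _ _ _)).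
Qed.

End SignedTransfer.

(** * Triples away from the diagonals *)

Section CircleFar.
Context {R : realType}.
Local Notation T := (measurableTypeR R).
Local Notation T3 := (T * T * T)%type.
Implicit Types (e x a b c : R) (t : R * R * R).

Lemma circle_farN e x : circle_far e (- x) <-> circle_far e x.
Proof.
split=> H k; have := H (- k); rewrite rmorphN /= opprK.
  by rewrite -normrN opprD opprK.
by rewrite -opprD normrN.
Qed.

Lemma circle_farD1 e x : circle_far e (x + 1) <-> circle_far e x.
Proof.
split=> H k.
  have := H (k + 1); rewrite intrD; congr (_ <= `|_|); ring.
have := H (k - 1); rewrite intrB; congr (_ <= `|_|); ring.
Qed.

Lemma circle_far_le e e' x : e <= e' -> circle_far e' x -> circle_far e x.
Proof. by move=> ee H k; exact: le_trans (H k). Qed.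

Lemma measurable_circle_far e : measurable (circle_far e : set T).
Proof.
apply: closed_measurable.
have -> : (circle_far e : set R) = \bigcap_(k in [set: int]) [set x | e <= `|x - k%:~R|].
  by apply/seteqP; split => [x H k _|x H k]; [exact: H|exact: (H k)].
apply: closed_bigI => k _.
apply: (@closed_comp _ _ (fun x : R => `|x - k%:~R|) [set y | e <= y]); last exact: closed_ge.
move=> x _; apply: (@continuous_comp _ _ _ (fun x : R => x - k%:~R) Num.norm).
  by apply: cvgB; [exact: cvg_id|exact: cvg_cst].
exact: norm_continuous.
Qed.

Lemma circle_far_exists x : (forall k : int, x <> k%:~R) -> exists2 e, 0 < e & circle_far e x.
Proof.
move=> xk; have /andP[f1 f2] := floor_itv x.
set m := (Num.floor x)%:~R : R.
have m1 : m < x by rewrite lt_neqAle f1 andbT; apply/eqP => E; exact: (xk (Num.floor x)).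
rewrite intrD in f2.
exists (Num.min (x - m) (m + 1 - x)); first by rewrite lt_min !subr_gt0 m1.
move=> k; have [km|mk] := leP k (Num.floor x).
  have km' : k%:~R <= m by rewrite ler_int.
  rewrite ge_min; apply/orP; left.
  by rewrite ger0_norm ?subr_ge0 ?(le_trans km') ?(ltW m1)// lerD2l lerN2.
have mk' : m + 1 <= k%:~R by rewrite -[1]/(1%:~R) -intrD ler_int lezD1.
rewrite ge_min; apply/orP; right.
rewrite distrC ger0_norm ?subr_ge0 ?lerD2r//.
exact: le_trans (ltW f2) mk'.
Qed.

(* [torus3_far] in the coordinates [(u1, u2, u3)] of [intM]; unlike the coordinates
   [(u, v, w)] these make it visibly symmetric. *)
Definition pairwise_far e : set (R * R * R) :=
  [set t | [/\ circle_far e (t.1.2 - t.1.1), circle_far e (t.2 - t.1.1)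
             & circle_far e (t.1.2 - t.2)]].

Lemma pairwise_far12 e a b c : pairwise_far e (b, a, c) <-> pairwise_far e (a, b, c).
Proof.
by rewrite /pairwise_far /=; split=> -[h1 h2 h3]; split=> //; rewrite -opprB circle_farN.
Qed.

Lemma pairwise_far23 e a b c : pairwise_far e (a, c, b) <-> pairwise_far e (a, b, c).
Proof.
by rewrite /pairwise_far /=; split=> -[h1 h2 h3]; split=> //; rewrite -opprB circle_farN.
Qed.

Lemma pairwise_far_periodic2 e a b c :
  pairwise_far e (a, b + 1, c) <-> pairwise_far e (a, b, c).
Proof.
rewrite /pairwise_far /= (addrAC b 1) (addrAC b 1).
by split=> -[h1 h2 h3]; split=> //; exact/circle_farD1.
Qed.

Lemma pairwise_far_periodic3 e a b c :
  pairwise_far e (a, b, c + 1) <-> pairwise_far e (a, b, c).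
Proof.
split=> /pairwise_far23 H; apply/pairwise_far23; exact/pairwise_far_periodic2.
Qed.

Lemma measurable_pairwise_far e : measurable (pairwise_far e : set T3).
Proof.
have m1 := @measurable_proj1 R; have m2 := @measurable_proj2 R.
have m3 := @measurable_proj3 R.
have pre (f : T3 -> R) : measurable_fun setT f -> measurable [set t : T3 | circle_far e (f t)].
  move=> mf; rewrite -[X in measurable X]setTI.
  exact: (mf measurableT _ (measurable_circle_far e)).
have -> : (pairwise_far e : set T3) = [set t | circle_far e (t.1.2 - t.1.1)] `&`
    [set t | circle_far e (t.2 - t.1.1)] `&` [set t | circle_far e (t.1.2 - t.2)].
  by apply/seteqP; split => t; [case|case; case].
by do 2?apply: measurableI; apply: pre; exact: measurable_funB.
Qed.

Lemma torus3_farE e : torus3_far e =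
  torus3 `&` [set t | pairwise_far e (t.1.1, t.1.1 + t.1.2, t.1.1 + t.2)].
Proof.
have E (x y : R) : x + y - x = y by ring.
have E' (x y z : R) : x + y - (x + z) = y - z by ring.
by congr (_ `&` _); apply/seteqP; split => t; rewrite /pairwise_far /= !E E'.
Qed.

End CircleFar.

Section PrincipalValueDensity.
Context {R : realType} {n : nat}.
Local Notation T := (measurableTypeR R).
Local Notation T3 := (T * T * T)%type.
Implicit Types (f g h k : R -> 'rV[R]_n) (a b c x y : R) (t : R * R * R).

Lemma increment_reduce g x y : C1_periodic g -> exists2 z : R, `|z - y| <= 2 / 3 &
  (exists k : int, z = x + k%:~R) /\ g z = g x.
Proof.
move=> [pg _ _]; pose k := - Num.floor (x - y + 2^-1).
have /andP[f1 f2] := floor_itv (x - y + 2^-1).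
exists (x + k%:~R).
  rewrite /k rmorphN /= ler_norml; rewrite intrD in f2; apply/andP; split; lra.
by split; [exists k|exact: periodic_intr].
Qed.

Lemma increment_bounded h r x y : C1_periodic h ->
  (forall x, enorm (derive1 h x) <= r) -> enorm (h x - h y) <= r.
Proof.
move=> ch hr; have r0 : 0 <= r := le_trans (enorm_ge0 _) (hr 0).
have [z zy [_ <-]] := increment_reduce x y ch.
apply: le_trans (lipschitz_le z y ch hr) _.
by rewrite ler_piMr// (le_trans zy)//; lra.
Qed.

Lemma increment_far g c e x y : 0 < c -> bilip c g -> C1_periodic g ->
  circle_far e (x - y) -> c * e <= enorm (g x - g y).
Proof.
move=> c0 big cg far; have [z zy [[k zE] <-]] := increment_reduce x y cg.
apply: le_trans (big _ _ zy); rewrite ler_wpM2l ?(ltW c0)//.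
have := far (- k); rewrite rmorphN /= opprK zE.
by congr (_ <= `|_|); ring.
Qed.

Variables (p q : R).

(** With [pv_dist] and [pv_speed] these are the three summands of the stated formula, up to their
    coefficients, in the coordinates (u1, u2, u3) of [intM]. *)
Definition pv_wedge g h t : R :=
  psi q (wedge3 g t) (bivec (g t.1.2 - g t.1.1) (h t.2 - h t.1.1)) *
  menger_den g t.1.1 t.1.2 t.2 `^ (- p).

Definition pv_dist g h t : R :=
  enorm (wedge3 g t) `^ q * psi 0 (g t.1.2 - g t.2) (h t.1.2 - h t.2) *
  menger_den g t.1.1 t.1.2 t.2 `^ (- p).

Definition pv_speed g h t : R :=
  enorm (wedge3 g t) `^ q * edot (derive1 g t.1.1) (derive1 h t.1.1) *
  menger_den g t.1.1 t.1.2 t.2 `^ (- p).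

Definition pv_density g h t : R :=
  2 * q * pv_wedge g h t + (- 3 * p) * pv_dist g h t + 3 * pv_speed g h t.

Lemma wedge3_23 g a b c : wedge3 g (a, c, b) = - wedge3 g (a, b, c).
Proof. by rewrite /wedge3 /= bivecC. Qed.

Lemma enorm_wedge3_23 g a b c : enorm (wedge3 g (a, c, b)) = enorm (wedge3 g (a, b, c)).
Proof. by rewrite wedge3_23 enormN. Qed.

Lemma enorm_wedge3_12 g a b c : enorm (wedge3 g (b, a, c)) = enorm (wedge3 g (a, b, c)).
Proof.
have E t : enorm (wedge3 g t) = enorm (cross3 g g t) / 2.
  by rewrite cross3gg enormZ ger0_norm// mulrAC mulfV ?mul1r// pnatr_eq0.
by rewrite !E /cross3 /= cross12 enormN.
Qed.

Lemma psiNN m a (W eta : 'rV[R]_m) : psi a (- W) (- eta) = psi a W eta.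
Proof. by rewrite /psi enormN edotNl edotNr opprK. Qed.

Lemma psi_opp0 a b g h : psi 0 (g a - g b) (h a - h b) = psi 0 (g b - g a) (h b - h a).
Proof. by rewrite -(opprB (g b)) -(opprB (h b)) psiNN. Qed.

(** At unit speed the velocity factors disappear. The polarized bivector is a sum of two terms
    exchanged by swapping the last two points, and the terms of the three sides, like those of the
    three velocities, are permuted copies of a single one. *)
Lemma menger_ddens_arclength g h a b c : (forall x, enorm (derive1 g x) = 1) ->
  menger_ddens p q g h (a, b, c) =
    q * (pv_wedge g h (a, b, c) + pv_wedge g h (a, c, b)) -
    p * (pv_dist g h (a, b, c) + pv_dist g h (b, a, c) + pv_dist g h (c, a, b)) +
    (pv_speed g h (a, b, c) + pv_speed g h (b, a, c) + pv_speed g h (c, a, b)).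
Proof.
move=> g1.
have P0 x : psi 0 (derive1 g x) (derive1 h x) = edot (derive1 g x) (derive1 h x).
  by rewrite /psi g1 powR1 mul1r.
have LE : Lam (iota 0 6) (exponents p) (lengths g (a, b, c)) (lengths h (a, b, c)) =
    - p * (psi 0 (g b - g c) (h b - h c) + psi 0 (g b - g a) (h b - h a) +
           psi 0 (g c - g a) (h c - h a)) +
    (edot (derive1 g a) (derive1 h a) + edot (derive1 g b) (derive1 h b) +
     edot (derive1 g c) (derive1 h c)).
  have H (x1 x2 x3 y1 y2 y3 : R) :
      - p * x1 + (- p * x2 + (- p * x3 + (1 * y1 + (1 * y2 + (1 * y3 + 0))))) =
      - p * (x1 + x2 + x3) + (y1 + y2 + y3) by ring.
  by rewrite /Lam !big_cons big_nil /exponents /= !P0; exact: H.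
have PE : menger_Phi p g (a, b, c) = menger_den g a b c `^ (- p).
  by rewrite menger_PhiE /= (g1 a) (g1 b) (g1 c) !mulr1.
have E1 : pv_wedge g h (a, c, b) =
    psi q (wedge3 g (a, c, b)) (bivec (g c - g a) (h b - h a)) *
    menger_den g a b c `^ (- p).
  by rewrite /pv_wedge /= (menger_den23 g a b c).
have E2 : pv_dist g h (b, a, c) = enorm (wedge3 g (a, b, c)) `^ q *
    psi 0 (g c - g a) (h c - h a) * menger_den g a b c `^ (- p).
  by rewrite /pv_dist /= (enorm_wedge3_12 g a b c) (menger_den12 g a b c) psi_opp0.
have HM (w w' d d' x : R) : w = w' -> d = d' ->
    w `^ q * x * d `^ (- p) = w' `^ q * x * d' `^ (- p) by move=> -> ->.
have W' := etrans (enorm_wedge3_12 g a c b) (enorm_wedge3_23 g a b c).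
have D' := etrans (menger_den12 g a c b) (menger_den23 g a b c).
have E3 : pv_dist g h (c, a, b) = enorm (wedge3 g (a, b, c)) `^ q *
    psi 0 (g b - g a) (h b - h a) * menger_den g a b c `^ (- p).
  by rewrite /pv_dist /= psi_opp0; exact: HM W' D'.
have E4 : pv_speed g h (b, a, c) = enorm (wedge3 g (a, b, c)) `^ q *
    edot (derive1 g b) (derive1 h b) * menger_den g a b c `^ (- p).
  by rewrite /pv_speed /= (enorm_wedge3_12 g a b c) (menger_den12 g a b c).
have E5 : pv_speed g h (c, a, b) = enorm (wedge3 g (a, b, c)) `^ q *
    edot (derive1 g c) (derive1 h c) * menger_den g a b c `^ (- p).
  exact: HM W' D'.
have E6 : psi q (wedge3 g (a, b, c)) (cross3 g h (a, b, c)) =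
    psi q (wedge3 g (a, b, c)) (bivec (g b - g a) (h c - h a)) +
    psi q (wedge3 g (a, c, b)) (bivec (g c - g a) (h b - h a)).
  by rewrite (wedge3_23 g a b c) (bivecC (g c - g a) (h b - h a)) psiNN -psiD.
have H (x1 x2 y1 y2 y3 z1 z2 z3 N D : R) :
    (q * (x1 + x2) + N * (- p * (y1 + y2 + y3) + (z1 + z2 + z3))) * D =
    q * (x1 * D + x2 * D) - p * (N * y1 * D + N * y3 * D + N * y2 * D) +
    (N * z1 * D + N * z2 * D + N * z3 * D) by ring.
rewrite E1 E2 E3 E4 E5 /menger_ddens /ddens -/(menger_Phi p g (a, b, c)) PE LE E6.
exact: H.
Qed.

Lemma variation_densityE g h u v w :
  variation_density p q g h u v w = pv_density g h (u, u + v, u + w).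
Proof.
have H (A B C D E F y : R) (W eta : 'rV[R]_(n * n)) (z k : 'rV[R]_n) :
  2 * q * (enorm W `^ (q - 2) / (A * B * C) `^ p) * edot W eta
    - 3 * p * (enorm W `^ q / (A * B * C) `^ p) * (edot z k / enorm z ^+ 2)
    + 3 * (enorm W `^ q / (A * B * C) `^ p) * y =
  2 * q * (psi q W eta * (A * B * C) `^ (- p)) +
    (- 3 * p) * (enorm W `^ q * psi 0 z k * (A * B * C) `^ (- p)) +
    3 * (enorm W `^ q * y * (A * B * C) `^ (- p)).
  have H0 (v' x N di y' zi s : R) :
      2 * q * (v' * di) * x - 3 * p * (N * di) * (y' * zi) + 3 * (N * di) * s =
      2 * q * (v' * x * di) + (- 3 * p) * (N * (zi * y') * di) + 3 * (N * s * di) by ring.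
  by rewrite /psi sub0r !powRN (powR_mulrn 2 (enorm_ge0 z)); exact: H0.
rewrite /variation_density -enorm_bivec -edot_bivec /tri !addr0.
exact: H.
Qed.

Section Bounds.
Variables (g h : R -> 'rV[R]_n) (c r e : R).
Hypotheses (q1 : 1 < q) (p0 : 0 < p) (c0 : 0 < c) (big : bilip c g) (e0 : 0 < e).
Hypotheses (cg : C1_periodic g) (ch : C1_periodic h).
Hypotheses (gr : forall x, enorm (derive1 g x) <= r) (hr : forall x, enorm (derive1 h x) <= r).

Let r0 : 0 <= r. Proof. exact: le_trans (enorm_ge0 _) (gr 0). Qed.

Lemma enorm_wedge3_bounded t : enorm (wedge3 g t) <= r * r.
Proof.
apply: le_trans (enorm_bivec_le _ _) _.
by apply: ler_pM; rewrite ?enorm_ge0//; exact: increment_bounded.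
Qed.

Lemma menger_den_far t : pairwise_far e t ->
  menger_den g t.1.1 t.1.2 t.2 `^ (- p) <= ((c * e) ^+ 3) `^ (- p).
Proof.
move=> [f1 f2 f3]; have ce0 : 0 < c * e by rewrite mulr_gt0.
apply: powRN_le; [exact: ltW|exact: exprn_gt0|].
have l1 := increment_far c0 big cg f1; have l2 := increment_far c0 big cg f2.
have l3 := increment_far c0 big cg f3.
rewrite /menger_den exprS expr2 mulrA.
have ce0' := ltW ce0.
by apply: ler_pM => //; [exact: mulr_ge0|exact: ler_pM].
Qed.

(** The sides are at least c e here, which bounds the negative powers; the other factors are bounded
    through the Lipschitz constant r. *)
Lemma pv_bounded : exists K : R, forall t, pairwise_far e t ->
  [/\ `|pv_wedge g h t| <= K, `|pv_dist g h t| <= K & `|pv_speed g h t| <= K].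
Proof.
have ce0 : 0 < c * e by rewrite mulr_gt0.
pose D := ((c * e) ^+ 3) `^ (- p).
have D0 : 0 <= D by exact: powR_ge0.
pose K1 := (r * r) `^ (q - 1) * (r * r) * D.
pose K2 := (r * r) `^ q * ((c * e) `^ (- 1) * r) * D.
pose K3 := (r * r) `^ q * (r * r) * D.
have q0 : 0 <= q by move: (q1) => h1; lra.
have q10 : 0 <= q - 1 by move: (q1) => h1; lra.
have rr := mulr_ge0 r0 r0.
have K10 : 0 <= K1 by rewrite !mulr_ge0 ?powR_ge0.
have K20 : 0 <= K2 by rewrite !mulr_ge0 ?powR_ge0.
have K30 : 0 <= K3 by rewrite !mulr_ge0 ?powR_ge0.
exists (K1 + K2 + K3) => t ft; have Dt := menger_den_far ft.
have W := enorm_wedge3_bounded t; have [f1 f2 f3] := ft.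
have dn := normr_ge0; have pd := powR_ge0 (menger_den g t.1.1 t.1.2 t.2) (- p).
have Wq : enorm (wedge3 g t) `^ q <= (r * r) `^ q by apply: powR_le_mono; rewrite ?enorm_ge0.
have b1 : `|pv_wedge g h t| <= K1.
  rewrite normrM (ger0_norm pd); apply: ler_pM => //; apply: le_trans (psi_le _ _ _) _.
  apply: ler_pM; rewrite ?powR_ge0 ?enorm_ge0//.
    by apply: powR_le_mono; rewrite ?enorm_ge0.
  apply: le_trans (enorm_bivec_le _ _) _.
  apply: ler_pM; rewrite ?enorm_ge0//; exact: increment_bounded.
have b2 : `|pv_dist g h t| <= K2.
  rewrite normrM (ger0_norm pd); apply: ler_pM => //.
  rewrite normrM (ger0_norm (powR_ge0 _ _)); apply: ler_pM; rewrite ?powR_ge0//.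
  apply: le_trans (psi_le _ _ _) _; rewrite sub0r.
  apply: ler_pM; rewrite ?powR_ge0 ?enorm_ge0//; last exact: increment_bounded.
  by apply: powRN_le => //; exact: increment_far.
have b3 : `|pv_speed g h t| <= K3.
  rewrite normrM (ger0_norm pd); apply: ler_pM => //.
  rewrite normrM (ger0_norm (powR_ge0 _ _)); apply: ler_pM; rewrite ?powR_ge0//.
  apply: le_trans (cauchy_schwarz _ _) _.
  by apply: ler_pM; rewrite ?enorm_ge0.
split; lra.
Qed.

Let m1 := @measurable_proj1 R.
Let m2 := @measurable_proj2 R.
Let m3 := @measurable_proj3 R.

Let measurable_den : measurable_fun setT
  (fun t : T3 => menger_den g t.1.1 t.1.2 t.2 `^ (- p)).
Proof. by apply: measurable_powR_comp; exact: measurable_menger_den. Qed.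

Let measurable_wedge_powR : measurable_fun setT (fun t : T3 => enorm (wedge3 g t) `^ q).
Proof.
by apply: measurable_powR_comp; apply: measurable_enorm; exact: measurable_wedge3.
Qed.

Lemma measurable_pv_wedge : measurable_fun setT (pv_wedge g h : T3 -> R).
Proof.
apply: measurable_funM => //; apply: measurable_psi; first exact: measurable_wedge3.
by apply: measurable_bivec => i; exact: measurable_increment.
Qed.

Lemma measurable_pv_dist : measurable_fun setT (pv_dist g h : T3 -> R).
Proof.
do 2![apply: measurable_funM => //].
by apply: measurable_psi => i; exact: measurable_increment.
Qed.

Lemma measurable_pv_speed : measurable_fun setT (pv_speed g h : T3 -> R).
Proof.
do 2![apply: measurable_funM => //].
by apply: measurable_edot => i; exact: measurable_derive1.
Qed.

End Bounds.
End PrincipalValueDensity.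

Lemma fine_integral_sum d (T : measurableType d) (R : realType) (m : {measure set T -> \bar R})
    (D : set T) (J : Type) (s : seq J) (a : J -> R) (F : J -> T -> R) : measurable D ->
  (forall j, m.-integrable D (fun t => (F j t)%:E)) ->
  m.-integrable D (fun t => (\sum_(j <- s) a j * F j t)%:E) /\
  fine (\int[m]_(t in D) (\sum_(j <- s) a j * F j t)%:E) =
    \sum_(j <- s) a j * fine (\int[m]_(t in D) (F j t)%:E).
Proof.
move=> mD iF; elim: s => [|j s [i1 E1]].
  have -> : (fun t => (\sum_(j <- [::]) a j * F j t)%:E) = (fun=> 0%:E).
    by apply/funext => t; rewrite big_nil.
  by rewrite big_nil integral0; split => //; exact: integrable0.
have -> : (fun t => (\sum_(i <- j :: s) a i * F i t)%:E) =
    (fun t => (a j * F j t + \sum_(i <- s) a i * F i t)%:E).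
  by apply/funext => t; rewrite big_cons.
by rewrite big_cons -E1; exact: (fine_integral_lin mD (a j) (iF j) i1).
Qed.

Section PrincipalValue.
Context {R : realType} {n : nat}.
Local Notation mu := (@lebesgue_measure R).
Local Notation T := (measurableTypeR R).
Local Notation T3 := (T * T * T)%type.
Local Notation mu3 := (mu \x mu \x mu)%E.
Implicit Types (F : R * R * R -> R) (a b c x y : R) (t : R * R * R).

Let mt : measurable (torus3 : set T3). Proof. exact: measurable_torus3. Qed.

Lemma torus3_measure_lty : (mu3 torus3 < +oo)%E.
Proof.
have -> : mu3 torus3 = (\int[mu3]_(t in torus3) (fun=> 1%E) t)%E.
  by rewrite integral_cst// mul1e.
rewrite (integral_cube (F := fun=> 1%E)) => //.
under eq_integral do under eq_integral do rewrite integral_cst//.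
rewrite /= lebesgue_measure_itv /= lte_fin ltr01 -EFinB subr0.
under eq_integral do rewrite mul1e integral_cst// /= lebesgue_measure_itv /= lte_fin ltr01 -EFinB subr0 mul1e.
by rewrite integral_cst//= lebesgue_measure_itv /= lte_fin ltr01 -EFinB subr0 mul1e ltry.
Qed.

Lemma bounded_integrable F (K : R) : measurable_fun [set: T3] F -> (forall t, `|F t| <= K) ->
  mu3.-integrable torus3 (fun t => (F t)%:E).
Proof.
move=> mF FK; have K0 : 0 <= K := le_trans (normr_ge0 _) (FK (0, 0, 0)).
have [] := @integrable_dominated _ T3 R mu3 torus3 mt F (fun=> 1) K (fine (mu3 torus3))
  mF _ K0 _ _ _ => //.
- by move=> t; rewrite mulr1.
- rewrite integral_cst// mul1e fineK// ge0_fin_numE//; exact: torus3_measure_lty.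
Qed.

Definition far_part (e : R) F t : R := F t * \1_(pairwise_far e) t.

Lemma measurable_far_part e F : measurable_fun [set: T3] F ->
  measurable_fun [set: T3] (far_part e F).
Proof.
move=> mF; apply: measurable_funM => //; apply: measurable_indic.
exact: measurable_pairwise_far.
Qed.

Lemma far_part_bounded e F (K : R) : (forall t, pairwise_far e t -> `|F t| <= K) -> 0 <= K ->
  forall t, `|far_part e F t| <= K.
Proof.
move=> FK K0 t; rewrite /far_part indicE; case: (boolP (t \in _)) => [|_].
  by rewrite inE mulr1 => /FK.
by rewrite mulr0 normr0.
Qed.

Lemma far_part_comp e F (sigma : R * R * R -> R * R * R) t :
  (pairwise_far e (sigma t) <-> pairwise_far e t) ->
  far_part e F (sigma t) = far_part e (F \o sigma) t.
Proof.
move=> H; rewrite /far_part /= !indicE; congr (_ * _%:R); congr nat_of_bool.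
by apply/idP/idP; rewrite !inE => /H.
Qed.

Definition swap23 t : R * R * R := (t.1.1, t.2, t.1.2).
Definition swap12 t : R * R * R := (t.1.2, t.1.1, t.2).
Definition rotate t : R * R * R := (t.2, t.1.1, t.1.2).

Section Curves.
Variables (g h : R -> 'rV[R]_n) (p q c r : R).
Hypotheses (q1 : 1 < q) (p0 : 0 < p) (c0 : 0 < c) (big : bilip c g).
Hypotheses (cg : C1_periodic g) (ch : C1_periodic h).
Hypotheses (gr : forall x, enorm (derive1 g x) <= r) (hr : forall x, enorm (derive1 h x) <= r).
Hypothesis g1 : forall x, enorm (derive1 g x) = 1.
Hypothesis iD : mu3.-integrable torus3 (fun t => (menger_ddens p q g h t)%:E).

Let mA := @measurable_pv_wedge R n p q g h cg ch.
Let mB := @measurable_pv_dist R n p q g h cg ch.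
Let mC := @measurable_pv_speed R n p q g h cg ch.

(** Away from the diagonals each summand is bounded, so the integral may be taken term by term, and
    the domain is invariant under permutations of the points. The eight terms of the derivative thus
    give 2, 3 and 3 times the integrals of three functions, whence the coefficients 2 q, - 3 p and
    3. *)
Lemma far_part_ddens e : 0 < e ->
  fine (\int[mu3]_(t in torus3) (far_part e (menger_ddens p q g h) t)%:E) =
  fine (\int[mu3]_(t in torus3) (far_part e (pv_density p q g h) t)%:E).
Proof.
move=> e0; have [K HK] := pv_bounded q1 p0 c0 big e0 cg ch gr hr.
pose K' := `|K|; have K'0 : 0 <= K' by exact: normr_ge0.
pose A := pv_wedge p q g h; pose B := pv_dist p q g h; pose C := pv_speed p q g h.
have bA t : pairwise_far e t -> `|A t| <= K' by case/HK => H _ _; exact: le_trans (ler_norm _).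
have bB t : pairwise_far e t -> `|B t| <= K' by case/HK => _ H _; exact: le_trans (ler_norm _).
have bC t : pairwise_far e t -> `|C t| <= K' by case/HK => _ _ H; exact: le_trans (ler_norm _).
have i0 F : measurable_fun setT F -> (forall t, pairwise_far e t -> `|F t| <= K') ->
    mu3.-integrable torus3 (fun t => (far_part e F t)%:E).
  move=> mF bF; apply: (@bounded_integrable _ K'); first exact: measurable_far_part.
  exact: far_part_bounded.
have perm (sigma : R * R * R -> R * R * R) F : measurable_fun [set: T3] F ->
    measurable_fun [set: T3] (sigma : T3 -> T3) ->
    (forall t, pairwise_far e (sigma t) <-> pairwise_far e t) ->
    (forall G : T3 -> \bar R, measurable_fun setT G ->
      (\int[mu3]_(t in torus3) G (sigma t) = \int[mu3]_(t in torus3) G t)%E) ->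
    (forall t, pairwise_far e t -> `|F t| <= K') ->
    mu3.-integrable torus3 (fun t => (far_part e (F \o sigma) t)%:E) /\
    fine (\int[mu3]_(t in torus3) (far_part e (F \o sigma) t)%:E) =
      fine (\int[mu3]_(t in torus3) (far_part e F t)%:E).
  move=> mF ms fs Is bF; split.
    apply: i0; first exact: (measurableT_comp mF ms).
    by move=> t /fs /bF.
  congr fine; rewrite -(Is (fun t => (far_part e F t)%:E)); last first.
    by apply/measurable_EFinP; exact: measurable_far_part.
  by apply: eq_integral => t _; rewrite far_part_comp.
have p1 := @measurable_proj1 R; have p2 := @measurable_proj2 R.
have p3 := @measurable_proj3 R.
have ms23 : measurable_fun [set: T3] (swap23 : T3 -> T3) by exact: measurable_triple.
have ms12 : measurable_fun [set: T3] (swap12 : T3 -> T3) by exact: measurable_triple.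
have mrot : measurable_fun [set: T3] (rotate : T3 -> T3) by exact: measurable_triple.
have f23 t : pairwise_far e (swap23 t) <-> pairwise_far e t.
  by case: t => -[a b] c'; exact: pairwise_far23.
have f12 t : pairwise_far e (swap12 t) <-> pairwise_far e t.
  by case: t => -[a b] c'; exact: pairwise_far12.
have frot t : pairwise_far e (rotate t) <-> pairwise_far e t.
  by case: t => -[a b] c'; split=> [/pairwise_far12 /pairwise_far23//|H];
     apply/pairwise_far12/pairwise_far23.
have [iA2 EA2] := perm swap23 A mA ms23 f23 (@integral_torus3_swap23 R) bA.
have [iB2 EB2] := perm swap12 B mB ms12 f12 (@integral_torus3_swap12 R) bB.
have [iB3 EB3] := perm rotate B mB mrot frot (@integral_torus3_rotate R) bB.
have [iC2 EC2] := perm swap12 C mC ms12 f12 (@integral_torus3_swap12 R) bC.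
have [iC3 EC3] := perm rotate C mC mrot frot (@integral_torus3_rotate R) bC.
have iA := i0 A mA bA; have iB := i0 B mB bB; have iC := i0 C mC bC.
pose F1 (j : nat) : T3 -> R := match j with
  | 0 => far_part e A | 1 => far_part e (A \o swap23) | 2 => far_part e B
  | 3 => far_part e (B \o swap12) | 4 => far_part e (B \o rotate)
  | 5 => far_part e C | 6 => far_part e (C \o swap12) | _ => far_part e (C \o rotate) end.
have iF1 j : mu3.-integrable torus3 (fun t => (F1 j t)%:E).
  case: j => [|[|[|[|[|[|[|j]]]]]]]; [exact: iA|exact: iA2|exact: iB|exact: iB2|
    exact: iB3|exact: iC|exact: iC2|exact: iC3].
pose a1 := nth 0 [:: q; q; - p; - p; - p; 1; 1; 1].
pose F2 (j : nat) : T3 -> R := match j with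
  | 0 => far_part e A | 1 => far_part e B | _ => far_part e C end.
have iF2 j : mu3.-integrable torus3 (fun t => (F2 j t)%:E).
  by case: j => [|[|j]]; [exact: iA|exact: iB|exact: iC].
pose a2 := nth 0 [:: 2 * q; - 3 * p; 3].
have [_ S1] := fine_integral_sum (iota 0 8) a1 mt iF1.
have [_ S2] := fine_integral_sum (iota 0 3) a2 mt iF2.
have E1 t : \sum_(j <- iota 0 8) a1 j * F1 j t = far_part e (menger_ddens p q g h) t.
  case: t => -[a b] c'; rewrite !big_cons big_nil.
  have H (x1 x2 y1 y2 y3 z1 z2 z3 x : R) :
    q * (x1 * x) + (q * (x2 * x) + (- p * (y1 * x) + (- p * (y2 * x) + (- p * (y3 * x) +
      (1 * (z1 * x) + (1 * (z2 * x) + (1 * (z3 * x) + 0))))))) =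
    (q * (x1 + x2) - p * (y1 + y2 + y3) + (z1 + z2 + z3)) * x by ring.
  apply: etrans (H (A (a, b, c')) (A (a, c', b)) (B (a, b, c')) (B (b, a, c')) (B (c', a, b))
    (C (a, b, c')) (C (b, a, c')) (C (c', a, b)) (\1_(pairwise_far e) (a, b, c'))) _.
  by rewrite /far_part (menger_ddens_arclength p q h a b c' g1).
have E2 t : \sum_(j <- iota 0 3) a2 j * F2 j t = far_part e (pv_density p q g h) t.
  rewrite !big_cons big_nil.
  have H (x1 y1 z1 x : R) :
    2 * q * (x1 * x) + (- 3 * p * (y1 * x) + (3 * (z1 * x) + 0)) =
    (2 * q * x1 + - 3 * p * y1 + 3 * z1) * x by ring.
  exact: (H (A t) (B t) (C t) (\1_(pairwise_far e) t)).
have I1 : (\int[mu3]_(t in torus3) (far_part e (menger_ddens p q g h) t)%:E =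
    \int[mu3]_(t in torus3) (\sum_(j <- iota 0 8) a1 j * F1 j t)%:E)%E.
  by apply: eq_integral => t _; rewrite E1.
have I2 : (\int[mu3]_(t in torus3) (far_part e (pv_density p q g h) t)%:E =
    \int[mu3]_(t in torus3) (\sum_(j <- iota 0 3) a2 j * F2 j t)%:E)%E.
  by apply: eq_integral => t _; rewrite E2.
have H (x1 y1 z1 x2 y2 y3 z2 z3 : R) : x2 = x1 -> y2 = y1 -> y3 = y1 -> z2 = z1 -> z3 = z1 ->
  q * x1 + (q * x2 + (- p * y1 + (- p * y2 + (- p * y3 + (1 * z1 + (1 * z2 + (1 * z3 + 0))))))) =
  2 * q * x1 + (- 3 * p * y1 + (3 * z1 + 0)) by move=> -> -> -> -> ->; ring.
rewrite I1 I2 S1 S2 !big_cons !big_nil.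
exact: (H _ _ _ _ _ _ _ _ EA2 EB2 EB3 EC2 EC3).
Qed.

End Curves.
End PrincipalValue.

(** * Passage to the limit in the truncated integrals *)

Section PrincipalValueLimit.
Context {R : realType} {n : nat}.
Local Notation mu := (@lebesgue_measure R).
Local Notation T := (measurableTypeR R).
Local Notation T3 := (T * T * T)%type.
Local Notation mu3 := (mu \x mu \x mu)%E.
Implicit Types (a b x y : R) (t : R * R * R).

Let mt : measurable (torus3 : set T3). Proof. exact: measurable_torus3. Qed.

Section FarParts.
Variables (F : R * R * R -> R).
Hypothesis mF : measurable_fun [set: T3] F.
Hypothesis iF : mu3.-integrable torus3 (fun t => (F t)%:E).
Hypothesis F0 : forall t, (forall e, 0 < e -> ~ pairwise_far e t) -> F t = 0.

Lemma pairwise_far_le e e' t : e <= e' -> pairwise_far e' t -> pairwise_far e t.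
Proof. by move=> ee [h1 h2 h3]; split; exact: circle_far_le ee _. Qed.

Let absF : mu3.-integrable torus3 (fun t => `|(F t)%:E|%E).
Proof. exact: integrable_abse. Qed.

Lemma far_part_norm_le e t : `|far_part e F t| <= `|F t|.
Proof.
rewrite /far_part normrM indicE ler_piMr// ger0_norm ?ler0n//.
by rewrite -[leRHS]/(1%:R) ler_nat leq_b1.
Qed.

Lemma far_part_integrable e : mu3.-integrable torus3 (fun t => (far_part e F t)%:E).
Proof.
apply: le_integrable absF => //.
  by apply/measurable_funTS/measurable_EFinP; exact: measurable_far_part.
by move=> t _; rewrite /= lee_fin normr_id; exact: far_part_norm_le.
Qed.

(** Dominated convergence along e = 1 / (k + 1). For smaller e the omitted set shrinks and so does
    the L^1 distance to F, hence one index k settles all of them. *)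
Lemma far_part_limit : fine (\int[mu3]_(t in torus3) (far_part e F t)%:E) @[e --> 0^'+] -->
  fine (\int[mu3]_(t in torus3) (F t)%:E).
Proof.
pose f_ (k : nat) (t : T3) := (far_part k.+1%:R^-1 F t)%:E.
have mf k : measurable_fun torus3 (f_ k).
  by apply/measurable_funTS/measurable_EFinP; exact: measurable_far_part.
have mF' : measurable_fun torus3 (fun t : T3 => (F t)%:E).
  exact/measurable_funTS/measurable_EFinP.
have cv : {ae mu3, forall t, torus3 t -> f_ ^~ t @ \oo --> (F t)%:E}.
  apply: aeW => t _.
  have [[e e0 et]|/forall2NP nf] := pselect (exists2 e : R, 0 < e & pairwise_far e t).
    apply: cvg_near_cst; near=> k.
    rewrite /f_ /far_part indicE mem_set ?mulr1//.
    apply: pairwise_far_le et.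
    by apply: ltW; near: k; exact: (near_infty_natSinv_lt (PosNum e0)).
  have Ft : F t = 0.
    by apply: F0 => e e0 et; case: (nf e) => [/(_ e0)|/(_ et)].
  apply: cvg_near_cst; near=> k.
  by rewrite /f_ /far_part Ft mul0r.
have dom : {ae mu3, forall t k, torus3 t -> (`|f_ k t| <= `|(F t)%:E|)%E}.
  by apply: aeW => t k _; rewrite lee_fin far_part_norm_le.
have [_ /= lim _] := dominated_convergence mt mf mF' cv absF dom.
apply/cvgrPdist_le => eta eta0.
have : \forall k \near \oo, (\int[mu3]_(t in torus3) `|f_ k t - (F t)%:E| < eta%:E)%E.
  have /fine_cvgP[fn /cvgrPdist_lt /(_ _ eta0) cl] := lim.
  near=> k.
  have fk : (\int[mu3]_(t in torus3) `|f_ k t - (F t)%:E|)%E \is a fin_num by near: k.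
  rewrite -(fineK fk) lte_fin.
  have : `|0 - fine (\int[mu3]_(t in torus3) `|f_ k t - (F t)%:E|)%E| < eta by near: k.
  by rewrite sub0r normrN; exact: le_lt_trans (ler_norm _).
move=> /(@filter_ex _ _ _)[k Hk].
near=> e.
have e0 : 0 < e by near: e; exact: nbhs_right_gt.
have ek : e <= k.+1%:R^-1 by near: e; apply: nbhs_right_le; rewrite invr_gt0.
have [iB <-] := fine_integralB mt iF (far_part_integrable e).
rewrite -lee_fin -abse_EFin fineK; last exact: integrable_fin_num.
apply: le_trans (ltW Hk).
apply: le_trans (le_abse_integral mu3 mt _) _; first by case/integrableP: iB.
apply: integral_mono => t _ //.
rewrite /f_ -EFinB !abse_EFin lee_fin distrC /far_part !indicE.
have [/[!inE] ft|] := boolP (t \in pairwise_far k.+1%:R^-1).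
  by rewrite mem_set ?mulr1 ?subrr ?normr0//; exact: pairwise_far_le ft.
move=> _; rewrite mulr0 sub0r normrN; case: (t \in _); rewrite ?mulr1 ?subrr ?normr0//.
by rewrite mulr0 sub0r normrN.
Unshelve. all: by end_near.
Qed.

End FarParts.

Section Curves.
Variables (g h : R -> 'rV[R]_n) (p q c r : R).
Hypotheses (q1 : 1 < q) (p0 : 0 < p) (c0 : 0 < c) (big : bilip c g).
Hypotheses (cg : C1_periodic g) (ch : C1_periodic h).
Hypotheses (gr : forall x, enorm (derive1 g x) <= r) (hr : forall x, enorm (derive1 h x) <= r).
Hypothesis g1 : forall x, enorm (derive1 g x) = 1.
Hypothesis iD : mu3.-integrable torus3 (fun t => (menger_ddens p q g h t)%:E).

Let shift t : R * R * R := (t.1.1, t.1.1 + t.1.2, t.1.1 + t.2).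

Let measurable_shift : measurable_fun [set: T3] (shift : T3 -> T3).
Proof.
have m1 := @measurable_proj1 R; have m2 := @measurable_proj2 R.
have m3 := @measurable_proj3 R.
by apply: measurable_triple => //; exact: measurable_funD.
Qed.

Lemma measurable_pv_density : measurable_fun [set: T3] (pv_density p q g h : T3 -> R).
Proof.
have mA := @measurable_pv_wedge R n p q g h cg ch.
have mB := @measurable_pv_dist R n p q g h cg ch.
have mC := @measurable_pv_speed R n p q g h cg ch.
by apply: measurable_funD; [apply: measurable_funD|]; exact: measurable_funM.
Qed.

Lemma pv_density_bounded e : 0 < e -> exists2 K : R, 0 <= K &
  forall t, pairwise_far e t -> `|pv_density p q g h t| <= K.
Proof.
move=> e0; have [K HK] := pv_bounded q1 p0 c0 big e0 cg ch gr hr.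
exists ((`|2 * q| + `|- 3 * p| + 3) * `|K|) => [|t ft].
  by rewrite mulr_ge0 ?addr_ge0.
have [h1 h2 h3] := HK t ft; have KK := ler_norm K.
rewrite /pv_density; apply: le_trans (ler_normD _ _) _; rewrite [leRHS]mulrDl.
apply: lerD; first (apply: le_trans (ler_normD _ _) _; rewrite [leRHS]mulrDl; apply: lerD).
- by rewrite normrM ler_wpM2l// (le_trans h1).
- by rewrite normrM ler_wpM2l// (le_trans h2).
- by rewrite normrM (ger0_norm (_ : 0 <= 3))// ler_wpM2l// (le_trans h3).
Qed.

Let far_density e t : R := far_part e (pv_density p q g h) (shift t).

Let far_density_integrable e : 0 < e ->
  mu3.-integrable torus3 (fun t => (far_density e t)%:E).
Proof.
move=> e0; have [K K0 HK] := pv_density_bounded e0.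
apply: (@bounded_integrable R _ K).
  apply: (measurableT_comp (measurable_far_part e measurable_pv_density)).
  exact: measurable_shift.
by move=> t; exact: far_part_bounded.
Qed.

Let far_densityE e t : torus3_far e t ->
  far_density e t = variation_density p q g h t.1.1 t.1.2 t.2.
Proof.
rewrite torus3_farE => -[_ ft]; rewrite variation_densityE /far_density /far_part indicE.
by rewrite mem_set// mulr1.
Qed.

Let measurable_torus3_far e : measurable (torus3_far e : set T3).
Proof.
rewrite torus3_farE; apply: measurableI => //.
rewrite -[X in measurable X]setTI; exact: measurable_shift (measurable_pairwise_far e).
Qed.

Lemma variation_density_integrable e : 0 < e ->
  integrable3 (torus3_far e) (variation_density p q g h).
Proof.
move=> e0; have sub : (torus3_far e : set T3) `<=` torus3 by move=> t [].
have := integrableS mt (measurable_torus3_far e) sub (far_density_integrable e0).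
apply: eq_integrable => // t; rewrite inE => ft; congr EFin; exact: far_densityE.
Qed.

Let density_periodic2 e a b c' :
  far_part e (pv_density p q g h) (a, b + 1, c') = far_part e (pv_density p q g h) (a, b, c').
Proof.
have [pg _ _] := cg; have [ph _ _] := ch.
have E : pv_density p q g h (a, b + 1, c') = pv_density p q g h (a, b, c').
  rewrite /pv_density /pv_wedge /pv_dist /pv_speed /wedge3 /menger_den /=.
  by rewrite (pg b) (ph b).
rewrite /far_part E !indicE; congr (_ * _%:R); congr nat_of_bool.
by apply/idP/idP; rewrite !inE => /pairwise_far_periodic2.
Qed.

Let density_periodic3 e a b c' :
  far_part e (pv_density p q g h) (a, b, c' + 1) = far_part e (pv_density p q g h) (a, b, c').
Proof.
have [pg _ _] := cg; have [ph _ _] := ch.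
have E : pv_density p q g h (a, b, c' + 1) = pv_density p q g h (a, b, c').
  rewrite /pv_density /pv_wedge /pv_dist /pv_speed /wedge3 /menger_den /=.
  by rewrite (pg c') (ph c').
rewrite /far_part E !indicE; congr (_ * _%:R); congr nat_of_bool.
by apply/idP/idP; rewrite !inE => /pairwise_far_periodic3.
Qed.

(** The shear to (u, u + v, u + w) leads from the coordinates of the formula to the symmetric ones,
    in which [far_part_ddens] holds. *)
Lemma integral3_far e : 0 < e ->
  integral3 (torus3_far e) (variation_density p q g h) =
  (fine (\int[mu3]_(t in torus3) (far_part e (menger_ddens p q g h) t)%:E))%:E.
Proof.
move=> e0; rewrite (far_part_ddens q1 p0 c0 big cg ch gr hr g1 e0).
have mF : measurable_fun [set: T3] (fun t => (far_part e (pv_density p q g h) t)%:E).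
  apply/measurable_EFinP; exact: measurable_far_part measurable_pv_density.
have S := integral_torus3_shift mF
  (fun a b c' => congr1 EFin (density_periodic2 e a b c'))
  (fun a b c' => congr1 EFin (density_periodic3 e a b c')).
rewrite -S fineK; last exact: integrable_fin_num (far_density_integrable e0).
rewrite /integral3 torus3_farE integral_mkcondr.
apply: eq_integral => t tt; rewrite patchE; case: ifPn => ft.
  have ft' : pairwise_far e (t.1.1, t.1.1 + t.1.2, t.1.1 + t.2) := set_mem ft.
  by rewrite variation_densityE /far_part indicE (mem_set ft') mulr1.
have ft' : ~ pairwise_far e (t.1.1, t.1.1 + t.1.2, t.1.1 + t.2).
  by move=> H; move/negP: ft; apply; exact: mem_set.
by rewrite /far_part indicE (memNset ft') mulr0.
Qed.

(** A triple that is not far for any e has two coordinates differing by an integer; the denominator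
    is then 0 and, by 0^(- p) = 0, so is the derivative. Hence the truncations converge at every
    point. *)
Let ddens_off_far t : (forall e, 0 < e -> ~ pairwise_far e t) ->
  menger_ddens p q g h t = 0.
Proof.
move=> nf; apply: menger_ddens_eq0; rewrite menger_PhiE.
have int0 x y (k : int) : x - y = k%:~R -> g x - g y = 0.
  have [pg _ _] := cg; move=> E; rewrite (_ : x = y + k%:~R); last by rewrite -E; ring.
  by rewrite (periodic_intr pg) subrr.
have np : - p != 0 by rewrite oppr_eq0 gt_eqF.
suff -> : menger_den g t.1.1 t.1.2 t.2 = 0 by rewrite powR0// mul0r.
rewrite /menger_den.
have [[k /int0 ->]|/forallNP n1] := pselect (exists k : int, t.1.2 - t.1.1 = k%:~R).
  by rewrite enorm0 mulr0 mul0r.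
have [[k /int0 ->]|/forallNP n2] := pselect (exists k : int, t.2 - t.1.1 = k%:~R).
  by rewrite enorm0 mulr0.
have [[k /int0 ->]|/forallNP n3] := pselect (exists k : int, t.1.2 - t.2 = k%:~R).
  by rewrite enorm0 !mul0r.
have [e1 e10 E1] := circle_far_exists n1; have [e2 e20 E2] := circle_far_exists n2.
have [e3 e30 E3] := circle_far_exists n3.
have e0 : 0 < Num.min e1 (Num.min e2 e3) by rewrite !lt_min e10 e20.
case: (nf _ e0); split.
- by apply: circle_far_le E1; rewrite ge_min lexx.
- by apply: circle_far_le E2; rewrite !ge_min lexx orbT.
- by apply: circle_far_le E3; rewrite !ge_min lexx !orbT.
Qed.

Theorem variation_density_pv : is_pv_integral3 (variation_density p q g h)
  (fine (\int[mu3]_(t in torus3) (menger_ddens p q g h t)%:E)).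
Proof.
split; first exact: variation_density_integrable.
have mD : measurable_fun [set: T3] (menger_ddens p q g h : T3 -> R).
  exact: measurable_menger_ddens.
have L := far_part_limit mD iD ddens_off_far.
apply: (@cvg_trans _ ((fine (\int[mu3]_(t in torus3)
    (far_part e (menger_ddens p q g h) t)%:E))%:E @[e --> 0^'+])).
  apply: near_eq_cvg; near=> e; apply/esym/integral3_far.
  by near: e; exact: nbhs_right_gt.
by apply: cvg_EFin => //; near=> e.
Unshelve. all: by end_near.
Qed.

End Curves.
End PrincipalValueLimit.

Lemma arclength_everywhere (R : realType) n (g : R -> 'rV[R]_n) : C1_periodic g ->
  arclength g -> forall u, enorm (derive1 g u) = 1.
Proof.
move=> cg; apply: (@ae_everywhere _ (fun u => enorm (derive1 g u) = 1)).
have -> : ~` (fun u => enorm (derive1 g u) = 1) =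
    (fun u => enorm (derive1 g u - 0)) @^-1` [set~ 1].
  by apply/seteqP; split => u /=; rewrite subr0.
apply: open_comp; first by move=> u _; exact: continuous_derive1_dist.
by apply: closed_openC; exact: closed_eq.
Qed.

Theorem theorem3 (R : realType) (n : nat) (p q : R)
    (q_gt1 : 1 < q) (p_gt : 2 / 3 * q + 1 < p) (p_lt : p < q + 2 / 3) :
  let s := (3 * p - 2) / q - 2 in
  let X : set (R -> 'rV[R]_n) := W1s s q in
  let U : set (R -> 'rV[R]_n) :=
    [set gamma | [/\ X gamma, regular gamma & embedded gamma]] in
  ((forall gamma, U gamma -> intM p q gamma \is a fin_num) /\
   C1_on X (W1s_norm s q) U (intMr p q)) /\
  (forall gamma h : R -> 'rV[R]_n,
     X gamma -> arclength gamma -> embedded gamma -> X h ->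
     derivable (fun tau : R => intMr p q (gamma + tau *: h)) 0 1 /\
     is_pv_integral3 (variation_density p q gamma h)
       (first_variation p q gamma h)).
Proof.
move=> s X U; split; first split.
- by move=> gamma [Xg rg eg]; exact: intM_fin_num Xg rg eg.
- exact: intMr_C1.
move=> gamma h Xg ag eg Xh.
have cg := W1s_C1_periodic q_gt1 p_gt Xg; have ch := W1s_C1_periodic q_gt1 p_gt Xh.
have g1 := arclength_everywhere cg ag.
have rg : regular gamma by exists 1 => //; apply: aeW => u; rewrite g1.
have [c [rho [c0 big gc bg crho]]] := base_curve q_gt1 p_gt Xg rg eg.
have D := intMr_derivable q_gt1 p_gt p_lt c0 big gc bg crho Xh.
split; first exact: ex_derive.
have -> : first_variation p q gamma h = menger_variation p q gamma h.
  by rewrite /first_variation derive1E (@derive_val _ _ _ _ _ _ _ D).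
have [nu nu0 NE] := W1s_norm_fin Xh.
have bh := W1s_ball_of_norm q_gt1 p_gt ch nu0 (_ : W1s_norm s q h <= nu%:E)%E.
have [_ hr _] : W1s_ball q (1 + q * s) h (@embedding_const R n q s * nu).
  by apply: bh; rewrite NE.
have p0 : 0 < p by lra.
pose r := Num.max 1 (@embedding_const R n q s * nu).
have gr u : enorm (derive1 gamma u) <= r by rewrite g1 le_max lexx.
have hr' u : enorm (derive1 h u) <= r by rewrite le_max hr orbT.
have iD := menger_variation_integrable q_gt1 p_gt p_lt c0 big gc bg crho Xh.
exact: (variation_density_pv q_gt1 p0 c0 big cg ch gr hr' g1 iD).
Qed.
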